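(* Let $\varphi\in[0,\frac mn]$, let $P(t)=-\frac1n c'_\varphi(F(t))$ be the merit-with-guarantee interim allocation rule with parameter $\varphi$, and let $p^m$ be the merit-based allocation determined by $C^{allo}$ and $C^{aud}$. Then there is a lottery-based allocation rule $p^\ell$ that, together with $p^m$, induces $P$. That is, $p^m+p^\ell$ is feasible, i.e. $p_i^m(\mathbf t)+p_i^\ell(\mathbf t,s)\in\{0,1\}$ for all $i\in N$ and $\sum_{i\in N}\big(p_i^m(\mathbf t)+p^\ell_i(\mathbf t,s)\big)\le m$ for all $\mathbf t$ and $s$, and $p^m+p^\ell$ induces $P$, i.e. for every $i\in N$ and all $t\in T$, $$\mathbb E_{\mathbf t_{-i},s}\big[p_i^m(t,\mathbf t_{-i})+p_i^\ell(t,\mathbf t_{-i},s)\big]=P(t).$$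
   Context: There are $n$ agents, $N=\{1,\dots,n\}$, and $m$ identical objects with $m<n$; up to $k$ agents can be audited, where $k<m$. Types $t_1,\dots,t_n$ are drawn independently on $T=[0,1]$ from a cdf $F$ with strictly positive density; $\mathbf t=(t_1,\dots,t_n)\in T^n$, and $\mathbf t_{-i}$ omits the $i$-th coordinate. The variable $s$ is uniform on $[0,1]$, independent of the types. An allocation rule is a profile of functions $p_i:T^n\times[0,1]\to\{0,1\}$, $i\in N$, with $\sum_i p_i(\mathbf t,s)\le m$ for all $\mathbf t$ and $s$ (the argument $s$ is dropped when the rule does not depend on it). For $\varphi\in[0,\frac mn]$ and $q\in[0,1]$ (with $0^0=1$) define $$c^{allo}(q)=\sum_{i=1}^n\min\{i,m\}\binom ni(1-q)^iq^{n-i},\qquad c^{ic}_\varphi(q)=m-nq\varphi,$$ $$c^{aud}_\varphi(q)=\sum_{i=1}^n\min\{i,k\}\binom ni(1-q)^iq^{n-i}+n(1-q)\varphi,\qquad c_\varphi=\min\{c^{allo},c^{aud}_\varphi,c^{ic}_\varphi\}.$$ At points where $c_\varphi$ is not differentiable, $c_\varphi'$ denotes the right-derivative. Let $C^{allo}$ be the set of $t\in T$ with $c^{allo}(F(t))\le c^{aud}_\varphi(F(t))$ and $c^{allo}(F(t))\le c^{ic}_\varphi(F(t))$; $C^{aud}$ and $C^{ic}$ are defined analogously (the set of $t$ at which $c_\varphi^{aud}(F(t))$, respectively $c_\varphi^{ic}(F(t))$, is minimal among the three). The merit-based allocation $p^m$ is: $p_i^m(\mathbf t)=1$ if the coordinates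 of $\mathbf t$ are pairwise distinct and either (i) $t_i\in C^{allo}$ and $t_i$ is among the $m$ highest coordinates of $\mathbf t$, or (ii) $t_i\in C^{aud}$ and $t_i$ is among the $k$ highest coordinates of $\mathbf t$; otherwise $p_i^m(\mathbf t)=0$. An allocation rule $p^\ell$ is lottery-based if it allocates the objects remaining after $p^m$ to agents that did not get an object under $p^m$, in such a way that each agent $i$ with a type $t\in C^{aud}\cup C^{ic}$ gets an object under $p^\ell$ with probability $\mathbb E_{\mathbf t_{-i},s}[p_i^\ell(t,\mathbf t_{-i},s)]=\varphi$.
   Formalization: The requirement E[p^ℓ_i]=φ is imposed only for t in C^aud∪C^ic outside C^allo (at t=1 it contradicts feasibility if φ>0); E[p^m+p^ℓ]=P(t) is not claimed at t=1 when φ=m/n or k=0, where it fails; c'_φ at q=1 is the left-derivative. *)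

(* Defs.v *)
(* World: MathComp-Analysis. *)
From HB Require Import structures.
From mathcomp Require Import all_boot all_order all_algebra.
From mathcomp Require Import all_classical all_reals all_analysis.

Set Implicit Arguments.
Unset Strict Implicit.
Unset Printing Implicit Defensive.

Import Order.TTheory GRing.Theory Num.Theory.
Import numFieldNormedType.Exports.

Local Open Scope classical_set_scope.
Local Open Scope ring_scope.

Section IndependentDraws.
Context d (T : measurableType d) (R : realType).

Definition tuple_cons n (w : T * n.-tuple T) : n.+1.-tuple T :=
  [the n.+1.-tuple T of w.1 :: w.2].

Lemma measurable_tuple_cons n : measurable_fun setT (@tuple_cons n).
Proof. exact: measurable_cons. Qed.

HB.instance Definition _ n :=
  isMeasurableFun.Build _ _ _ _ (@tuple_cons n) (@measurable_tuple_cons n).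

(* The n-fold product of P, i.e. the law of n independent draws from P. *)
Fixpoint iid (P : probability T R) n : probability (n.-tuple T) R :=
  match n return probability (n.-tuple T) R with
  | 0 => dirac [tuple]
  | n'.+1 => distribution (P \x iid P n')%E (@tuple_cons n')
  end.

End IndependentDraws.

Section Types.
Context (R : realType).

(* mu is concentrated on [0, 1], with a strictly positive density f there. *)
Definition has_positive_density (mu : probability R R) (f : R -> R) :=
  [/\ measurable_fun (`[0, 1] : set R) f,
      forall t, 0 <= t <= 1 -> 0 < f t
    & forall A : set R, measurable A ->
        mu A = (\int[lebesgue_measure]_(x in A `&` `[0%R, 1%R]) (f x)%:E)%E].

Definition type_cdf (mu : probability R R) (t : R) : R :=
  fine (mu (`]-oo, t]%classic)).

Definition profile_in_T n (t : n.-tuple R) := forall i, 0 <= tnth t i <= 1.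

(* (x, t_{-i}) *)
Definition set_coord n (i : 'I_n) (x : R) (t : n.-tuple R) : n.-tuple R :=
  [tuple (if j == i then x else tnth t j) | j < n].

(* A rule with values in {0, 1}; coerced to nat wherever objects are counted.
   Only its restriction to T^n x [0, 1] is meaningful. *)
Definition rule n := 'I_n -> n.-tuple R -> R -> bool.

(* E_{t_{-i}, s}[p i (x, t_{-i}, s)].  The i-th of the n independent draws is
   overwritten by x, so that only t_{-i} is averaged over. *)
Definition interim (mu : probability R R) n
    (p : 'I_n -> n.-tuple R -> R -> nat) (i : 'I_n) (x : R) : \bar R :=
  ('E_(iid mu n \x uniform_prob (@ltr01 R))
     [fun w => (p i (set_coord i x w.1) w.2)%:R])%E.

(* Measurability is what makes the expectations of the rule meaningful. *)
Definition allocation_rule n (m : nat) (p : rule n) :=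
  (forall i, measurable_fun setT (fun w : n.-tuple R * R => p i w.1 w.2)) /\
  (forall t s, profile_in_T t -> 0 <= s <= 1 -> (\sum_(i < n) p i t s <= m)%N).

End Types.

Section MeritWithGuarantee.
Context (R : realType) (n m k : nat) (phi : R).

Definition c_allo (q : R) : R :=
  \sum_(1 <= i < n.+1)
    (minn i m)%:R * 'C(n, i)%:R * (1 - q) ^+ i * q ^+ (n - i).

Definition c_ic (q : R) : R := m%:R - n%:R * q * phi.

Definition c_aud (q : R) : R :=
  \sum_(1 <= i < n.+1)
    (minn i k)%:R * 'C(n, i)%:R * (1 - q) ^+ i * q ^+ (n - i)
  + n%:R * (1 - q) * phi.

Definition c_phi (q : R) : R :=
  Num.min (c_allo q) (Num.min (c_aud q) (c_ic q)).

(* The derivative of c_phi, with the right-derivative at kinks.  As c_phi is a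
   function on [0, 1], its one-sided derivative at q = 1 is the left one. *)
Definition c_phi' (q : R) : R :=
  if `[< derivable c_phi q 1 >] then 'D_1 c_phi q
  else if q < 1 then lim ((h^-1 * (c_phi (q + h) - c_phi q)) @[h --> 0^'+])
  else lim ((h^-1 * (c_phi (q + h) - c_phi q)) @[h --> 0^'-]).

Variable mu : probability R R.
Local Notation F := (type_cdf mu).

Definition merit_with_guarantee (t : R) : R := - n%:R^-1 * c_phi' (F t).

Definition C_allo : set R :=
  [set t | [/\ 0 <= t <= 1, c_allo (F t) <= c_aud (F t)
             & c_allo (F t) <= c_ic (F t)]].

Definition C_aud : set R :=
  [set t | [/\ 0 <= t <= 1, c_aud (F t) <= c_allo (F t)
             & c_aud (F t) <= c_ic (F t)]].

Definition C_ic : set R :=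
  [set t | [/\ 0 <= t <= 1, c_ic (F t) <= c_allo (F t)
             & c_ic (F t) <= c_aud (F t)]].

Definition among_highest (r : nat) (t : n.-tuple R) (i : 'I_n) : bool :=
  (#|[set j : 'I_n | (tnth t i < tnth t j)%R]%SET| < r)%N.

Definition p_merit (i : 'I_n) (t : n.-tuple R) : bool :=
  uniq t && ((tnth t i \in C_allo) && among_highest m t i
             || (tnth t i \in C_aud) && among_highest k t i).

(* A type in C_allo that is tied with C_aud or C_ic is treated as a C_allo
   type: it is not promised a lottery probability of phi on top of its merit
   probability.  Ties occur at finitely many types, but always at t = 1, where
   the merit probability is 1 and such a promise could not be kept. *)
Definition lottery_based (pl : rule R n) :=
  [/\ allocation_rule m pl,
      forall t s, profile_in_T t -> 0 <= s <= 1 ->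
        (\sum_(i < n) pl i t s <= m - \sum_(i < n) p_merit i t)%N,
      forall i t s, profile_in_T t -> 0 <= s <= 1 ->
        p_merit i t -> pl i t s = false
    & forall i t, t \in (C_aud `|` C_ic) `\` C_allo ->
        interim mu (fun j u s => pl j u s) i t = phi%:E].

End MeritWithGuarantee.

(* Main.v *)
From HB Require Import structures.
Require Import Defs.
From mathcomp Require Import all_boot all_order all_algebra.
From mathcomp Require Import all_classical all_reals all_analysis.
From mathcomp Require Import measurable_realfun fingroup perm.
From mathcomp Require Import ring lra zify.

Set Implicit Arguments.
Unset Strict Implicit.
Unset Printing Implicit Defensive.

Import Order.TTheory GRing.Theory Num.Theory.
Import numFieldNormedType.Exports.

Local Open Scope classical_set_scope.
Local Open Scope ring_scope.

(* The guarantee phi is the slope of c_ic and of c_aud minus its merit part, so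
   the types in C_aud and C_ic must receive phi from the m - sum_i p^m_i objects
   left over by the merit rule.  The curves cut [0, 1] into at most five
   intervals, since c_allo - c_ic is concave and c_allo - c_aud is a
   concave-convex function vanishing at 1.  Because the pieces are ordered, the
   number of leftover objects is a function of four order counts, and for every
   set B of lottery types the expected number of leftover objects that agents
   with types in B can absorb is at least n phi mu(B) (a Border inequality):
   pointwise this is an inequality between counts whose expectation compares
   values of the curves.

   Given the Border inequalities, a fractional rule minimizing the L2 distance
   of the average interim probability to phi exists by a parallelogram argument,
   and comparing it with the greedy rule that serves the most underserved types
   first shows that the distance is 0; symmetrization gives every agent phi at
   almost every type.  The exceptional types, a null set, are served on the null
   event that exactly one agent has such a type, where enough objects are left
   with enough probability.  Systematic sampling with the single uniform
   variable s turns the fractional rule into a deterministic one. *)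

Section Bernstein.
Context (R : realType).
Implicit Types (a b : nat -> R) (p : R) (n i j m : nat).

(* The expectation of [a X] for [X] binomial with parameters [n] and [p]. *)
Fixpoint bern n a p : R :=
  if n is n'.+1 then p * bern n' (fun i => a i.+1) p + (1 - p) * bern n' a p
  else a 0%N.

Definition Da a i : R := a i.+1 - a i.

Lemma bernS n a p :
  bern n.+1 a p = p * bern n (fun i => a i.+1) p + (1 - p) * bern n a p.
Proof. by []. Qed.

Lemma eq_bern n a b p : (forall i, (i <= n)%N -> a i = b i) ->
  bern n a p = bern n b p.
Proof.
elim: n a b => [|n IH] a b ab /=; first exact: ab.
by rewrite (IH (fun i => a i.+1) (fun i => b i.+1)) ?(IH a b)// => i ilen;
  apply: ab => //; exact: leqW.
Qed.

Lemma bernD n a b p :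
  bern n (fun i => a i + b i) p = bern n a p + bern n b p.
Proof. by elim: n a b => [//|n IH] a b /=; rewrite !IH; ring. Qed.

Lemma bernZ n c a p : bern n (fun i => c * a i) p = c * bern n a p.
Proof. by elim: n a => [//|n IH] a /=; rewrite !IH; ring. Qed.

Lemma bern_ge0 n a p : 0 <= p <= 1 -> (forall i, (i <= n)%N -> 0 <= a i) ->
  0 <= bern n a p.
Proof.
move=> /andP[p0 p1]; elim: n a => [|n IH] a a0 /=; first exact: a0.
by rewrite addr_ge0// mulr_ge0 ?subr_ge0// IH// => i ilen;
  apply: a0 => //; exact: leqW.
Qed.

Lemma bern_at0 n a : bern n a 0 = a 0%N.
Proof. by elim: n a => [//|n IH] a /=; rewrite !IH; ring. Qed.

Lemma bern_at1 n a : bern n a 1 = a n.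
Proof. by elim: n a => [//|n IH] a /=; rewrite !IH; ring. Qed.

Lemma bernE n a p : bern n a p =
  \sum_(i < n.+1) a i * 'C(n, i)%:R * p ^+ i * (1 - p) ^+ (n - i).
Proof.
elim: n a => [|n IH] a.
  by rewrite big_ord1 /= bin0 subnn !expr0 !mulr1.
rewrite bernS !IH [RHS]big_ord_recl [in RHS]big_ord_recr /=.
rewrite [X in p * X]big_ord_recr [X in (1 - p) * X]big_ord_recl /=.
rewrite !bin0 !subn0 subnn /bump /= !add1n !binn subnn !expr0 !exprS.
under [in RHS]eq_bigr do rewrite add1n.
under [X in (1 - p) * (_ + X)]eq_bigr do rewrite add1n.
rewrite [in RHS](_ : \sum_(i < n) _ = p * (\sum_(i < n) a i.+1 * 'C(n, i)%:R * p ^+ i * (1 - p) ^+ (n - i)) +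
  (1 - p) * (\sum_(i < n) a i.+1 * 'C(n, i.+1)%:R
     * p ^+ i.+1 * (1 - p) ^+ (n - i.+1))); first by ring.
rewrite !mulr_sumr -big_split /=; apply: eq_bigr => i _.
rewrite binS natrD subSS.
rewrite (_ : (n - i = (n - i.+1).+1)%N) ?exprS; last by have := ltn_ord i; lia.
ring.
Qed.

Lemma bern_delta n j p : (j <= n)%N ->
  bern n (fun i => (i == j)%:R) p = 'C(n, j)%:R * p ^+ j * (1 - p) ^+ (n - j).
Proof.
move=> jn; rewrite bernE.
have jn1 : (j < n.+1)%N by [].
rewrite (bigD1 (Ordinal jn1)) //= eqxx mul1r big1 ?addr0// => i ij.
rewrite (_ : (i == j :> nat) = false) ?mul0r//.
by apply: contraNF ij => /eqP ij; apply/eqP/val_inj.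
Qed.

Lemma is_derive_bern n a (p : R) :
  is_derive p 1 (bern n a) (n%:R * bern n.-1 (Da a) p).
Proof.
elim: n a => [|n IH] a.
  rewrite mul0r; exact: is_derive_cst.
have -> : bern n.+1 a = (fun p => p * bern n (fun i => a i.+1) p + (1 - p) * bern n a p).
  by apply/funext.
have d1 := IH (fun i => a i.+1).
have d2 := IH a.
apply: is_derive_eq.
rewrite /GRing.scale /=.
have -> : bern n (fun i => a i.+1) p = bern n (Da a) p + bern n a p.
  by rewrite -bernD; apply: eq_bern => i _; rewrite /Da; ring.
rewrite -[Da (fun i => a i.+1)]/(fun i => Da a i.+1).
case: n {IH} d1 d2 => [|n] d1 d2; first by rewrite /= /Da; ring.
rewrite [n.+1.-1]/= [bern n.+1 (Da a) p]bernS -[n.+2%:R]natr1.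
ring.
Qed.

End Bernstein.

Section RealFunctions.
Context (R : realType).
Implicit Types (f df : R -> R).

Lemma is_derive_continuous f df : (forall x : R, is_derive x 1 f (df x)) ->
  continuous f.
Proof.
move=> dfx x; apply/differentiable_continuous/derivable1_diffP.
by have [] := dfx x.
Qed.

Lemma mvt f df (a b : R) : (forall x : R, is_derive x 1 f (df x)) -> a < b ->
  exists c : R, [/\ a < c, c < b & f b - f a = df c * (b - a)].
Proof.
move=> dfx ab; have cf := continuous_subspaceT (is_derive_continuous dfx).
have [c] := @MVT R f df a b ab (fun x _ => dfx x) (cf _).
by rewrite in_itv /= => /andP[ac cb] e; exists c.
Qed.

Lemma chord_convex f df (u v x : R) : (forall x : R, is_derive x 1 f (df x)) ->
  (forall x y : R, u <= x -> x <= y -> y <= v -> df x <= df y) ->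
  u < x -> x < v -> (f x - f u) * (v - x) <= (f v - f x) * (x - u).
Proof.
move=> dfx mono ux xv.
have [c [uc cx ->]] := mvt dfx ux; have [d [xd dv ->]] := mvt dfx xv.
have cd : df c <= df d by apply: mono; lra.
have -> : df d * (v - x) * (x - u) = df d * ((v - x) * (x - u)) by ring.
have -> : df c * (x - u) * (v - x) = df c * ((v - x) * (x - u)) by ring.
by rewrite ler_wpM2r// mulr_ge0// subr_ge0 ltW.
Qed.

Lemma is_deriveNf f df : (forall x : R, is_derive x 1 f (df x)) ->
  forall x : R, is_derive x 1 (fun y => - f y) (- df x).
Proof. by move=> h x; have hx := h x; exact: is_deriveN. Qed.

Lemma chord_concave f df (u v x : R) : (forall x : R, is_derive x 1 f (df x)) ->
  (forall x y : R, u <= x -> x <= y -> y <= v -> df y <= df x) ->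
  u < x -> x < v -> (f v - f x) * (x - u) <= (f x - f u) * (v - x).
Proof.
move=> dfx mono ux xv.
have := @chord_convex (fun y => - f y) (fun y => - df y) u v x (is_deriveNf dfx).
move=> /(_ _ ux xv) h; rewrite -lerN2.
have : (- f x - - f u) * (v - x) <= (- f v - - f x) * (x - u).
  by apply: h => y z uy yz zv; rewrite lerN2; exact: mono.
by nra.
Qed.

Lemma concave_pos f df (z y : R) : (forall x : R, is_derive x 1 f (df x)) ->
  (forall x y : R, 0 <= x -> x <= y -> y <= z -> df y <= df x) ->
  0 <= f 0 -> 0 < f z -> 0 < y -> y <= z -> 0 < f y.
Proof.
move=> dfx mono f0 fz y0; rewrite le_eqVlt => /predU1P[->//|yz].
have h := chord_concave dfx mono y0 yz.
nra.
Qed.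

Lemma concave_convex_pos f df (u x y z : R) :
  (forall x : R, is_derive x 1 f (df x)) ->
  (forall x y : R, 0 <= x -> x <= y -> y <= u -> df y <= df x) ->
  (forall x y : R, u <= x -> x <= y -> y <= 1 -> df x <= df y) ->
  f 1 = 0 -> 0 <= x -> x < y -> y < z -> z <= 1 ->
  0 < f x -> 0 < f z -> 0 < f y.
Proof.
move=> dfx mono1 mono2 f1 x0 xy yz z1 fx fz.
have zlt1 : z < 1.
  rewrite lt_neqAle z1 andbT; apply: contraTneq fz => ->.
  by rewrite f1 ltxx.
have right y' : u <= y' -> y' < z -> 0 < f y'.
  move=> uy yz'; have h := @chord_convex f df y' 1 z dfx.
  have {h} h := h (fun a b ya ab b1 => mono2 a b (le_trans uy ya) ab b1) yz' zlt1.
  rewrite f1 in h; nra.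
have [uy|yu] := leP u y; first exact: right.
have [uz|zu] := ltP u z.
  have fu := right u (lexx u) uz.
  have h := @chord_concave f df x u y dfx
    (fun a b xa ab bu => mono1 a b (le_trans x0 xa) ab bu) xy yu.
  nra.
have h := @chord_concave f df x z y dfx
    (fun a b xa ab bz => mono1 a b (le_trans x0 xa) ab (le_trans bz zu)) xy yz.
nra.
Qed.

Lemma continuous_pos_near f (x : R) : continuous f -> 0 < f x ->
  exists2 e : R, 0 < e & forall y : R, `|y - x| < e -> 0 < f y.
Proof.
move=> cf fx; have /cvgrPdist_lt/(_ _ fx) := cf x.
move=> /nbhs_ballP[e /= e0 h]; exists e => // y yx.
have : `|f x - f y| < f x by apply: h; rewrite /ball /= distrC.
by rewrite ltr_norml => /andP[_]; lra.
Qed.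

Lemma last_pos f (a e : R) : continuous f ->
  (forall y z : R, a < y -> y < z -> z <= e -> 0 < f z -> 0 < f y) ->
  0 < f a -> a <= e -> f e <= 0 ->
  exists b : R, [/\ a < b, b <= e, f b = 0,
    (forall q : R, a <= q -> q < b -> 0 < f q) &
    (forall q : R, b <= q -> q <= e -> f q <= 0)].
Proof.
move=> cf itv fa ae fe.
pose S := [set q | a <= q <= e /\ 0 < f q].
have Sa : S a by rewrite /S /= lexx ae.
have ubS : ubound S e by move=> q [/andP[_]].
have hS : has_sup S by split; [exists a|exists e].
have aS : a <= sup S by exact: (sup_upper_bound hS).
have Se : sup S <= e by apply: ge_sup => //; exists a.
have posl q : a <= q -> q < sup S -> 0 < f q.
  rewrite le_eqVlt => /predU1P[<-//|aq] qS.
  have [z [/andP[az ze] fz] qz] := sup_gt (ex_intro _ _ Sa) qS.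
  exact: itv aq qz ze fz.
have negr q : sup S < q -> q <= e -> f q <= 0.
  move=> Sq qe; rewrite leNgt; apply/negP => fq.
  suff : q <= sup S by rewrite leNgt Sq.
  by apply: (sup_upper_bound hS); split=> //; rewrite qe andbT (le_trans aS (ltW Sq)).
have fS : f (sup S) = 0.
  apply/eqP; case: ltgtP => // h.
    have Nf : 0 < - f (sup S) by rewrite oppr_gt0.
    have cNf : continuous (fun x => - f x) by move=> x; apply: continuousN; exact: cf.
    have [d d0 hd] := @continuous_pos_near (fun x => - f x) _ cNf Nf.
    have aS' : a < sup S.
      by rewrite lt_neqAle aS andbT; apply/eqP => e0; move: h; rewrite -e0; lra.
    pose q := Num.max a (sup S - d / 2).
    have qS : q < sup S by rewrite gt_max aS' /=; lra.
    have /hd : `|q - sup S| < d.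
      rewrite distrC ger0_norm; last by lra.
      have : sup S - d / 2 <= q by rewrite le_max lexx orbT.
      lra.
    have aq : a <= q by rewrite le_max lexx.
    by have := posl q aq qS; lra.
  have [d d0 hd] := continuous_pos_near cf h.
  have Se' : sup S < e.
    by rewrite lt_neqAle Se andbT; apply/eqP => e0; move: h; rewrite e0; lra.
  pose q := Num.min e (sup S + d / 2).
  have qS : sup S < q by rewrite lt_min Se' /=; lra.
  have /hd : `|q - sup S| < d.
    rewrite ger0_norm; last by lra.
    have : q <= sup S + d / 2 by rewrite ge_min lexx orbT.
    lra.
  have qe : q <= e by rewrite ge_min lexx.
  by have := negr q qS qe; lra.
exists (sup S); split => //.
  by rewrite lt_neqAle aS andbT; apply/eqP => e0; move: fS; rewrite -e0; lra.
move=> q; rewrite le_eqVlt => /predU1P[<-|]; first by rewrite fS.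
exact: negr.
Qed.

Lemma first_pos f (c a : R) : continuous f ->
  (forall x y : R, y < a -> x < y -> c <= x -> 0 < f x -> 0 < f y) ->
  0 < f a -> c <= a -> f c <= 0 ->
  exists b : R, [/\ c <= b, b < a, f b = 0,
    (forall q : R, b < q -> q <= a -> 0 < f q) &
    (forall q : R, c <= q -> q <= b -> f q <= 0)].
Proof.
move=> cf itv fa ca fc.
have [||||| b [h1 h2 h3 h4 h5]] := @last_pos (fun x => f (- x)) (- a) (- c).
- move=> x; apply: continuous_comp; [exact: opp_continuous|exact: cf].
- by move=> y z ay yz zc; apply: itv; lra.
- by rewrite opprK.
- lra.
- by rewrite opprK.
exists (- b); split => //; [lra|lra| |].
- by move=> q bq qa; rewrite -(opprK q); apply: h4; lra.
- by move=> q bq qa; rewrite -(opprK q); apply: h5; lra.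
Qed.

Lemma derive_le0_of_left f df (a b : R) : (forall x : R, is_derive x 1 f (df x)) ->
  continuous df -> a < b -> (forall q : R, a <= q -> q < b -> f b <= f q) ->
  df b <= 0.
Proof.
move=> dfx cdf ab h; rewrite leNgt; apply/negP => dfb.
have [d d0 hd] := continuous_pos_near cdf dfb.
pose q := Num.max a (b - d / 2).
have qb : q < b by rewrite gt_max ab /=; lra.
have aq : a <= q by rewrite le_max lexx.
have dq : b - d / 2 <= q by rewrite le_max lexx orbT.
have [c [qc cb e]] := mvt dfx qb.
have : 0 < df c by apply: hd; rewrite ltr_norml; apply/andP; split; lra.
have := h q aq qb; nra.
Qed.

Lemma derive_ge0_of_right f df (a b : R) : (forall x : R, is_derive x 1 f (df x)) ->
  continuous df -> a < b -> (forall q : R, a < q -> q <= b -> f a <= f q) ->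
  0 <= df a.
Proof.
move=> dfx cdf ab h; rewrite leNgt; apply/negP => dfb.
have Ndf : 0 < - df a by rewrite oppr_gt0.
have cNdf : continuous (fun x => - df x) by move=> x; apply: continuousN; exact: cdf.
have [d d0 hd] := @continuous_pos_near (fun x => - df x) _ cNdf Ndf.
pose q := Num.min b (a + d / 2).
have qb : a < q by rewrite lt_min ab /=; lra.
have aq : q <= b by rewrite ge_min lexx.
have dq : q <= a + d / 2 by rewrite ge_min lexx orbT.
have [c [qc cb e]] := mvt dfx qb.
have : 0 < - df c by apply: hd; rewrite ltr_norml; apply/andP; split; lra.
have := h q qb aq; nra.
Qed.

Lemma pos_of_derive_pos f df (a : R) : (forall x : R, is_derive x 1 f (df x)) ->
  continuous df -> 0 <= f a -> 0 < df a ->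
  exists2 e : R, 0 < e & forall q : R, a < q -> q < a + e -> 0 < f q.
Proof.
move=> dfx cdf fa dfa; have [e e0 he] := continuous_pos_near cdf dfa.
exists e => // q aq qe; have [c [ac cq eq]] := mvt dfx aq.
have : 0 < df c by apply: he; rewrite ger0_norm; lra.
by nra.
Qed.

End RealFunctions.

(** * The three curves *)

Section Shape.
Context (R : realType) (n m k : nat) (phi : R).

(* The probability that fewer than r of the other agents have a type above
   quantile q. *)
Definition top r (q : R) : R := bern n.-1 (fun i => (i < r)%:R) (1 - q).

Definition capped r (p : R) : R := bern n (fun i => (minn i r)%:R) p.

Lemma capped_sum r q : capped r (1 - q) =
  \sum_(1 <= i < n.+1)
    (minn i r)%:R * 'C(n, i)%:R * (1 - q) ^+ i * q ^+ (n - i).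
Proof.
rewrite /capped bernE -(big_mkord xpredT (fun i =>
  (minn i r)%:R * 'C(n, i)%:R * (1 - q) ^+ i * (1 - (1 - q)) ^+ (n - i))).
rewrite big_ltn// min0n !mul0r add0r; apply: eq_bigr => i _.
by rewrite subKr.
Qed.

Lemma c_alloE q : c_allo n m q = capped m (1 - q).
Proof. by rewrite capped_sum. Qed.

Lemma c_audE q : c_aud n k phi q = capped k (1 - q) + n%:R * (1 - q) * phi.
Proof. by rewrite capped_sum. Qed.

Lemma Da_minn r i : Da (fun i => (minn i r)%:R) i = (i < r)%:R :> R.
Proof.
rewrite /Da; have [ir|ri] := ltnP i r.
  by rewrite !(minn_idPl _)// ?(ltnW ir)// -natr1 addrAC subrr add0r.
by rewrite !(minn_idPr _) ?subrr// leqW.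
Qed.

Lemma is_derive_bern1 j a (q : R) :
  is_derive q 1 (fun q => bern j a (1 - q)) (- (j%:R * bern j.-1 (Da a) (1 - q))).
Proof.
have d := @is_derive_bern R j a (1 - q).
have := @is_derive1_comp R (bern j a) (fun q => 1 - q) q _ (-1) d.
rewrite mulrN1 => h; apply: h.
by apply: is_derive_eq; rewrite add0r mul1r.
Qed.

Lemma is_derive_capped r (q : R) :
  is_derive q 1 (fun q => capped r (1 - q)) (- (n%:R * top r q)).
Proof.
have := @is_derive_bern1 n (fun i => (minn i r)%:R) q.
by rewrite (@eq_bern _ n.-1 _ (fun i => (i < r)%:R))// => i _; exact: Da_minn.
Qed.

Lemma is_derive_allo (q : R) : is_derive q 1 (c_allo n m) (- (n%:R * top m q)).
Proof.
by rewrite (_ : c_allo n m = fun q => capped m (1 - q));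
  [exact: is_derive_capped|apply/funext => x; exact: c_alloE].
Qed.

Lemma is_derive_aud (q : R) :
  is_derive q 1 (c_aud n k phi) (- (n%:R * top k q) - n%:R * phi).
Proof.
rewrite (_ : c_aud n k phi = fun q => capped k (1 - q) + n%:R * (1 - q) * phi);
  last by apply/funext => x; exact: c_audE.
have d := is_derive_capped k q.
by apply: is_derive_eq; rewrite /GRing.scale /=; ring.
Qed.

Lemma is_derive_ic (q : R) : is_derive q 1 (c_ic n m phi) (- (n%:R * phi)).
Proof.
rewrite (_ : c_ic n m phi = fun q => m%:R - n%:R * q * phi)//.
by apply: is_derive_eq; rewrite /GRing.scale /=; ring.
Qed.

Lemma top_ge0 r q : 0 <= q <= 1 -> 0 <= top r q.
Proof. by move=> q01; apply: bern_ge0 => //; lra. Qed.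

Lemma top_at0 r : (r < n)%N -> top r 0 = 0.
Proof.
by move=> rn; rewrite /top subr0 bern_at1 (_ : (n.-1 < r)%N = false)//; lia.
Qed.

Lemma top_at1 r : top r 1 = (0 < r)%:R.
Proof. by rewrite /top subrr bern_at0. Qed.

Lemma continuous_top r : continuous (top r).
Proof. exact: (is_derive_continuous (fun q => @is_derive_bern1 n.-1 _ q)). Qed.

Lemma Da_lt r i : Da (fun i => (i < r)%:R) i = - ((0 < r)%:R * (i == r.-1)%:R) :> R.
Proof.
rewrite /Da; case: r => [|r] /=; first by rewrite ?ltn0 mul0r subrr oppr0.
rewrite mul1r ltnS ltnS [(i <= r)%N]leq_eqVlt.
by case: ltngtP => //=; rewrite ?subrr ?oppr0 ?sub0r.
Qed.

Definition dens r (q : R) : R :=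
  (0 < r)%:R * ('C(n.-2, r.-1)%:R * (1 - q) ^+ r.-1 * q ^+ (n.-2 - r.-1)).

Lemma is_derive_top r (q : R) : (r < n)%N ->
  is_derive q 1 (top r) (n.-1%:R * dens r q).
Proof.
move=> rn; have := @is_derive_bern1 n.-1 (fun i => (i < r)%:R) q.
rewrite (@eq_bern _ _ _ (fun i => - 1 * ((0 < r)%:R * (i == r.-1)%:R))); last first.
  by move=> i _; rewrite Da_lt mulN1r.
rewrite bernZ bernZ bern_delta; last by lia.
by rewrite mulN1r mulrN opprK subKr.
Qed.

Lemma dens_ge0 r q : 0 <= q <= 1 -> 0 <= dens r q.
Proof.
by move=> /andP[q0 q1]; rewrite /dens !mulr_ge0// exprn_ge0// subr_ge0.
Qed.

Lemma top_mono r x y : (r < n)%N -> 0 <= x -> x <= y -> y <= 1 ->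
  top r x <= top r y.
Proof.
move=> rn x0; rewrite le_eqVlt => /predU1P[->//|xy y1].
have [c [xc cy e]] := mvt (fun q => is_derive_top q rn) xy.
have h := @dens_ge0 r c; rewrite -subr_ge0 e.
apply: mulr_ge0; last by lra.
by apply: mulr_ge0 => //; apply: h; lra.
Qed.

Hypotheses (hkm : (k < m)%N) (hmn : (m < n)%N) (hphi : 0 <= phi <= m%:R / n%:R).

Lemma dens_diff_sign : exists2 u : R, 0 <= u <= 1 &
  (forall q : R, 0 <= q <= u -> dens k q <= dens m q) /\
  (forall q : R, u < q <= 1 -> dens m q <= dens k q).
Proof.
have [k0|k0] := posnP k.
  exists 1; first by rewrite ler01 lexx.
  split => q q01; last by lra.
  by rewrite {1}/dens k0 !mul0r; exact: dens_ge0.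
pose al : R := 'C(n.-2, k.-1)%:R; pose ga : R := 'C(n.-2, m.-1)%:R.
have al0 : 0 <= al by [].
have ga0 : 0 <= ga by [].
pose be q : R := ga * (1 - q) ^+ (m - k) - al * q ^+ (m - k).
have densE q : dens m q - dens k q =
    (1 - q) ^+ k.-1 * q ^+ (n - m.+1) * be q.
  rewrite /dens k0 (leq_ltn_trans _ hkm)// /be -/al -/ga !mul1r.
  rewrite (_ : m.-1 = k.-1 + (m - k))%N; last by lia.
  rewrite (_ : n.-2 - (k.-1 + (m - k)) = n - m.+1)%N; last by lia.
  rewrite (_ : n.-2 - k.-1 = (n - m.+1) + (m - k))%N; last by lia.
  by rewrite !exprD; ring.
have be_mono (x y : R) : 0 <= x -> x <= y -> y <= 1 -> be y <= be x.
  move=> x0 xy y1; rewrite /be lerB// ler_wpM2l// lerXn2r ?nnegrE//; lra.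
have mk0 : (0 < m - k)%N by rewrite subn_gt0.
have be0 : be 0 = ga by rewrite /be subr0 expr1n expr0n gtn_eqF// mulr0 subr0 mulr1.
have be1 : be 1 = - al by rewrite /be subrr expr1n expr0n gtn_eqF// mulr0 sub0r mulr1.
have c1 : continuous (fun q : R => 1 - q).
  by move=> x; apply: cvgB; [exact: cvg_cst|exact: cvg_id].
have c2 : continuous (fun q : R => (1 - q) ^+ (m - k)).
  move=> x; exact: (@continuous_comp _ _ _ (fun q : R => 1 - q)
    (fun y : R => y ^+ (m - k)) x (c1 x) (@exprn_continuous R (m - k) (1 - x))).
have cbe : continuous be.
  move=> x; apply: cvgB; apply: cvgM; try exact: cvg_cst; first exact: c2.
  exact: exprn_continuous.
have [|u] := @IVT R be 0 1 0 ler01 (continuous_subspaceT cbe).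
  by rewrite be0 be1 ge_min le_max ga0 oppr_le0 al0 !orbT.
rewrite in_itv /= => u01 beu; exists u => //.
have pos (q : R) : 0 <= q <= 1 -> 0 <= (1 - q) ^+ k.-1 * q ^+ (n - m.+1).
  by move=> q01; rewrite mulr_ge0// exprn_ge0//; lra.
split => q q01; rewrite -subr_ge0.
  by rewrite densE mulr_ge0 ?pos//; [lra|rewrite -beu be_mono//; lra].
rewrite -oppr_le0 opprB densE mulr_ge0_le0 ?pos//; first by lra.
by rewrite -beu be_mono//; lra.
Qed.

Definition psi q := top m q - top k q.

Lemma psi_unimodal : exists2 u : R, 0 <= u <= 1 &
  (forall x y : R, 0 <= x -> x <= y -> y <= u -> psi x <= psi y) /\
  (forall x y : R, u <= x -> x <= y -> y <= 1 -> psi y <= psi x).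
Proof.
have [u u01 [h1 h2]] := dens_diff_sign; exists u => //.
have kn : (k < n)%N by exact: ltn_trans hmn.
have d (q : R) : is_derive q 1 psi (n.-1%:R * dens m q - n.-1%:R * dens k q).
  by have dm := is_derive_top q hmn; have dk := is_derive_top q kn;
    exact: is_deriveB.
split => x y x0; rewrite le_eqVlt => /predU1P[->//|xy] yu.
  have [c [xc cy e]] := mvt d xy.
  have h : dens k c <= dens m c by apply: h1; lra.
  by rewrite -subr_ge0 e -mulrBr mulr_ge0 ?mulr_ge0 ?subr_ge0// ltW.
have [c [xc cy e]] := mvt d xy.
have h : dens m c <= dens k c by apply: h2; lra.
rewrite -subr_le0 e -mulrBr mulr_le0_ge0 ?subr_ge0 ?(ltW xy)//.
by rewrite mulr_ge0_le0// subr_le0.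
Qed.

(* Quantiles are partitioned into (0, q1) and (q2, c), where only c_ic is
   minimal, [c, b), where c_aud is minimal, and [q1, q2) and [b, 1], where
   c_allo is. *)
Record regions (q1 q2 c b : R) : Prop := Regions {
  reg_le : [/\ 0 <= q1, q1 <= q2, q2 <= c, c <= b & b <= 1];
  reg_ic : forall q : R, 0 <= q < q1 \/ q2 <= q < c ->
    c_ic n m phi q <= c_aud n k phi q /\ c_ic n m phi q <= c_allo n m q;
  reg_ic_strict : forall q : R, 0 < q < q1 \/ q2 < q < c ->
    c_ic n m phi q < c_aud n k phi q /\ c_ic n m phi q < c_allo n m q;
  reg_aud : forall q : R, c <= q < b ->
    c_aud n k phi q <= c_ic n m phi q /\ c_aud n k phi q <= c_allo n m q;
  reg_aud_strict : forall q : R, c <= q < b -> q2 < q ->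
    c_aud n k phi q < c_allo n m q;
  reg_allo : forall q : R, q1 <= q < q2 \/ b <= q <= 1 ->
    c_allo n m q <= c_aud n k phi q /\ c_allo n m q <= c_ic n m phi q;
  reg_q2 : 0 < q2 -> q2 < b ->
    c_allo n m q2 <= c_aud n k phi q2 /\ c_allo n m q2 <= c_ic n m phi q2;
  reg_bot : q1 = 0 -> q2 = 0 /\ 0 < b;
  reg_c : 0 < q2 -> c = q2;
  reg_border0 : forall q : R, 0 <= q <= q1 ->
    n%:R * phi * (q1 - q) <= capped m (1 - q) - capped m (1 - q1);
  reg_border1 : forall q : R, q2 <= q <= b ->
    n%:R * phi * (b - q) <= capped m (1 - q) - capped m (1 - b)
                            - (capped k (1 - q) - capped k (1 - b)) \/
    n%:R * phi * (b - q) <= capped m (1 - q) - capped m (1 - b)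
                            - (capped k (1 - c) - capped k (1 - b));
  reg_psi_b : q2 < b -> phi <= psi b;
  reg_top_q1 : 0 < q1 -> phi <= top m q1;
  reg_psi_q2 : 0 < q2 -> q2 < b -> psi q2 <= phi }.

Definition gapI q : R := c_allo n m q - c_ic n m phi q.
Definition audI q : R := c_aud n k phi q - c_ic n m phi q.
Definition gapA q : R := c_allo n m q - c_aud n k phi q.
Definition dgapI q : R := - (n%:R * top m q) + n%:R * phi.
Definition dgapA q : R := - (n%:R * top m q) + (n%:R * top k q + n%:R * phi).
Local Notation E := gapI.
Local Notation H := audI.
Local Notation D := gapA.
Local Notation dE := dgapI.
Local Notation dD := dgapA.

Let n0 : 0 < n%:R :> R.
Proof. by rewrite ltr0n (leq_ltn_trans _ hmn). Qed.

Let phi0 : 0 <= phi. Proof. by case/andP: hphi. Qed.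

Lemma is_derive_gapI (q : R) : is_derive q 1 E (dE q).
Proof.
have d1 := is_derive_allo q; have d2 := is_derive_ic q.
by have := is_deriveB d1 d2; rewrite /dgapI opprK.
Qed.

Lemma is_derive_gapA (q : R) : is_derive q 1 D (dD q).
Proof.
have d1 := is_derive_allo q; have d2 := is_derive_aud q.
have := is_deriveB d1 d2; congr is_derive; rewrite /dgapA; ring.
Qed.

Lemma is_derive_audI (q : R) : is_derive q 1 H (- (n%:R * top k q)).
Proof.
have d1 := is_derive_aud q; have d2 := is_derive_ic q.
by have := is_deriveB d1 d2; rewrite opprK subrK.
Qed.

Let cE := is_derive_continuous is_derive_gapI.
Let cD := is_derive_continuous is_derive_gapA.
Let cH := is_derive_continuous is_derive_audI.

Lemma continuous_mtop r : continuous (fun q => n%:R * top r q).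
Proof. by move=> x; apply: cvgM; [exact: cvg_cst|exact: continuous_top]. Qed.

Lemma continuous_dgapI : continuous dE.
Proof.
move=> x; apply: cvgD; last exact: cvg_cst.
by apply: cvgN; exact: continuous_mtop.
Qed.

Lemma continuous_dgapA : continuous dD.
Proof.
move=> x; apply: cvgD; first by apply: cvgN; exact: continuous_mtop.
by apply: cvgD; [exact: continuous_mtop|exact: cvg_cst].
Qed.

Lemma gapI0 : E 0 = 0.
Proof.
rewrite /gapI c_alloE subr0 /capped bern_at1 (minn_idPr (ltnW hmn)) /c_ic.
by rewrite mulr0 mul0r subr0 subrr.
Qed.

Lemma gapA1 : D 1 = 0.
Proof.
by rewrite /gapA c_alloE c_audE subrr /capped !bern_at0 !min0n mulr0 mul0r addr0 subrr.
Qed.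

Lemma audI1 : H 1 <= 0.
Proof.
rewrite /audI c_audE subrr /capped bern_at0 min0n mulr0 mul0r addr0 /c_ic mulr1.
have : n%:R * phi <= m%:R by case/andP: hphi => _ h; rewrite mulrC -ler_pdivlMr.
lra.
Qed.

Lemma audI0 : H 0 = k%:R + n%:R * phi - m%:R.
Proof.
rewrite /audI c_audE subr0 /capped bern_at1 (minn_idPr (ltnW (ltn_trans hkm hmn))) /c_ic.
ring.
Qed.

Lemma gapA_sub q : D q = E q - H q.
Proof. by rewrite /gapA /gapI /audI; ring. Qed.

Lemma audI_mono (x y : R) : 0 <= x -> x <= y -> y <= 1 -> H y <= H x.
Proof.
move=> x0; rewrite le_eqVlt => /predU1P[->//|xy] y1.
have [c [xc cy e]] := mvt is_derive_audI xy.
have t0 : 0 <= top k c by apply: top_ge0; apply/andP; split; lra.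
have : 0 <= n%:R * top k c * (y - x).
  by rewrite !mulr_ge0 ?(ltW n0)// subr_ge0 ltW.
lra.
Qed.

Lemma dgapI_mono (x y : R) : 0 <= x -> x <= y -> y <= 1 -> dE y <= dE x.
Proof.
move=> x0 xy y1; have h := top_mono hmn x0 xy y1; rewrite /dgapI.
by rewrite lerD2r lerN2 ler_wpM2l ?(ltW n0).
Qed.

Lemma gapI_pos (z y : R) : z <= 1 -> 0 < E z -> 0 < y -> y <= z -> 0 < E y.
Proof.
move=> z1 Ez y0 yz; apply: (@concave_pos R E dE z y is_derive_gapI) => //.
  by move=> x x' x0 xx' xz; apply: dgapI_mono => //; lra.
by rewrite gapI0.
Qed.

Lemma dgapAE q : dD q = n%:R * (phi - psi q).
Proof. by rewrite /dgapA /psi; ring. Qed.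

Lemma gapA_pos (x y z : R) : 0 <= x -> x < y -> y < z -> z <= 1 ->
  0 < D x -> 0 < D z -> 0 < D y.
Proof.
have [u u01 [ps1 ps2]] := psi_unimodal.
move=> x0 xy yz z1; apply: (@concave_convex_pos R D dD u) => //.
- exact: is_derive_gapA.
- move=> a b a0 ab bu; rewrite !dgapAE ler_wpM2l ?(ltW n0)// lerD2l lerN2.
  exact: ps1.
- move=> a b a0 ab bu; rewrite !dgapAE ler_wpM2l ?(ltW n0)// lerD2l lerN2.
  exact: ps2.
exact: gapA1.
Qed.

Lemma gapA_last (q0 : R) : 0 <= q0 -> q0 <= 1 -> 0 < D q0 -> exists b : R,
  [/\ q0 < b, b <= 1, D b = 0, forall q : R, q0 <= q -> q < b -> 0 < D q &
      forall q : R, b <= q -> q <= 1 -> D q <= 0].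
Proof.
move=> q00 q01 Dq0; apply: last_pos => //; last by rewrite gapA1.
by move=> y z ay yz z1 Dz; exact: (@gapA_pos q0 y z).
Qed.

Lemma gapA_psi (q0 b : R) : q0 < b -> D b = 0 ->
  (forall q : R, q0 <= q -> q < b -> 0 < D q) -> phi <= psi b.
Proof.
move=> qb Db h.
have := @derive_le0_of_left R D dD q0 b is_derive_gapA continuous_dgapA qb.
rewrite dgapAE pmulr_rle0// subr_le0; apply=> q q0q qb'.
by rewrite Db ltW// h.
Qed.

Lemma border_gapI (q1 q : R) : E q1 = 0 -> 0 <= E q ->
  n%:R * phi * (q1 - q) <= capped m (1 - q) - capped m (1 - q1).
Proof. by rewrite /gapI !c_alloE /c_ic; lra. Qed.

Lemma border_gapA (b q : R) : D b = 0 -> 0 <= D q ->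
  n%:R * phi * (b - q) <= capped m (1 - q) - capped m (1 - b)
                            - (capped k (1 - q) - capped k (1 - b)).
Proof. by rewrite /gapA !c_alloE !c_audE; lra. Qed.

Lemma border_gapIA (b c q : R) : D b = 0 -> H c = 0 -> 0 <= E q ->
  n%:R * phi * (b - q) <= capped m (1 - q) - capped m (1 - b)
                            - (capped k (1 - c) - capped k (1 - b)).
Proof. by rewrite /gapA /audI /gapI !c_alloE !c_audE /c_ic; lra. Qed.

(* The signs of the gaps on the pieces of [0, 1] determine which of the three
   curves is lowest. *)
Lemma regions_of_signs (q1 q2 c b : R) :
  [/\ 0 <= q1, q1 <= q2, q2 <= c, c <= b & b <= 1] ->
  (forall q : R, 0 <= q < q1 \/ q2 <= q < c -> 0 <= H q /\ 0 <= E q) ->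
  (forall q : R, 0 < q < q1 \/ q2 < q < c -> 0 < H q /\ 0 < E q) ->
  (forall q : R, c <= q < b -> H q <= 0 /\ 0 <= D q) ->
  (forall q : R, c <= q < b -> q2 < q -> 0 < D q) ->
  (forall q : R, q1 <= q < q2 \/ b <= q <= 1 -> D q <= 0 /\ E q <= 0) ->
  (0 < q2 -> q2 < b -> D q2 <= 0 /\ E q2 <= 0) ->
  (q1 = 0 -> q2 = 0 /\ 0 < b) ->
  (0 < q2 -> c = q2) ->
  (0 < q1 -> E q1 = 0) ->
  (q2 < b -> D b = 0) ->
  (q2 < c -> H c = 0) ->
  (q2 < b -> phi <= psi b) ->
  (0 < q1 -> phi <= top m q1) ->
  (0 < q2 -> q2 < b -> psi q2 <= phi) ->
  regions q1 q2 c b.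
Proof.
move=> [r1 r2 r3 r4 r5] ic ics aud auds allo aq2 bot ceq Eq1 Db Hc pb tq1 pq2.
split => //.
- by move=> q /ic; rewrite /audI /gapI !subr_ge0 => -[-> ->].
- by move=> q /ics; rewrite /audI /gapI !subr_gt0 => -[-> ->].
- by move=> q /aud; rewrite /audI /gapA subr_le0 subr_ge0 => -[-> ->].
- by move=> q qc qq; have := auds q qc qq; rewrite /gapA subr_gt0.
- by move=> q /allo; rewrite /gapA /gapI !subr_le0 => -[-> ->].
- by move=> h1 h2; have := aq2 h1 h2; rewrite /gapA /gapI !subr_le0 => -[-> ->].
- move=> q /andP[q0 qq1]; have [->|q1n] := eqVneq q q1.
    by rewrite !subrr mulr0 lexx.
  have lt1 : q < q1 by rewrite lt_def eq_sym q1n.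
  apply: border_gapI; first by apply: Eq1; exact: le_lt_trans lt1.
  by have [] // := ic q; left; rewrite q0.
- move=> q /andP[q0 qb]; have [->|qnb] := eqVneq q b.
    by left; rewrite !subrr mulr0 lexx.
  have ltb : q < b by rewrite lt_def eq_sym qnb.
  have D0 := Db (le_lt_trans q0 ltb); have [ltc|gec] := ltP q c.
    right; apply: border_gapIA => //; first by apply: Hc; exact: le_lt_trans ltc.
    by have [] // := ic q; right; rewrite q0.
  by left; apply: border_gapA => //; have [] // := aud q; rewrite gec.
Qed.

Lemma regions_without_ic : H 0 <= 0 -> exists q1 q2 c b, regions q1 q2 c b.
Proof.
move=> H0.
have DE0 : D 0 = - H 0 by rewrite gapA_sub gapI0 sub0r.
have D00 : 0 <= D 0 by rewrite DE0 oppr_ge0.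
have [e e0 he] : exists2 e : R, 0 < e & forall q : R, 0 < q -> q < e -> 0 < D q.
  have [D0|D0] := ltP 0 (D 0).
    have [e e0 he] := continuous_pos_near cD D0.
    by exists e => // q q0 qe; apply: he; rewrite subr0 gtr0_norm.
  have dD0 : 0 < dD 0.
    have kn := ltn_trans hkm hmn.
    rewrite dgapAE /psi !top_at0// subrr subr0.
    have : k%:R < m%:R :> R by rewrite ltr_nat.
    by move: D0; rewrite DE0 audI0; lra.
  have [e e0 he] := pos_of_derive_pos is_derive_gapA continuous_dgapA D00 dD0.
  by exists e => // q q0 qe; apply: he; rewrite ?add0r.
pose q0 := Num.min (e / 2) 1.
have q0e : q0 <= e / 2 by rewrite ge_min lexx.
have q00 : 0 < q0 by rewrite lt_min ltr01 andbT; lra.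
have q01 : q0 <= 1 by rewrite ge_min lexx orbT.
have Dq0 : 0 < D q0 by apply: he => //; lra.
have [b [q0b b1 Db Dl Dr]] := gapA_last (ltW q00) q01 Dq0.
have Dl' (q : R) : 0 < q -> q < b -> 0 < D q.
  move=> qp qb; have [qq0|q0q] := leP q q0; last exact: Dl (ltW q0q) qb.
  by apply: he => //; lra.
have Hle (q : R) : 0 <= q -> q <= 1 -> H q <= 0.
  by move=> qp q1; apply: le_trans H0; apply: audI_mono.
have bp : 0 < b by exact: lt_trans q0b.
exists 0, 0, 0, b; apply: regions_of_signs; rewrite ?lexx ?ltxx//.
- by split => //; exact: ltW.
- by move=> q [|] /andP[/le_lt_trans h /h]; rewrite ltxx.
- by move=> q [|] /andP[/lt_trans h /h]; rewrite ltxx.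
- move=> q /andP[qp qb]; split; first by apply: Hle => //; exact: le_trans (ltW qb) b1.
  by move: qp; rewrite le_eqVlt => /predU1P[<-//|qp]; exact/ltW/Dl'.
- by move=> q /andP[_ qb] qp; exact: Dl'.
- move=> q [/andP[/le_lt_trans h /h]|/andP[bq q1]]; first by rewrite ltxx.
  have Dq := Dr q bq q1; split=> //.
  have := Hle q (le_trans (ltW bp) bq) q1; move: Dq; rewrite gapA_sub; lra.
- by move=> _; exact: gapA_psi q0b Db Dl.
Qed.

Lemma regions_ic_aud (c : R) : 0 < c -> c <= 1 -> H c = 0 ->
  (forall q : R, 0 <= q -> q < c -> 0 < H q) ->
  (forall q : R, c <= q -> q <= 1 -> H q <= 0) -> 0 < E c ->
  exists q1 q2 c b, regions q1 q2 c b.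
Proof.
move=> c0 c1 Hc Hl Hr Ec.
have Dc : 0 < D c by rewrite gapA_sub Hc subr0.
have [b [cb b1 Db Dl Dr]] := gapA_last (ltW c0) c1 Dc.
have El (q : R) : 0 < q -> q <= c -> 0 < E q by exact: gapI_pos.
exists 0, 0, c, b; apply: regions_of_signs; rewrite ?lexx ?ltxx//.
- by split => //; exact: ltW.
- move=> q [/andP[/le_lt_trans h /h]|/andP[qp qc]]; first by rewrite ltxx.
  split; first exact/ltW/Hl.
  move: qp; rewrite le_eqVlt => /predU1P[<-|qp]; first by rewrite gapI0.
  by apply/ltW/El => //; exact: ltW.
- move=> q [/andP[/lt_trans h /h]|/andP[qp qc]]; first by rewrite ltxx.
  by split; [exact: Hl (ltW qp) qc|exact: El (ltW qc)].
- move=> q /andP[cq qb]; split; last exact/ltW/Dl.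
  by apply: Hr => //; exact: le_trans (ltW qb) b1.
- by move=> q /andP[cq qb] _; exact: Dl.
- move=> q [/andP[/le_lt_trans h /h]|/andP[bq q1]]; first by rewrite ltxx.
  have Dq := Dr q bq q1; split=> //.
  have := Hr q (le_trans (ltW cb) bq) q1; move: Dq; rewrite gapA_sub; lra.
- by move=> _; split => //; exact: lt_trans cb.
- by move=> _; exact: gapA_psi cb Db Dl.
Qed.

Lemma regions_ic_allo (c : R) : 0 < c -> c <= 1 -> H c = 0 ->
  (forall q : R, 0 <= q -> q < c -> 0 < H q) ->
  (forall q : R, c <= q -> q <= 1 -> H q <= 0) -> E c <= 0 -> 0 < phi ->
  exists q1 q2 c b, regions q1 q2 c b.
Proof.
move=> c0 c1 Hc Hl Hr Ec phip.
have dE0 : 0 < dE 0.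
  by rewrite /dgapI top_at0// mulr0 oppr0 add0r mulr_gt0.
have E00 : 0 <= E 0 by rewrite gapI0.
have [e e0 he] := pos_of_derive_pos is_derive_gapI continuous_dgapI E00 dE0.
pose q0 := Num.min (e / 2) c.
have q0e : q0 <= e / 2 by rewrite ge_min lexx.
have q00 : 0 < q0 by rewrite lt_min c0 andbT; lra.
have q0c : q0 <= c by rewrite ge_min lexx orbT.
have Eq0 : 0 < E q0 by apply: he; lra.
have [q1 [q01 q1c Eq1 El Er]] : exists b : R, [/\ q0 < b, b <= c, E b = 0,
    forall q : R, q0 <= q -> q < b -> 0 < E q & forall q : R, b <= q -> q <= c -> E q <= 0].
  apply: last_pos => // y z y0 yz zc Ez.
  apply: (@gapI_pos z) => //; [exact: le_trans c1|exact: lt_trans y0|exact: ltW].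
have El' (q : R) : 0 < q -> q < q1 -> 0 < E q.
  move=> qp qb; have [qq0|q0q] := leP q q0; last exact: El (ltW q0q) qb.
  by apply: he => //; lra.
have q1p := lt_trans q00 q01.
have topq1 : phi <= top m q1.
  have := @derive_le0_of_left R E dE q0 q1 is_derive_gapI continuous_dgapI q01.
  rewrite (_ : dE q1 = n%:R * (phi - top m q1)); last by rewrite /dgapI; ring.
  rewrite pmulr_rle0// subr_le0; apply=> q q0q qb'.
  by rewrite Eq1 ltW// El.
have lowE (q : R) : 0 <= q -> q < q1 -> 0 <= E q.
  by rewrite le_eqVlt => /predU1P[<-//|qp qq1]; exact/ltW/El'.
have lowH (q : R) : 0 <= q -> q < q1 -> 0 < H q.
  by move=> qp qq1; apply: Hl => //; exact: lt_le_trans qq1 q1c.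
have midE (q : R) : q1 <= q -> q <= c -> D q <= 0 /\ E q <= 0.
  move=> q1q qc; have Eq := Er q q1q qc; split => //; rewrite gapA_sub.
  have : 0 <= H q.
    move: qc; rewrite le_eqVlt => /predU1P[->|qc]; first by rewrite Hc.
    by apply/ltW/Hl => //; exact: le_trans (ltW q1p) q1q.
  move: Eq; lra.
have [[a [ca a1 Da']]|noD] := pselect (exists a : R, [/\ c <= a, a <= 1 & 0 < D a]); last first.
  have Dn (q : R) : c <= q -> q <= 1 -> D q <= 0 /\ E q <= 0.
    move=> cq qle; have Dq : D q <= 0.
      by rewrite leNgt; apply/negP => Dq; apply: noD; exists q.
    by split => //; have := Hr q cq qle; move: Dq; rewrite gapA_sub; lra.
  exists q1, 1, 1, 1; apply: regions_of_signs; rewrite ?lexx ?ltxx//.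
  - by split; rewrite ?lexx// ?(le_trans q1c)// ltW.
  - move=> q [/andP[qp qq]|/andP[/le_lt_trans h /h]]; last by rewrite ltxx.
    by split; [exact/ltW/lowH|exact: lowE].
  - move=> q [/andP[qp qq]|/andP[/lt_trans h /h]]; last by rewrite ltxx.
    by split; [exact: lowH (ltW qp) qq|exact: El'].
  - by move=> q /andP[/le_lt_trans h /h]; rewrite ltxx.
  - by move=> q /andP[/le_lt_trans h /h]; rewrite ltxx.
  - move=> q qc; have [h1 h2] : q1 <= q /\ q <= 1.
      case: qc => /andP[h1 h2]; first by rewrite h1 ltW.
      by rewrite h2 (le_trans _ h1)// (le_trans q1c).
    by have [qc'|cq] := leP q c; [exact: midE|exact/Dn/h2/ltW].
  - by move=> q10; move: q1p; rewrite q10 ltxx.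
have [q2 [cq2 q2a Dq2 D2l D2r]] : exists b : R, [/\ c <= b, b < a, D b = 0,
    forall q : R, b < q -> q <= a -> 0 < D q & forall q : R, c <= q -> q <= b -> D q <= 0].
  apply: first_pos => //; last by rewrite gapA_sub Hc subr0.
  move=> x y ya xy cx Dx; apply: (@gapA_pos x y a) => //.
  exact: le_trans (ltW c0) cx.
have [b [ab b1 Db Dl Dr]] := gapA_last (le_trans (ltW c0) ca) a1 Da'.
have Dm (q : R) : q2 < q -> q < b -> 0 < D q.
  by move=> q2q qb; have [qa|aq] := leP q a; [exact: D2l|exact/Dl/qb/ltW].
have q2b := lt_trans q2a ab.
have Er' (q : R) : c <= q -> q <= 1 -> D q <= 0 -> E q <= 0.
  by move=> cq qle; have := Hr q cq qle; rewrite gapA_sub; lra.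
exists q1, q2, q2, b; apply: regions_of_signs; rewrite ?ltxx//.
- by split; rewrite ?lexx// ?(le_trans q1c)// ltW.
- move=> q [/andP[qp qq]|/andP[/le_lt_trans h /h]]; last by rewrite ltxx.
  by split; [exact/ltW/lowH|exact: lowE].
- move=> q [/andP[qp qq]|/andP[/lt_trans h /h]]; last by rewrite ltxx.
  by split; [exact: lowH (ltW qp) qq|exact: El'].
- move=> q /andP[qp qb]; split.
    by apply: Hr; [exact: le_trans cq2 qp|exact: le_trans (ltW qb) b1].
  by move: qp; rewrite le_eqVlt => /predU1P[<-|qp]; [rewrite Dq2|exact/ltW/Dm].
- by move=> q /andP[_ qb] qp; exact: Dm.
- move=> q [/andP[h1 h2]|/andP[h1 h2]].
    have [qc|cq] := leP q c; first exact: midE.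
    have Dq := D2r q (ltW cq) (ltW h2); split => //.
    apply: Er' => //; first exact: ltW.
    exact: le_trans (ltW h2) (le_trans (ltW q2b) b1).
  have Dq := Dr q h1 h2; split => //; apply: Er' => //.
  exact: le_trans (le_trans cq2 (ltW q2b)) h1.
- move=> _ _; rewrite Dq2; split => //; apply: Er' => //; last by rewrite Dq2.
  exact: le_trans (ltW q2b) b1.
- by move=> q10; move: q1p; rewrite q10 ltxx.
- by move=> _; exact: gapA_psi ab Db Dl.
- move=> _ _.
  have := @derive_ge0_of_right R D dD q2 a is_derive_gapA continuous_dgapA q2a.
  rewrite dgapAE pmulr_rge0// subr_ge0; apply=> q q2q qa.
  by rewrite Dq2 ltW// D2l.
Qed.

Lemma regions_exist : exists q1 q2 c b, regions q1 q2 c b.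
Proof.
have [H0|H0] := leP (H 0) 0; first exact: regions_without_ic.
have phip : 0 < phi.
  have : k%:R < m%:R :> R by rewrite ltr_nat.
  by rewrite -(pmulr_rgt0 _ n0); move: H0; rewrite audI0; lra.
have [c [c0 c1 Hc Hl Hr]] : exists b : R, [/\ 0 < b, b <= 1, H b = 0,
    forall q : R, 0 <= q -> q < b -> 0 < H q & forall q : R, b <= q -> q <= 1 -> H q <= 0].
  apply: last_pos => //; last exact: audI1.
  move=> y z y0 yz z1 Hz.
  by apply: lt_le_trans Hz _; apply: audI_mono => //; exact: ltW.
have [Ec|Ec] := ltP 0 (E c); first exact: (@regions_ic_aud c).
exact: (@regions_ic_allo c).
Qed.

End Shape.

(** * Expectations over profiles *)

Section BoundedMeasurable.
Context d (T : measurableType d) (R : realType).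
Implicit Types (f g : T -> R).

Definition bm f := measurable_fun setT f /\ exists M, forall x, `|f x| <= M.

Lemma bm_measurable f : bm f -> measurable_fun setT f. Proof. by case. Qed.

Lemma bm_intro f (M : R) : measurable_fun setT f -> (forall x, `|f x| <= M) -> bm f.
Proof. by move=> mf fM; split => //; exists M. Qed.

Lemma bm01 f : measurable_fun setT f -> (forall x, 0 <= f x <= 1) -> bm f.
Proof.
move=> mf f01; apply: (bm_intro (M := 1)) => // x.
by have /andP[? ?] := f01 x; rewrite ger0_norm.
Qed.

Lemma bm_cst c : bm (fun=> c).
Proof. by apply: (bm_intro (M := `|c|)); first exact: measurable_cst. Qed.

Lemma bmD f g : bm f -> bm g -> bm (fun x => f x + g x).
Proof.
move=> [mf [M fM]] [mg [N gN]]; apply: (bm_intro (M := M + N)).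
  exact: measurable_funD.
by move=> x; rewrite (le_trans (ler_normD _ _))// lerD.
Qed.

Lemma bmN f : bm f -> bm (fun x => - f x).
Proof.
move=> [mf [M fM]]; apply: (bm_intro (M := M)).
  exact: measurableT_comp.
by move=> x; rewrite normrN.
Qed.

Lemma bmB f g : bm f -> bm g -> bm (fun x => f x - g x).
Proof. by move=> bf bg; apply: bmD => //; exact: bmN. Qed.

Lemma bmM f g : bm f -> bm g -> bm (fun x => f x * g x).
Proof.
move=> [mf [M fM]] [mg [N gN]]; apply: (bm_intro (M := M * N)).
  exact: measurable_funM.
by move=> x; rewrite normrM ler_pM.
Qed.

Lemma bmZ c f : bm f -> bm (fun x => c * f x).
Proof. by move=> bf; apply: bmM => //; exact: bm_cst. Qed.

Lemma bmX2 f : bm f -> bm (fun x => f x ^+ 2).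
Proof.
by move=> bf; under eq_fun do rewrite expr2; exact: bmM.
Qed.

Lemma bm_sum (I : Type) (s : seq I) (Q : pred I) (F : I -> T -> R) :
  (forall i, bm (F i)) -> bm (fun x => \sum_(i <- s | Q i) F i x).
Proof.
move=> bF; elim: s => [|i s IH].
  by under eq_fun do rewrite big_nil; exact: bm_cst.
under eq_fun do rewrite big_cons; case: (Q i) => //.
exact: bmD.
Qed.

Lemma bm_bool (b : T -> bool) : measurable_fun setT b -> bm (fun x => (b x)%:R).
Proof.
move=> mb; apply: bm01; last by move=> x; case: (b x); rewrite /= ?lexx ?ler01.
rewrite (_ : (fun x => (b x)%:R) = (fun x => if b x then 1 else 0)).
  exact: measurable_fun_ifT.
by apply/funext => x; case: (b x).
Qed.

Lemma bm_max f g : bm f -> bm g -> bm (fun x => Num.max (f x) (g x)).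
Proof.
move=> [mf [M fM]] [mg [N gN]]; apply: (bm_intro (M := Num.max M N)).
  exact: measurable_maxr.
by move=> x; case: (leP (f x) (g x)) => _; rewrite le_max ?fM ?gN ?orbT.
Qed.

End BoundedMeasurable.

Lemma bm_comp d d' (T : measurableType d) (U : measurableType d') (R : realType)
    (f : U -> R) (g : T -> U) : bm f -> measurable_fun setT g -> bm (fun x => f (g x)).
Proof.
by move=> [mf [M fM]] mg; apply: (bm_intro (M := M)) => //; exact: measurableT_comp.
Qed.

Section Expectation.
Context d (T : measurableType d) (R : realType) (P : probability T R).
Implicit Types (f g : T -> R).

Definition Ex f : R := fine (\int[P]_x (f x)%:E)%E.

Lemma bm_integrable f : bm f -> P.-integrable setT (EFin \o f).
Proof.
move=> [mf [M fM]]; apply/integrableP; split; first exact/measurable_EFinP.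
apply: (@le_lt_trans _ _ (\int[P]_x M%:E)%E); last first.
  by rewrite integral_cst//= probability_setT mule1 ltry.
  apply: ge0_le_integral => //.
  by apply/measurableT_comp => //; exact/measurable_EFinP.
by move=> x _; rewrite /= lee_fin.
Qed.

Lemma Ex_fin f : bm f -> (\int[P]_x (f x)%:E)%E = (Ex f)%:E.
Proof.
by move=> bf; rewrite /Ex fineK//; apply: integrable_fin_num => //; exact: bm_integrable.
Qed.

Lemma eq_Ex f g : f =1 g -> Ex f = Ex g.
Proof. by move=> /funext ->. Qed.

Lemma Ex_cst c : Ex (fun=> c) = c.
Proof. by rewrite /Ex integral_cst//= probability_setT mule1. Qed.

Lemma ExD f g : bm f -> bm g -> Ex (fun x => f x + g x) = Ex f + Ex g.
Proof. by move=> bf bg; apply: RintegralD => //; exact: bm_integrable. Qed.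

Lemma ExB f g : bm f -> bm g -> Ex (fun x => f x - g x) = Ex f - Ex g.
Proof. by move=> bf bg; apply: RintegralB => //; exact: bm_integrable. Qed.

Lemma ExZ c f : bm f -> Ex (fun x => c * f x) = c * Ex f.
Proof. by move=> bf; apply: RintegralZl => //; exact: bm_integrable. Qed.

Lemma Ex_sum (I : Type) (s : seq I) (Q : pred I) (F : I -> T -> R) :
  (forall i, bm (F i)) ->
  Ex (fun x => \sum_(i <- s | Q i) F i x) = \sum_(i <- s | Q i) Ex (F i).
Proof.
move=> bF; elim: s => [|i s IH].
  by rewrite big_nil; under eq_Ex do rewrite big_nil; exact: Ex_cst.
rewrite big_cons; under eq_Ex do rewrite big_cons; case: (Q i) => //.
by rewrite ExD ?IH//; exact: bm_sum.
Qed.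

Lemma Ex_le f g : bm f -> bm g -> (forall x, f x <= g x) -> Ex f <= Ex g.
Proof. by move=> bf bg fg; apply: le_Rintegral => //; exact: bm_integrable. Qed.

Lemma Ex_ge0 f : (forall x, 0 <= f x) -> 0 <= Ex f.
Proof. by move=> f0; apply: Rintegral_ge0. Qed.

Lemma Ex_ae f g (N : set T) : bm f -> bm g -> measurable N -> P N = 0%E ->
  (forall x, ~ N x -> f x = g x) -> Ex f = Ex g.
Proof.
move=> bf bg mN N0 fg; congr fine.
apply: ae_eq_integral => //.
- exact/measurable_EFinP/bm_measurable.
- exact/measurable_EFinP/bm_measurable.
- exists N; split => // x /=; apply: contra_notP => Nx _.
  by rewrite fg.
Qed.

Lemma Ex_ae_le f g (N : set T) : bm f -> bm g -> measurable N -> P N = 0%E ->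
  (forall x, ~ N x -> f x <= g x) -> Ex f <= Ex g.
Proof.
move=> bf bg mN N0 fg.
have bh : bm (fun x => Num.max (f x) (g x)) by exact: bm_max.
rewrite (@Ex_ae g (fun x => Num.max (f x) (g x)) N)//.
  by apply: Ex_le => // x; rewrite le_max lexx.
by move=> x /fg/max_idPr.
Qed.

Lemma Ex_indic (A : set T) : measurable A -> Ex (fun x => (x \in A)%:R) = fine (P A).
Proof.
move=> mA; rewrite /Ex.
by under eq_integral do rewrite -indicE; rewrite integral_indic// setIT.
Qed.

Lemma Ex_eq0 f : bm f -> (forall x, 0 <= f x) -> Ex f = 0 ->
  P [set x | f x != 0] = 0%E.
Proof.
move=> bf f0 Ef; have mf := bm_measurable bf.
have : (\int[P]_x `|(EFin \o f) x| = 0)%E.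
  under eq_integral do rewrite gee0_abs ?lee_fin//=.
  by rewrite Ex_fin// Ef.
move/(ae_eq_integral_abs P measurableT ((measurable_EFinP _ _).2 mf)).1.
move=> [N [mN N0 sub]].
have mA : measurable [set x | f x != 0].
  rewrite [X in measurable X](_ : _ = f @^-1` (~` [set 0])).
    by rewrite -[X in measurable X]setTI; apply: mf => //; exact: measurableC.
  by apply/seteqP; split => x /= /eqP.
apply: (subset_measure0 _ mN) => //.
by move=> x /= fx; apply: sub => /= /(_ I) [] /eqP; rewrite (negbTE fx).
Qed.

Lemma Ex_cvg (F : (T -> R)^nat) f (M : R) :
  (forall j, measurable_fun setT (F j)) -> (forall j x, `|F j x| <= M) ->
  (forall x, F ^~ x @ \oo --> f x) -> bm f /\ (fun j => Ex (F j)) @ \oo --> Ex f.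
Proof.
move=> mF FM Ff.
have bF j : bm (F j) by exact: bm_intro (mF j) (FM j).
have EFf x : (fun j => (F j x)%:E) @ \oo --> (f x)%:E.
  by apply: cvg_EFin; [exact: nearW|exact: Ff].
have mEF j : measurable_fun setT (EFin \o F j) by exact/measurable_EFinP.
have mf : measurable_fun setT f.
  apply/measurable_EFinP.
  by apply: (@emeasurable_fun_cvg _ _ _ _ (fun j => EFin \o F j)) => // x _; exact: EFf.
have fM x : `|f x| <= M.
  have h : `|F j x| @[j --> \oo] --> `|f x| by exact: cvg_norm.
  rewrite -(cvg_lim _ h)//; apply: limr_le; first by apply/cvg_ex; exists `|f x|.
  by apply: nearW => j; exact: FM.
have bf : bm f by exact: bm_intro mf fM.
split=> //.
have iM := bm_integrable (bm_cst T M).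
have := @dominated_cvg _ T R P setT measurableT (fun j => EFin \o F j) (EFin \o f)
  (cst M%:E) mEF (fun x _ => EFf x) (fun x _ => isT) iM
  (fun j x _ => FM j x).
rewrite /= (Ex_fin bf).
under eq_fun do rewrite Ex_fin//.
by move/fine_cvgP => [].
Qed.

End Expectation.

Section Product.
Context d1 d2 (T1 : measurableType d1) (T2 : measurableType d2) (R : realType).
Variables (P1 : probability T1 R) (P2 : probability T2 R).

Lemma bm_pair1 (f : T1 * T2 -> R) x : bm f -> bm (fun y => f (x, y)).
Proof. by move=> bf; apply: bm_comp => //; exact: measurable_pair1. Qed.

Lemma bm_pair2 (f : T1 * T2 -> R) y : bm f -> bm (fun x => f (x, y)).
Proof. by move=> bf; apply: bm_comp => //; exact: measurable_pair2. Qed.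

Lemma Ex_bound d (T : measurableType d) (P : probability T R) (f : T -> R) (M : R) :
  measurable_fun setT f -> (forall x, `|f x| <= M) -> `|Ex P f| <= M.
Proof.
move=> mf fM; have bf : bm f by exact: bm_intro mf fM.
have h1 : Ex P (fun=> - M) <= Ex P f.
  apply: Ex_le => //; first exact: bm_cst.
  by move=> x; have := fM x; rewrite ler_norml => /andP[].
have h2 : Ex P f <= Ex P (fun=> M).
  apply: Ex_le => //; first exact: bm_cst.
  by move=> x; have := fM x; rewrite ler_norml => /andP[].
by rewrite !Ex_cst in h1 h2; rewrite ler_norml h1.
Qed.

Lemma bm_Ex1 (f : T1 * T2 -> R) : bm f -> bm (fun x => Ex P2 (fun y => f (x, y))).
Proof.
move=> bf; have [mf [M fM]] := bf.
apply: (bm_intro (M := M)); last first.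
  by move=> x; apply: Ex_bound => //; exact: (bm_pair1 x bf).1.
apply/measurable_EFinP.
rewrite (_ : EFin \o _ = fubini_F P2 (EFin \o f)).
  exact: (@measurable_fubini_F _ _ _ _ _ P1 P2 _ (bm_integrable (P1 \x P2)%E bf)).
by apply/funext => x; rewrite /fubini_F /= Ex_fin//; exact: bm_pair1.
Qed.

Lemma Ex_prod1 (f : T1 * T2 -> R) : bm f ->
  Ex (P1 \x P2)%E f = Ex P1 (fun x => Ex P2 (fun y => f (x, y))).
Proof.
move=> bf; rewrite {1}/Ex -integral12_prod_meas1; last exact: bm_integrable.
congr fine; apply: eq_integral => x _.
by rewrite /fubini_F /= Ex_fin//; exact: bm_pair1.
Qed.

Lemma Ex_prod2 (f : T1 * T2 -> R) : bm f ->
  Ex (P1 \x P2)%E f = Ex P2 (fun y => Ex P1 (fun x => f (x, y))).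
Proof.
move=> bf; rewrite {1}/Ex -integral21_prod_meas1; last exact: bm_integrable.
congr fine; apply: eq_integral => x _.
by rewrite /fubini_G /= Ex_fin//; exact: bm_pair2.
Qed.

Lemma Ex_swap (f : T1 * T2 -> R) : bm f ->
  Ex P1 (fun x => Ex P2 (fun y => f (x, y))) =
  Ex P2 (fun y => Ex P1 (fun x => f (x, y))).
Proof. by move=> bf; rewrite -Ex_prod1// Ex_prod2. Qed.

End Product.

Section Iid.
Context d (T : measurableType d) (R : realType) (P : probability T R).

Lemma Ex_iid0 (f : 0.-tuple T -> R) : bm f -> Ex (iid P 0) f = f [tuple].
Proof.
by move=> [mf _]; rewrite /Ex /= integral_dirac// ?diracT ?mul1e//; exact/measurable_EFinP.
Qed.

Lemma Ex_iidS n (f : n.+1.-tuple T -> R) : bm f ->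
  Ex (iid P n.+1) f = Ex P (fun x => Ex (iid P n) (fun t => f (tuple_cons (x, t)))).
Proof.
move=> bf; rewrite -[RHS](@Ex_prod1 _ _ _ _ _ _ _ (fun w => f (tuple_cons w))).
  rewrite {1}/Ex /= integral_distribution//.
    by apply/measurable_EFinP; exact: bm_measurable bf.
  exact: (bm_integrable (P \x iid P n)%E
    (bm_comp bf (@measurable_tuple_cons _ T n))).
by apply: bm_comp => //; exact: measurable_tuple_cons.
Qed.

End Iid.

Section BoundedCounts.
Context d (T : measurableType d).
Implicit Types (b : T -> bool) (c : T -> nat).

Lemma measurable_boolP b : measurable [set x | b x] <-> measurable_fun setT b.
Proof.
split=> [mb|mb].
  apply: (measurable_fun_bool true).
  by rewrite setTI (_ : _ @^-1` _ = [set x | b x]).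
rewrite (_ : [set x | b x] = b @^-1` [set true]).
  by have := mb measurableT [set true] I; rewrite setTI.
by [].
Qed.

Definition bmn c := (exists M, forall x, (c x <= M)%N) /\
  forall i, measurable_fun setT (fun x => c x == i).

Lemma measurable_nat2 c c' (q : nat -> nat -> bool) : bmn c -> bmn c' ->
  measurable_fun setT (fun x => q (c x) (c' x)).
Proof.
move=> [_ mc] [_ mc']; apply/measurable_boolP.
rewrite (_ : [set x | _] = \bigcup_i \bigcup_j
  [set x | [&& c x == i, c' x == j & q i j]]).
  apply: bigcupT_measurable => i; apply: bigcupT_measurable => j.
  apply/measurable_boolP; apply: measurable_and => //.
  by apply: measurable_and => //; exact: measurable_cst.
apply/seteqP; split => [x /= qx|x [i _ [j _ /= /and3P[/eqP -> /eqP ->]]]//].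
by exists (c x) => //; exists (c' x) => //=; rewrite !eqxx.
Qed.

Lemma bmn2 c c' (g : nat -> nat -> nat) : bmn c -> bmn c' ->
  bmn (fun x => g (c x) (c' x)).
Proof.
move=> bc bc'; split; last first.
  by move=> i; exact: (measurable_nat2 (fun u v => g u v == i) bc bc').
have [[M cM] _] := bc; have [[M' cM'] _] := bc'.
exists (\sum_(i < M.+1) \sum_(j < M'.+1) g i j)%N => x.
have cx : (c x < M.+1)%N by rewrite ltnS.
have cx' : (c' x < M'.+1)%N by rewrite ltnS.
rewrite (bigD1 (Ordinal cx))//= (bigD1 (Ordinal cx'))//=.
by rewrite -addnA leq_addr.
Qed.

Lemma bmn_cst j : bmn (fun=> j).
Proof. by split; [exists j|move=> i; exact: measurable_cst]. Qed.

Lemma bmn_bool b : measurable_fun setT b -> bmn (fun x => nat_of_bool (b x)).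
Proof.
move=> mb; split; first by exists 1%N => x; exact: leq_b1.
move=> [|[|i]].
- rewrite (_ : (fun x => _) = fun x => ~~ b x); first exact: measurable_neg.
  by apply/funext => x; case: (b x).
- rewrite (_ : (fun x => _) = b)//.
  by apply/funext => x; case: (b x).
- rewrite (_ : (fun x => _) = fun=> false); first exact: measurable_cst.
  by apply/funext => x; case: (b x).
Qed.

Lemma bmn_sum (I : Type) (s : seq I) (Q : pred I) (C : I -> T -> nat) :
  (forall i, bmn (C i)) -> bmn (fun x => \sum_(i <- s | Q i) C i x)%N.
Proof.
move=> bC; elim: s => [|i s IH].
  by under eq_fun do rewrite big_nil; exact: bmn_cst.
under eq_fun do rewrite big_cons; case: (Q i) => //.
exact: (bmn2 addn).
Qed.

Section Real.
Context (R : realType).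

Lemma bm_bmn c (F : nat -> T -> R) : bmn c -> (forall i, bm (F i)) ->
  bm (fun x => F (c x) x).
Proof.
move=> [[M cM] mc] bF.
rewrite (_ : (fun x => F (c x) x) =
    fun x => \sum_(i < M.+1) (c x == i)%:R * F i x).
  by apply: bm_sum => i; apply: bmM => //; exact: bm_bool.
apply/funext => x; have cx : (c x < M.+1)%N by rewrite ltnS.
rewrite (bigD1 (Ordinal cx))//= eqxx mul1r big1 ?addr0// => i ic.
rewrite (_ : (c x == i) = false) ?mul0r//.
by apply: contraNF ic => /eqP ci; apply/eqP/val_inj.
Qed.

Lemma bm_nat c (a : nat -> R) : bmn c -> bm (fun x => a (c x)).
Proof. by move=> bc; apply: (bm_bmn (F := fun i _ => a i)) => // i; exact: bm_cst. Qed.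

Lemma bm_nat2 c c' (a : nat -> nat -> R) : bmn c -> bmn c' ->
  bm (fun x => a (c x) (c' x)).
Proof.
move=> bc bc'; apply: (bm_bmn (F := fun i x => a i (c' x))) => // i.
exact: bm_nat.
Qed.

End Real.

End BoundedCounts.

Lemma measurable_mem d d' (T : measurableType d) (U : measurableType d')
  (f : T -> U) (A : set U) : measurable_fun setT f -> measurable A ->
  measurable_fun setT (fun x => f x \in A).
Proof.
move=> mf mA; apply: (measurable_fun_bool true).
rewrite (_ : _ @^-1` _ = f @^-1` A); first exact: mf.
by apply/seteqP; split => x /= h; [apply/set_mem|apply/mem_set].
Qed.

Section Resample.
Context (R : realType) (mu : probability R R).

Lemma measurable_set_coord d (T : measurableType d) n (i : 'I_n) (x : T -> R)
    (t : T -> n.-tuple R) : measurable_fun setT x -> measurable_fun setT t ->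
  measurable_fun setT (fun w => set_coord i (x w) (t w)).
Proof.
move=> mx mt; apply/measurable_fun_tnthP => j.
rewrite (_ : _ \o _ = fun w => if j == i then x w else tnth (t w) j).
  case: (j == i) => //.
  by apply: (measurableT_comp (measurable_tnth j)).
by apply/funext => w; rewrite /= tnth_mktuple.
Qed.

Lemma bm_set_coord n (i : 'I_n) (f : n.-tuple R -> R) x :
  bm f -> bm (fun t => f (set_coord i x t)).
Proof.
move=> bf; apply: bm_comp => //.
by apply: measurable_set_coord => //; exact: measurable_cst.
Qed.

Definition condE n (f : n.-tuple R -> R) (i : 'I_n) (x : R) :=
  Ex (iid mu n) (fun t => f (set_coord i x t)).

Lemma bm_condE n (i : 'I_n) f : bm f -> bm (condE f i).
Proof.
move=> bf; apply: (@bm_Ex1 _ _ _ _ _ mu (iid mu n)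
  (fun w => f (set_coord i w.1 w.2))).
by apply: bm_comp => //; exact: measurable_set_coord.
Qed.

Lemma set_coord0 n x y (t : n.-tuple R) :
  set_coord ord0 x (tuple_cons (y, t)) = tuple_cons (x, t).
Proof.
apply: eq_from_tnth => j; rewrite tnth_mktuple.
by case: (unliftP ord0 j) => [j' ->|->]; rewrite ?eqxx ?tnth0//= !tnthS.
Qed.

Lemma set_coordS n (i : 'I_n) x y (t : n.-tuple R) :
  set_coord (lift ord0 i) x (tuple_cons (y, t)) = tuple_cons (y, set_coord i x t).
Proof.
apply: eq_from_tnth => j; rewrite tnth_mktuple.
case: (unliftP ord0 j) => [j' ->|->]; last by rewrite /= !tnth0.
by rewrite !tnthS tnth_mktuple (inj_eq lift_inj).
Qed.

Lemma Ex_resample n (f : n.-tuple R -> R) (i : 'I_n) : bm f ->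
  Ex (iid mu n) f = Ex mu (condE f i).
Proof.
elim: n f i => [f []//|n IH] f i bf.
rewrite Ex_iidS//.
case: (unliftP ord0 i) => [i' ->|->]; last first.
  apply: eq_Ex => x; rewrite /condE Ex_iidS; last exact: bm_set_coord.
  rewrite -[LHS](Ex_cst mu); apply: eq_Ex => y; apply: eq_Ex => t.
  by rewrite set_coord0.
have E x : condE f (lift ord0 i') x = Ex mu (fun y =>
    Ex (iid mu n) (fun t => f (tuple_cons (y, set_coord i' x t)))).
  rewrite /condE Ex_iidS; last exact: bm_set_coord.
  by apply: eq_Ex => y; apply: eq_Ex => t; rewrite set_coordS.
under [RHS]eq_Ex do rewrite E.
have bg : bm (fun w : R * R => Ex (iid mu n)
    (fun t => f (tuple_cons (w.2, set_coord i' w.1 t)))).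
  apply: (@bm_Ex1 _ _ _ _ R (mu \x mu)%E (iid mu n)
    (fun w : (R * R) * n.-tuple R => f (tuple_cons (w.1.2, set_coord i' w.1.1 w.2)))).
  apply: bm_comp => //; apply: (measurableT_comp (@measurable_tuple_cons _ R n)).
  apply: measurable_fun_pair; first exact: (measurableT_comp measurable_snd).
  by apply: measurable_set_coord => //; exact: (measurableT_comp measurable_fst).
rewrite (Ex_swap _ _ bg) /=; apply: eq_Ex => y.
rewrite (IH _ i')//.
have -> : (fun t => f (tuple_cons (y, t))) = (fun t => f (tuple_cons (y, t))) by [].
apply: bm_comp => //; apply: (measurableT_comp (@measurable_tuple_cons _ R n)).
by apply: measurable_fun_pair => //; exact: measurable_cst.
Qed.

Definition permt n (s : 'S_n) (t : n.-tuple R) : n.-tuple R :=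
  [tuple tnth t (s j) | j < n].

Lemma measurable_permt n (s : 'S_n) : measurable_fun setT (permt s).
Proof.
apply/measurable_fun_tnthP => j.
rewrite (_ : _ \o _ = fun t => tnth t (s j)); first exact: measurable_tnth.
by apply/funext => w; rewrite /= tnth_mktuple.
Qed.

Lemma permtM n (s u : 'S_n) t : permt (s * u)%g t = permt s (permt u t).
Proof. by apply: eq_from_tnth => j; rewrite !tnth_mktuple permM. Qed.

Lemma permt1 n (t : n.-tuple R) : permt 1%g t = t.
Proof. by apply: eq_from_tnth => j; rewrite !tnth_mktuple perm1. Qed.

Lemma permt_set_coord n (s : 'S_n) i x t :
  permt s (set_coord (s i) x t) = set_coord i x (permt s t).
Proof.
by apply: eq_from_tnth => j; rewrite !tnth_mktuple (inj_eq perm_inj).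
Qed.

Lemma Ex_resample2 n (f : n.-tuple R -> R) (i j : 'I_n) : bm f ->
  Ex (iid mu n) f = Ex mu (fun x => Ex mu (fun y =>
    Ex (iid mu n) (fun t => f (set_coord i x (set_coord j y t))))).
Proof.
move=> bf; rewrite (Ex_resample i)//; apply: eq_Ex => x.
by rewrite {1}/condE (Ex_resample j)//; exact: bm_set_coord.
Qed.

Lemma Ex_permt n (f : n.-tuple R -> R) (s : 'S_n) : bm f ->
  Ex (iid mu n) (fun t => f (permt s t)) = Ex (iid mu n) f.
Proof.
have [ts -> all_ts] := prod_tpermP s.
elim: ts all_ts f => [_ f bf|[i j] ts IH /= /andP[ij all_ts] f bf].
  by rewrite big_nil; under eq_Ex do rewrite permt1.
rewrite big_cons /=; under eq_Ex do rewrite permtM.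
rewrite (IH all_ts (fun t => f (permt (tperm i j) t))); last first.
  by apply: bm_comp => //; exact: measurable_permt.
rewrite (Ex_resample2 i j); last by apply: bm_comp => //; exact: measurable_permt.
rewrite (Ex_resample2 i j bf).
rewrite (@Ex_swap _ _ _ _ _ mu mu (fun w => Ex (iid mu n)
  (fun t => f (permt (tperm i j) (set_coord i w.1 (set_coord j w.2 t)))))).
  apply: eq_Ex => x; apply: eq_Ex => y; apply: eq_Ex => t; congr f.
  apply: eq_from_tnth => l; rewrite !tnth_mktuple.
  rewrite /dpair /= in ij.
  case: tpermP => [->|->|/eqP li /eqP lj].
  - by rewrite eqxx eq_sym (negbTE ij) eqxx.
  - by rewrite !eqxx eq_sym (negbTE ij).
  - by rewrite (negbTE li) (negbTE lj).
apply: (@bm_Ex1 _ _ _ _ R (mu \x mu)%E (iid mu n) (fun w : (R * R) * n.-tuple R => f (permt (tperm i j)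
   (set_coord i w.1.1 (set_coord j w.1.2 w.2))))).
apply: bm_comp => //; apply: (measurableT_comp (measurable_permt _)).
apply: measurable_set_coord; first exact: (measurableT_comp measurable_fst).
by apply: measurable_set_coord => //; exact: (measurableT_comp measurable_snd).
Qed.

Definition cnt n (Q : pred 'I_n) (S : set R) (t : n.-tuple R) : nat :=
  \sum_(j < n) (Q j && (tnth t j \in S)).

Lemma bmn_cnt n (Q : pred 'I_n) (S : set R) : measurable S -> bmn (@cnt n Q S).
Proof.
move=> mS; apply: bmn_sum => j; apply: bmn_bool.
apply: measurable_and; first exact: measurable_cst.
by apply: measurable_mem => //; exact: measurable_tnth.
Qed.

Lemma Ex_cnt n (Q : pred 'I_n) (S : set R) (a : nat -> R) : measurable S ->
  Ex (iid mu n) (fun t => a (cnt Q S t)) =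
  bern (\sum_(j < n) Q j)%N a (fine (mu S)).
Proof.
move=> mS; elim: n Q a => [|n IH] Q a.
  by rewrite Ex_iid0; [rewrite /cnt !big_ord0|apply: bm_nat; exact: bmn_cnt].
rewrite Ex_iidS; last by apply: bm_nat; exact: bmn_cnt.
rewrite big_ord_recl.
have E x t : cnt Q S (tuple_cons (x, t)) =
   ((Q ord0 && (x \in S)) + cnt (fun j => Q (lift ord0 j)) S t)%N.
  rewrite /cnt big_ord_recl /= tnth0; congr (_ + _)%N.
  by apply: eq_bigr => j _; rewrite tnthS.
under eq_Ex do under eq_Ex do rewrite E.
case: (Q ord0) => /=; last first.
  by rewrite add0n; under eq_Ex do rewrite (IH _ a); rewrite Ex_cst.
under eq_Ex do rewrite (IH _ (fun c => a (_ + c)%N)).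
set p := fine _; set N := (\sum_(i < n) _)%N.
rewrite (_ : (fun x => _) = fun x : R => (x \in S)%:R *
    (bern N (fun i => a i.+1) p - bern N a p) + bern N a p); last first.
  apply/funext => x; case: (x \in S) => /=; last by rewrite mul0r add0r.
  by rewrite mul1r subrK.
have bS : bm (fun x : R => (x \in S)%:R : R).
  by apply: bm_bool; apply: measurable_mem.
rewrite ExD; [|by apply: bmM => //; exact: bm_cst|exact: bm_cst].
rewrite Ex_cst; under eq_Ex do rewrite mulrC.
by rewrite ExZ// Ex_indic// -/p add0n; ring.
Qed.

End Resample.

(** * Fractional rules with a prescribed interim probability *)

Lemma card_rank_lt (I : finType) (A : {set I}) (bef : rel I) (r : nat) :
  {in A, irreflexive bef} -> {in A & &, transitive bef} ->
  {in A &, forall i j, i != j -> bef i j || bef j i} ->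
  #|[set i in A | (#|[set j in A | bef j i]%SET| < r)%N]%SET| = minn r #|A|.
Proof.
move=> irr tr tot.
pose rk i := #|[set j in A | bef j i]%SET|.
have rk_lt i j : i \in A -> j \in A -> bef i j -> (rk i < rk j)%N.
  move=> iA jA ij; apply: proper_card; apply/properP; split.
    apply/fintype.subsetP => l; rewrite !inE => /andP[lA li]; rewrite lA /=.
    exact: (tr i).
  by exists i; rewrite !inE iA ?ij// irr.
have rkA i : i \in A -> (rk i < #|A|)%N.
  move=> iA; apply: proper_card; apply/properP; split.
    by apply/fintype.subsetP => l; rewrite !inE => /andP[].
  by exists i => //; rewrite !inE iA irr.
have rk_inj : {in A &, injective rk}.
  move=> i j iA jA; apply: contra_eq => /(tot i j iA jA) /orP[] /rk_lt.
    by move=> /(_ iA jA); rewrite ltn_neqAle => /andP[].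
  by move=> /(_ jA iA); rewrite ltn_neqAle eq_sym => /andP[].
pose s := [seq rk i | i <- enum A].
have us : uniq s.
  by rewrite map_inj_in_uniq ?enum_uniq// => i j; rewrite !mem_enum; exact: rk_inj.
have sA : {subset s <= iota 0 #|A|}.
  by move=> x /mapP[i]; rewrite mem_enum => iA ->; rewrite mem_iota rkA.
have ps : perm_eq s (iota 0 #|A|).
  apply: uniq_perm => //; first exact: iota_uniq.
  have := uniq_min_size us sA.
  by rewrite size_iota size_map -cardE leqnn => /(_ isT) [].
have -> : #|[set i in A | (rk i < r)%N]%SET| = (\sum_(j <- s) (j < r))%N.
  rewrite /s big_map -sum1_card big_enum /= [RHS]big_mkcond /= [LHS]big_mkcond /=.
  by apply: eq_bigr => i _; rewrite !inE; case: (i \in A) => //=; case: ltnP.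
rewrite (perm_big _ ps) /=.
have -> : (\sum_(j <- iota 0 #|A|) (j < r) = \sum_(0 <= j < #|A|) (j < r))%N.
  by rewrite /index_iota subn0.
elim: #|A| => [|m IH]; first by rewrite big_geq// minn0.
rewrite big_nat_recr//= IH; case: ltnP; lia.
Qed.

Lemma layer_count (R : realType) (N : nat) (z : R) : 0 <= z <= N%:R ->
  z - 1 <= \sum_(l < N) ((l.+1%:R <= z)%R)%:R <= z.
Proof.
elim: N z => [|N IH] z /andP[z0 zN].
  by rewrite big_ord0; move: zN => /=; lra.
rewrite big_ord_recr /=.
have [zN1|Nz] := leP z N%:R.
  have /IH : 0 <= z <= N%:R by rewrite z0.
  have -> : (N.+1%:R <= z) = false by apply/negbTE; rewrite -ltNge -natr1; lra.
  by rewrite addr0.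
rewrite (eq_bigr (fun=> 1)); last first.
  move=> l _; rewrite (le_trans _ (ltW Nz))// ler_nat; exact: ltn_ord.
rewrite sumr_const card_ord.
have [h|h] := leP N.+1%:R z => /=; rewrite -natr1 in h zN *; lra.
Qed.

Section MinSeq.
Context (R : realType) (T : Type) (C : set T) (mid : T -> T -> T)
  (dv nr : T -> R) (ds : T -> T -> R) (M : R).
Hypotheses (C0 : C !=set0) (Cmid : forall x y, C x -> C y -> C (mid x y))
  (dv0 : forall x, C x -> 0 <= dv x) (nr0 : forall x, C x -> 0 <= nr x <= M)
  (dvmid : forall x y, C x -> C y -> dv (mid x y) <= Num.max (dv x) (dv y))
  (paral : forall x y, C x -> C y -> ds x y <= 2 * nr x + 2 * nr y - 4 * nr (mid x y)).

(* Almost minimizers of dv whose nr is almost least among them: by the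
   parallelogram law they form a Cauchy sequence. *)
Lemma cauchy_minimizing_seq : exists u : nat -> T,
  [/\ forall j, C (u j), forall x j, C x -> dv (u j) <= dv x + 2^-1 ^+ j &
      forall j, ds (u j) (u j.+1) <= 4^-1 ^+ j].
Proof.
have [x0 Cx0] := C0.
pose d0 := inf (dv @` C).
have lbd : has_lbound (dv @` C) by exists 0 => _ [x Cx <-]; exact: dv0.
have d0le x : C x -> d0 <= dv x by move=> Cx; apply: ge_inf => //; exists x.
pose S e := [set x | C x /\ dv x <= d0 + e].
have S0 e : 0 < e -> S e !=set0.
  move=> e0; have [|_ [x Cx <-] xe] := @inf_adherent _ (dv @` C) e e0.
    by split => //; exists (dv x0); exists x0.
  by exists x; split => //; exact: ltW.
pose nu e := inf (nr @` S e).
have lbn e : has_lbound (nr @` S e).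
  by exists 0 => _ [x [Cx _] <-]; have /andP[] := nr0 Cx.
have nule e x : S e x -> nu e <= nr x by move=> Sx; apply: ge_inf => //; exists x.
pose V := nu @` [set e | 0 < e].
have ubV : has_ubound V.
  exists M => _ [e /= e0 <-]; have [x Sx] := S0 e e0.
  by apply: le_trans (nule _ _ Sx) _; have /andP[] := nr0 Sx.1.
have supV : has_sup V by split => //; exists (nu 1); exists 1 => //=.
pose nu0 := sup V.
have nu0le e : 0 < e -> nu e <= nu0.
  by move=> e0; apply: (sup_upper_bound supV); exists e.
have numono e e' : 0 < e -> e <= e' -> nu e' <= nu e.
  move=> e0 ee'; apply: lb_le_inf; first by have [x Sx] := S0 e e0; exists (nr x); exists x.
  move=> _ [x [Cx xe] <-]; apply: nule; split => //.
  by rewrite (le_trans xe)// lerD2l.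
pose del j : R := 8^-1 * 4^-1 ^+ j.
have del0 j : 0 < del j by rewrite mulr_gt0// exprn_gt0.
have : forall j, exists e, [/\ 0 < e, e <= 2^-1 ^+ j & nu0 - del j < nu e].
  move=> j; have [_ [e /= e0 <-] he] := sup_adherent (del0 j) supV.
  have p0 : 0 < 2^-1 ^+ j :> R by rewrite exprn_gt0.
  exists (Num.min e (2^-1 ^+ j)); split.
  - by rewrite lt_min e0.
  - by rewrite ge_min lexx orbT.
  - by apply: lt_le_trans he _; apply: numono; rewrite ?lt_min ?e0// ge_min lexx.
move=> /choice[e he].
have : forall j, exists x, S (e j) x /\ nr x <= nu (e j) + del j.
  move=> j; have [ej0 _ _] := he j.
  have [|_ [x Sx <-] xe] := @inf_adherent _ (nr @` S (e j)) (del j) (del0 j).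
    by split => //; have [x Sx] := S0 _ ej0; exists (nr x); exists x.
  by exists x; split => //; exact: ltW.
move=> /choice[u hu]; exists u; split.
- by move=> j; have [[]] := hu j.
- move=> x j Cx; have [[_ h] _] := hu j; have [_ ej _] := he j.
  by apply: le_trans h _; apply: lerD => //; exact: d0le.
move=> j; have [[Cj dj] nj] := hu j; have [[Cj1 dj1] nj1] := hu j.+1.
have [ej0 _ hej] := he j; have [ej10 _ hej1] := he j.+1.
apply: le_trans (paral Cj Cj1) _.
have Cm := Cmid Cj Cj1.
have delS : del j.+1 <= del j.
  rewrite /del exprS ler_wpM2l// ler_piMl// ?exprn_ge0//.
  by rewrite invf_le1// ler1n.
have nm : nu0 - del j <= nr (mid (u j) (u j.+1)).
  have [em|em] := leP (e j) (e j.+1).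
    apply: (@le_trans _ _ (nu (e j.+1))); first by lra.
    apply: nule; split => //; apply: le_trans (dvmid Cj Cj1) _.
    by rewrite ge_max dj1 (le_trans dj)// lerD2l.
  apply: (@le_trans _ _ (nu (e j))); first by lra.
  apply: nule; split => //; apply: le_trans (dvmid Cj Cj1) _.
  by rewrite ge_max dj (le_trans dj1)// lerD2l ltW.
have := nu0le _ ej0; have := nu0le _ ej10.
have -> : 4^-1 ^+ j = 8 * del j by rewrite /del mulrA divff// mul1r.
lra.
Qed.

End MinSeq.

Lemma summable_ae d (T : measurableType d) (R : realType) (P : probability T R)
    (g : nat -> T -> R) (c : R) : (forall j, bm (g j)) -> (forall j x, 0 <= g j x) ->
  (forall j, Ex P (g j) <= c * 2^-1 ^+ j) ->
  exists N, [/\ measurable N, P N = 0%E &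
    forall x, ~ N x -> exists M, forall l, \sum_(j < l) g j x <= M].
Proof.
move=> bg g0 Eg.
have mg j : measurable_fun setT (EFin \o g j) by exact/measurable_EFinP/bm_measurable.
pose G x := (\sum_(j <oo) (g j x)%:E)%E.
have c0 : 0 <= c.
  by have := Eg 0%N; rewrite expr0 mulr1; apply: le_trans; exact: Ex_ge0.
have G0 x : (0 <= G x)%E by apply: nneseries_ge0 => j _ _; rewrite lee_fin.
have mG : measurable_fun setT G.
  rewrite (_ : G = fun x => \sum_(j <oo | j \in xpredT) (g j x)%:E)%E.
    by apply: ge0_emeasurable_sum => [j x _ _|j _]; [rewrite lee_fin|exact: mg].
  by apply/funext => x; apply: eq_eseriesl.
have IG : (\int[P]_x G x <= (2 * c)%:E)%E.
  rewrite integral_nneseries//; last by move=> j x _; rewrite lee_fin.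
  apply: lime_le.
    by apply: is_cvg_nneseries => j _ _; apply: integral_ge0 => x _; rewrite lee_fin.
  apply: nearW => l.
  rewrite (eq_bigr (fun j => (Ex P (g j))%:E)); last by move=> j _; rewrite Ex_fin.
  rewrite sumEFin lee_fin.
  apply: (@le_trans _ _ (\sum_(0 <= j < l) c * 2^-1 ^+ j)).
    by apply: ler_sum => j _.
  rewrite -mulr_sumr [leRHS]mulrC ler_wpM2l//.
  elim: l => [|l IH]; first by rewrite big_geq.
  have : \sum_(0 <= j < l) 2^-1 ^+ j = 2 - 2 * 2^-1 ^+ l :> R.
    elim: l {IH} => [|l IH]; first by rewrite big_geq// expr0 mulr1 subrr.
    by rewrite big_nat_recr//= IH exprS; lra.
  rewrite big_nat_recr//= => ->.
  have : 0 <= 2^-1 ^+ l :> R by rewrite exprn_ge0.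
  lra.
have iG : P.-integrable setT G.
  apply/integrableP; split => //.
  under eq_integral do rewrite gee0_abs//.
  exact: le_lt_trans IG (ltry _).
have [N [mN N0 sub]] := integrable_ae measurableT iG.
exists N; split => // x Nx.
have Gfin : G x \is a fin_num.
  by apply: contrapT => h; apply: Nx; apply: sub => /= /(_ I).
exists (fine (G x)) => l; rewrite -lee_fin fineK// -sumEFin.
rewrite -(big_mkord xpredT (fun j => (g j x)%:E)).
by apply: nneseries_lim_ge => j _ _; rewrite lee_fin.
Qed.

Lemma cvg_of_bounded_variation (R : realType) (u g : nat -> R) (M : R) :
  (forall j, `|u j.+1 - u j| <= g j) -> (forall l, \sum_(j < l) g j <= M) ->
  cvg (u @ \oo).
Proof.
move=> ug gM.
have c1 : cvg ([series `|telescope u j|]_j @ \oo).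
  apply: nondecreasing_is_cvgn.
    by apply/nondecreasing_seqP => l; rewrite /series /= big_nat_recr//= lerDl.
  exists M => _ [l _ <-]; rewrite /series /=.
  apply: le_trans (gM l); rewrite big_mkord; apply: ler_sum => j _.
  exact: ug.
have /cvg_ex[l c2] : cvg (series (telescope u) @ \oo) by exact: normed_cvg c1.
apply/cvg_ex; exists (l + u 0%N).
rewrite [X in X @ _](_ : _ = fun j => series (telescope u) j + u 0%N).
  by apply: cvgD; [exact: c2|exact: cvg_cst].
by apply/funext => j; rewrite [LHS]eq_sum_telescope addrC.
Qed.

Lemma cvgn_sum (R : realType) (I : Type) (s : seq I) (F : I -> nat -> R) (l : I -> R) :
  (forall i, F i @ \oo --> l i) ->
  (fun j => \sum_(i <- s) F i j) @ \oo --> \sum_(i <- s) l i.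
Proof.
move=> Fl; elim: s => [|i s IH].
  by rewrite big_nil; under eq_fun do rewrite big_nil; exact: cvg_cst.
rewrite big_cons; under eq_fun do rewrite big_cons.
by apply: cvgD; [exact: Fl|exact: IH].
Qed.

Section Algebra.
Context (R : realType).
Implicit Types (a b c h phi : R).

Lemma half_le_max a b : 2^-1 * a + 2^-1 * b <= Num.max a b.
Proof.
have : a <= Num.max a b by rewrite le_max lexx.
have : b <= Num.max a b by rewrite le_max lexx orbT.
lra.
Qed.

Lemma sqr_mid_le phi a b : (phi - ((1 - 2^-1) * a + 2^-1 * b)) ^+ 2 <=
  2^-1 * (phi - a) ^+ 2 + 2^-1 * (phi - b) ^+ 2.
Proof. have := sqr_ge0 (a - b); nra. Qed.

Lemma parallelogram a b : (a - b) ^+ 2 <=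
  2 * a ^+ 2 + 2 * b ^+ 2 - 4 * ((1 - 2^-1) * a + 2^-1 * b) ^+ 2.
Proof. lra. Qed.

Lemma norm_le_sqr h a b : 0 < h -> `|b - a| <= (2 * h)^-1 * (a - b) ^+ 2 + h / 2.
Proof.
move=> h0; rewrite -(ler_pM2l (mulr_gt0 (ltr0n _ 2) h0)) mulrDr mulrA divff ?mul1r.
  rewrite -[(a - b) ^+ 2]real_normK ?num_real// [`|a - b|]distrC.
  have := sqr_ge0 (`|b - a| - h); nra.
by rewrite mulf_neq0// gt_eqF.
Qed.

Lemma scale01 a b c : 0 <= a <= 1 -> 0 <= b -> b <= c -> 0 <= a * b <= c.
Proof. nra. Qed.

Lemma half_sqr h : 0 < h -> (2 * h)^-1 * (h * h) + h / 2 = h.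
Proof. by move=> h0; rewrite invfM mulrA mulrVK ?unitfE ?gt_eqF//; lra. Qed.

Lemma mix_bounds l a b c : 0 <= l <= 1 -> 0 <= a <= c -> 0 <= b <= c ->
  0 <= (1 - l) * a + l * b <= c.
Proof. nra. Qed.

Lemma sqr_dist_lipschitz phi a b d : 0 <= phi -> 0 <= a <= 1 -> 0 <= b <= 1 ->
  `|a - b| <= d -> (phi - a) ^+ 2 <= (phi - b) ^+ 2 + (2 * phi + 2) * d.
Proof.
move=> phi0 /andP[a0 a1] /andP[b0 b1]; rewrite ler_norml => /andP[h1 h2].
have e1 : 0 <= (d - (b - a)) * (2 * phi + 2 + (2 * phi - a - b)).
  by apply: mulr_ge0; lra.
have e2 : 0 <= (d + (b - a)) * (2 * phi + 2 - (2 * phi - a - b)).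
  by apply: mulr_ge0; lra.
nra.
Qed.

End Algebra.

Section Reduced.
Context (R : realType) (mu : probability R R) (n : nat).
Variables (r : n.-tuple R -> nat) (el : 'I_n -> n.-tuple R -> bool) (J : set R).
Variable phi : R.
Hypotheses (n0 : (0 < n)%N) (phi0 : 0 <= phi) (mJ : measurable J) (br : bmn r)
  (mel : forall i, measurable_fun setT (el i)).

Local Notation E := (Ex (iid mu n)).

(* p i t is the probability that agent i gets one of the r t objects at t; only
   the agents with el i t may. *)
Definition fractional (p : 'I_n -> n.-tuple R -> R) :=
  [/\ forall i, measurable_fun setT (p i),
      forall i t, 0 <= p i t <= (el i t)%:R &
      forall t, \sum_(i < n) p i t <= (r t)%:R].

Lemma fractional01 p i t : fractional p -> 0 <= p i t <= 1.
Proof.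
case=> _ h _; have /andP[-> pe] := h i t; apply: le_trans pe _.
by case: (el i t); rewrite /= ?ler01.
Qed.

Lemma fractional_bm p i : fractional p -> bm (p i).
Proof. by move=> fp; apply: bm01 => [|t]; [have [] := fp|exact: fractional01]. Qed.

Lemma fractional_mix p q (l : R) : 0 <= l <= 1 -> fractional p -> fractional q ->
  fractional (fun i t => (1 - l) * p i t + l * q i t).
Proof.
move=> l01 [mp hp sp] [mq hq sq].
have s0 (f : 'I_n -> n.-tuple R -> R) t : (forall i t, 0 <= f i t <= (el i t)%:R) ->
    0 <= \sum_(i < n) f i t.
  by move=> h; apply: sumr_ge0 => i _; have /andP[] := h i t.
split => [i|i t|t].
- by apply: measurable_funD; apply: measurable_funM => //; exact: measurable_cst.
- exact: mix_bounds.
- rewrite big_split /= -!mulr_sumr.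
  have h1 : 0 <= \sum_(i < n) p i t <= (r t)%:R by rewrite s0// sp.
  have h2 : 0 <= \sum_(i < n) q i t <= (r t)%:R by rewrite s0// sq.
  by have /andP[] := mix_bounds l01 h1 h2.
Qed.

Definition avgPhi (p : 'I_n -> n.-tuple R -> R) (x : R) : R :=
  n%:R^-1 * \sum_(i < n) condE mu (p i) i x.

Lemma bm_avgPhi p : (forall i, bm (p i)) -> bm (avgPhi p).
Proof. by move=> bp; apply: bmZ; apply: bm_sum => i; exact: bm_condE. Qed.

Lemma bm_J : bm (fun x : R => (x \in J)%:R : R).
Proof. by apply: bm_bool; apply: measurable_mem. Qed.

Definition dev p : R := Ex mu (fun x => (x \in J)%:R * (phi - avgPhi p x) ^+ 2).

Lemma condED (f g : n.-tuple R -> R) (i : 'I_n) x : bm f -> bm g ->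
  condE mu (fun t => f t + g t) i x = condE mu f i x + condE mu g i x.
Proof. by move=> bf bg; rewrite /condE ExD//; exact: bm_set_coord. Qed.

Lemma condEZ c (f : n.-tuple R -> R) (i : 'I_n) x : bm f ->
  condE mu (fun t => c * f t) i x = c * condE mu f i x.
Proof. by move=> bf; rewrite /condE ExZ//; exact: bm_set_coord. Qed.

Lemma condE_le (f g : n.-tuple R -> R) (i : 'I_n) x : bm f -> bm g -> (forall t, f t <= g t) ->
  condE mu f i x <= condE mu g i x.
Proof. by move=> bf bg fg; apply: Ex_le => //; exact: bm_set_coord. Qed.

Lemma condE01 (f : n.-tuple R -> R) (i : 'I_n) x : measurable_fun setT f -> (forall t, 0 <= f t <= 1) ->
  0 <= condE mu f i x <= 1.
Proof.
move=> mf f01; have bf : bm f by exact: bm01.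
apply/andP; split; first by apply: Ex_ge0 => t; have /andP[] := f01 (set_coord i x t).
rewrite -(Ex_cst (iid mu n) 1); apply: Ex_le; [exact: bm_set_coord|exact: bm_cst|].
by move=> t; have /andP[] := f01 (set_coord i x t).
Qed.

Lemma n0R : 0 < n%:R :> R. Proof. by rewrite ltr0n. Qed.

Lemma avgPhi01 p x : fractional p -> 0 <= avgPhi p x <= 1.
Proof.
move=> fp; have h i : 0 <= condE mu (p i) i x <= 1.
  apply: condE01 => [|t]; [by have [] := fp|exact: fractional01].
rewrite /avgPhi; apply/andP; split.
  by rewrite mulr_ge0 ?invr_ge0// sumr_ge0// => i _; have /andP[] := h i.
rewrite ler_pdivrMl ?n0R// mulr1.
apply: (@le_trans _ _ (\sum_(i < n) 1)); last by rewrite sumr_const card_ord.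
by apply: ler_sum => i _; have /andP[] := h i.
Qed.

Lemma avgPhi_mix p q l x : fractional p -> fractional q ->
  avgPhi (fun i t => (1 - l) * p i t + l * q i t) x =
  (1 - l) * avgPhi p x + l * avgPhi q x.
Proof.
move=> fp fq; rewrite /avgPhi.
rewrite (eq_bigr (fun i => (1 - l) * condE mu (p i) i x + l * condE mu (q i) i x)).
  by rewrite big_split /= -!mulr_sumr; ring.
move=> i _; have bp := fractional_bm i fp; have bq := fractional_bm i fq.
by rewrite condED ?condEZ//; exact: bmZ.
Qed.

Lemma Ex_weight (w : R -> R) p : bm w -> (forall i, bm (p i)) ->
  Ex mu (fun x => w x * avgPhi p x) =
  n%:R^-1 * \sum_(i < n) E (fun t => w (tnth t i) * p i t).
Proof.
move=> bw bp; have bt i : bm (fun t : n.-tuple R => w (tnth t i)).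
  by apply: bm_comp => //; exact: measurable_tnth.
rewrite -[X in _ * X](Ex_cst mu).
rewrite (eq_bigr (fun i => Ex mu (fun x => w x * condE mu (p i) i x))); last first.
  move=> i _; rewrite (Ex_resample mu i); last exact: bmM.
  apply: eq_Ex => x; rewrite -condEZ//; apply: eq_Ex => t.
  by rewrite tnth_mktuple eqxx.
rewrite Ex_cst -Ex_sum; last by move=> i; apply: bmM => //; exact: bm_condE.
rewrite -ExZ; last by apply: bm_sum => i; apply: bmM => //; exact: bm_condE.
by apply: eq_Ex => x; rewrite /avgPhi -mulr_sumr mulrCA.
Qed.

Lemma bm_dev p : (forall i, bm (p i)) ->
  bm (fun x => (x \in J)%:R * (phi - avgPhi p x) ^+ 2).
Proof.
move=> bp; apply: bmM; first exact: bm_J.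
by apply: bmX2; apply: bmB; [exact: bm_cst|exact: bm_avgPhi].
Qed.

Lemma dev_ge0 p : 0 <= dev p.
Proof. by apply: Ex_ge0 => x; rewrite mulr_ge0// sqr_ge0. Qed.

Lemma bm_norm d (T : measurableType d) (f : T -> R) : bm f -> bm (fun x => `|f x|).
Proof.
move=> [mf [M fM]]; apply: (bm_intro (M := M)); first exact: measurableT_comp.
by move=> x; rewrite normr_id.
Qed.

Lemma dev_lipschitz p q : fractional p -> fractional q ->
  dev p <= dev q + (2 * phi + 2) * \sum_(i < n) E (fun t => `|p i t - q i t|).
Proof.
move=> fp fq; have bp i := fractional_bm i fp; have bq i := fractional_bm i fq.
have bpq i : bm (fun t => `|p i t - q i t|) by apply: bm_norm; exact: bmB.
pose D x := n%:R^-1 * \sum_(i < n) condE mu (fun t => `|p i t - q i t|) i x.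
have bD : bm D by apply: bmZ; apply: bm_sum => i; exact: bm_condE.
have nle1 : n%:R^-1 <= 1 :> R by rewrite invf_le1 ?n0R// ler1n.
have DE : Ex mu D <= \sum_(i < n) E (fun t => `|p i t - q i t|).
  rewrite ExZ; last by apply: bm_sum => i; exact: bm_condE.
  rewrite Ex_sum; last by move=> i; exact: bm_condE.
  rewrite (eq_bigr (fun i => E (fun t => `|p i t - q i t|))).
    by rewrite ler_piMl// sumr_ge0// => i _; exact: Ex_ge0.
  by move=> i _; rewrite -Ex_resample.
apply: (@le_trans _ _ (dev q + (2 * phi + 2) * Ex mu D)); last first.
  by rewrite lerD2l; apply: ler_wpM2l; rewrite ?addr_ge0 ?mulr_ge0.
rewrite /dev -ExZ// -ExD; [|exact: bm_dev|exact: bmZ].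
apply: Ex_le; [exact: bm_dev|by apply: bmD; [exact: bm_dev|exact: bmZ]|].
move=> x; have D0 : 0 <= D x.
  by rewrite /D mulr_ge0 ?invr_ge0// sumr_ge0// => i _; exact: Ex_ge0.
have dPhi : `|avgPhi p x - avgPhi q x| <= D x.
  rewrite /avgPhi /D -mulrBr normrM ger0_norm ?invr_ge0// ler_wpM2l ?invr_ge0//.
  rewrite -sumrB; apply: le_trans (ler_norm_sum _ _ _) _; apply: ler_sum => i _.
  have h : condE mu (fun t => p i t - q i t) i x =
      condE mu (p i) i x - condE mu (q i) i x.
    by rewrite /condE ExB//; exact: bm_set_coord.
  rewrite -h ler_norml; apply/andP; split.
    rewrite -mulN1r -condEZ//; apply: condE_le; [exact: bmZ|exact: bmB|].
    by move=> t; rewrite mulN1r lerNl; have := ler_norm (- (p i t - q i t)); rewrite normrN.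
  by apply: condE_le => // [|t]; [exact: bmB|exact: ler_norm].
have := avgPhi01 x fp; have := avgPhi01 x fq; move: dPhi.
case: (x \in J) => /=; rewrite ?mul1r ?mul0r ?add0r.
  by move=> h1 h2 h3; exact: sqr_dist_lipschitz.
by move=> _ _ _; apply: mulr_ge0 => //; rewrite addr_ge0// mulr_ge0.
Qed.

(* The squared error dev attains its minimum: minimizing sequences of least norm
   converge almost everywhere. *)
Lemma fractional_minimizer : exists p, fractional p /\
  forall q, fractional q -> dev p <= dev q.
Proof.
pose nr (p : 'I_n -> n.-tuple R -> R) := \sum_(i < n) E (fun t => p i t ^+ 2).
pose ds (p q : 'I_n -> n.-tuple R -> R) :=
  \sum_(i < n) E (fun t => (p i t - q i t) ^+ 2).
pose mid (p q : 'I_n -> n.-tuple R -> R) :=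
  fun i t => (1 - 2^-1) * p i t + 2^-1 * q i t.
have C0 : fractional !=set0.
  exists (fun _ _ => 0); split => [i|i t|t]; first exact: measurable_cst.
    by rewrite lexx /=; case: (el i t).
  by rewrite big1.
have Cmid p q : fractional p -> fractional q -> fractional (mid p q).
  by apply: fractional_mix; apply/andP; split; lra.
have nr0 p : fractional p -> 0 <= nr p <= n%:R.
  move=> fp; rewrite /nr; apply/andP; split.
    by apply: sumr_ge0 => i _; apply: Ex_ge0 => t; exact: sqr_ge0.
  apply: (@le_trans _ _ (\sum_(i < n) 1)); last by rewrite sumr_const card_ord.
  apply: ler_sum => i _; rewrite -(Ex_cst (iid mu n) 1); apply: Ex_le.
  - by apply: bmX2; exact: fractional_bm.
  - exact: bm_cst.
  - by move=> t; have /andP[a b] := fractional01 i t fp; rewrite expr_le1.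
have dvmid p q : fractional p -> fractional q ->
    dev (mid p q) <= Num.max (dev p) (dev q).
  move=> fp fq; have bp i := fractional_bm i fp; have bq i := fractional_bm i fq.
  have bm' i := fractional_bm i (Cmid _ _ fp fq).
  apply: (@le_trans _ _ (2^-1 * dev p + 2^-1 * dev q)); last first.
    exact: half_le_max.
  rewrite /dev -!ExZ -?ExD; try by [exact: bm_dev|apply: bmZ; exact: bm_dev].
  apply: Ex_le; first exact: bm_dev.
    by apply: bmD; apply: bmZ; exact: bm_dev.
  move=> x; rewrite avgPhi_mix//; case: (x \in J) => /=; rewrite ?mul1r ?mul0r.
    exact: sqr_mid_le.
  by rewrite !mulr0 addr0.
have paral p q : fractional p -> fractional q ->
    ds p q <= 2 * nr p + 2 * nr q - 4 * nr (mid p q).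
  move=> fp fq; have bp i := fractional_bm i fp; have bq i := fractional_bm i fq.
  have bm' i := fractional_bm i (Cmid _ _ fp fq).
  rewrite /ds /nr !mulr_sumr -big_split /= -sumrB; apply: ler_sum => i _.
  have b1 : bm (fun t => 2 * p i t ^+ 2) by apply: bmZ; exact: bmX2.
  have b2 : bm (fun t => 2 * q i t ^+ 2) by apply: bmZ; exact: bmX2.
  have b3 : bm (fun t => 4 * mid p q i t ^+ 2) by apply: bmZ; exact: bmX2.
  rewrite -!ExZ; try exact: bmX2.
  rewrite -ExD// -ExB//; last exact: bmD.
  apply: Ex_le; first by apply: bmX2; exact: bmB.
    by apply: bmB => //; exact: bmD.
  by move=> t; exact: parallelogram.
have [u [fu udev ucau]] := cauchy_minimizing_seq C0 Cmid (fun p _ => dev_ge0 p)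
   nr0 dvmid paral.
have bu j i := fractional_bm i (fu j).
have bd j i : bm (fun t => `|u j.+1 i t - u j i t|) by apply: bm_norm; exact: bmB.
pose g j t := \sum_(i < n) `|u j.+1 i t - u j i t|.
have Eg j : E (g j) <= n%:R * 2^-1 ^+ j.
  rewrite Ex_sum//; apply: (@le_trans _ _ (\sum_(i < n) 2^-1 ^+ j)); last first.
    by rewrite sumr_const card_ord mulr_natl.
  apply: ler_sum => i _.
  pose h := 2^-1 ^+ j : R.
  have h0 : 0 < h by rewrite exprn_gt0.
  have hh : 4^-1 ^+ j = h * h.
    by rewrite -exprMn; congr (_ ^+ _); lra.
  have b1 : bm (fun t => (2 * h)^-1 * (u j i t - u j.+1 i t) ^+ 2).
    by apply: bmZ; apply: bmX2; exact: bmB.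
  apply: (@le_trans _ _ (E (fun t => (2 * h)^-1 * (u j i t - u j.+1 i t) ^+ 2 + h / 2))).
    apply: Ex_le => //; first by apply: bmD => //; exact: bm_cst.
    by move=> t; exact: norm_le_sqr.
  rewrite ExD//; last exact: bm_cst.
  rewrite Ex_cst ExZ; last by apply: bmX2; exact: bmB.
  have : E (fun t => (u j i t - u j.+1 i t) ^+ 2) <= h * h.
    rewrite -hh; apply: le_trans (ucau j); rewrite /ds (bigD1 i)//= lerDl.
    by apply: sumr_ge0 => l _; apply: Ex_ge0 => t; exact: sqr_ge0.
  move=> hE; apply: (@le_trans _ _ ((2 * h)^-1 * (h * h) + h / 2)).
    by rewrite lerD2r ler_wpM2l// invr_ge0 mulr_ge0// ltW.
  by rewrite half_sqr.
have [||N [mN N0 bdd]] := @summable_ae _ _ _ (iid mu n) g _ _ _ Eg.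
- by move=> j; exact: bm_sum.
- by move=> j t; apply: sumr_ge0.
pose chi t : R := (t \in ~` N)%:R.
have bchi : bm chi.
  by apply: bm_bool; apply: measurable_mem => //; exact: measurableC.
pose U j i t := chi t * u j i t.
have cU i t : cvg ((fun j => U j i t) @ \oo).
  rewrite /U /chi; case: (boolP (t \in ~` N)) => [|_]; last first.
    by under eq_fun do rewrite mul0r; exact: is_cvg_cst.
  move=> /set_mem /bdd[M gM]; under eq_fun do rewrite mul1r.
  apply: (@cvg_of_bounded_variation _ _ (g ^~ t) M) => // j.
  by rewrite /g (bigD1 i)//= lerDl sumr_ge0.
pose p i t := lim ((fun j => U j i t) @ \oo).
have Up i t : (fun j => U j i t) @ \oo --> p i t by exact: cU.
have bU j i : bm (U j i) by exact: bmM.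
have chi01 t : 0 <= chi t <= 1 by rewrite /chi; case: (_ \in _); rewrite ?lexx ?ler01.
have U01 j i t : 0 <= U j i t <= (el i t)%:R.
  by have [_ h _] := fu j; have /andP[h1 h2] := h i t; exact: scale01.
have Ule1 j i t : `|U j i t| <= 1.
  have /andP[a b] := U01 j i t; rewrite ger0_norm//; apply: le_trans b _.
  by case: (el i t); rewrite ?ler01.
have bp i : bm (p i).
  by have [] := @Ex_cvg _ _ _ (iid mu n) (fun j => U j i) (p i) 1 (fun j => (bU j i).1)
    (fun j t => Ule1 j i t) (Up i).
have fp : fractional p.
  split; first by move=> i; have [] := bp i.
    move=> i t; apply/andP; split.
      by apply: (cvgr_to_ge (Up i t)); apply: nearW => j; have /andP[] := U01 j i t.
    by apply: (cvgr_to_le (Up i t)); apply: nearW => j; have /andP[] := U01 j i t.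
  move=> t.
  have h : (fun j => \sum_(i < n) U j i t) @ \oo --> \sum_(i < n) p i t.
    by apply: cvgn_sum => i; exact: Up.
  apply: (cvgr_to_le h); apply: nearW => j.
  rewrite /U -mulr_sumr; have [_ _ /(_ t)] := fu j; have := chi01 t.
  have : 0 <= \sum_(i < n) u j i t.
    by apply: sumr_ge0 => i _; have /andP[] := fractional01 i t (fu j).
  by move=> h1 h2 h3; have /andP[] := scale01 h2 h1 h3.
pose e j := \sum_(i < n) E (fun t => `|p i t - u j i t|).
have ecvg : e @ \oo --> (0 : R).
  rewrite (_ : e = fun j => \sum_(i < n) E (fun t => `|p i t - U j i t|)); last first.
    apply/funext => j; apply: eq_bigr => i _.
    apply: (Ex_ae (N := N)) => //; try by apply: bm_norm; exact: bmB.
    move=> t Nt; congr (`|_ - _|); rewrite /U /chi mem_set ?mul1r//.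
  have s0 : \sum_(i < n) E (fun=> 0) = 0 by rewrite big1// => i _; rewrite Ex_cst.
  rewrite -[X in _ --> X]s0; apply: cvgn_sum => i.
  have [|||_ h] := @Ex_cvg _ _ _ (iid mu n) (fun j t => `|p i t - U j i t|) (fun=> 0) 2.
  - by move=> j; have [] : bm (fun t => `|p i t - U j i t|) by apply: bm_norm; exact: bmB.
  - move=> j t; rewrite normr_id; apply: le_trans (ler_normB _ _) _.
    have := Ule1 j i t; have /andP[] := fractional01 i t fp.
    by move=> h1 h2 h3; rewrite (ger0_norm h1) (_ : 2 = 1 + 1) ?lerD.
  - move=> t; rewrite -(normr0 R) -(subrr (p i t)); apply: cvg_norm.
    by apply: cvgB; [exact: cvg_cst|exact: Up].
  - exact: h.
exists p; split => // q fq.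
pose K := 2 * phi + 2.
have lim2 : (fun j => dev q + 2^-1 ^+ j + K * e j) @ \oo --> dev q.
  rewrite -[X in _ --> X]addr0 -[X in _ --> X + _]addr0 -{2}(mulr0 K).
  apply: cvgD; last by apply: cvgM => //; exact: cvg_cst.
  apply: cvgD; first exact: cvg_cst.
  by apply: cvg_expr; rewrite ger0_norm ?invr_ge0// invf_lt1 ?ltr1n.
apply: (cvgr_to_ge lim2); apply: nearW => j.
apply: le_trans (dev_lipschitz fp (fu j)) _; rewrite lerD2r.
exact: udev.
Qed.

End Reduced.

Section Greedy.
Context (R : realType) (n : nat) (r : nat) (el : pred 'I_n) (w : 'I_n -> R).

Definition before (j i : 'I_n) : bool := (w i < w j) || (w j == w i) && (j < i)%N.

Definition greedy (i : 'I_n) : bool :=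
  [&& el i, 0 < w i & (\sum_(j < n) (el j && before j i) < r)%N].

Lemma greedy_layer (c : R) : 0 < c ->
  (minn r (\sum_(i < n) (el i && (c <= w i)%R)) <=
   \sum_(i < n) (greedy i && (c <= w i)%R))%N.
Proof.
move=> c0; pose A := [set i | el i && (c <= w i)]%SET.
have cardb (b : pred 'I_n) : (\sum_(i < n) b i)%N = #|[set i | b i]%SET|.
  by rewrite -sum1_card [RHS]big_mkcond /=; apply: eq_bigr => i _; rewrite inE; case: (b i).
rewrite [X in minn _ X]cardb -/A -(@card_rank_lt _ A before r); first last.
- move=> i j _ _ ij; rewrite /before; case: ltgtP => //= _.
  by have := ij; rewrite -val_eqE /= neq_ltn.
- move=> y x z _ _ _; rewrite /before => /orP[xy|/andP[/eqP xy yx]] /orP[yz|/andP[/eqP yz zy]].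
  + by rewrite (lt_trans yz xy).
  + by rewrite -yz xy.
  + by rewrite xy yz.
  + by rewrite xy yz eqxx (ltn_trans yx zy) orbT.
- by move=> x _; rewrite /before ltxx ltnn andbF.
rewrite cardb; apply: subset_leq_card; apply/fintype.subsetP => i.
rewrite !inE => /andP[/andP[eli cw]] h; rewrite cw andbT /greedy eli (lt_le_trans c0 cw) /=.
rewrite cardb; apply: leq_ltn_trans h; apply: subset_leq_card.
apply/fintype.subsetP => j; rewrite !inE => /andP[elj bji]; rewrite elj bji andbT /=.
move: bji; rewrite /before => /orP[wij|/andP[/eqP -> _]//].
exact: le_trans cw (ltW wij).
Qed.

Lemma greedy_count : (\sum_(i < n) greedy i <= r)%N.
Proof.
pose A := [set i | el i]%SET.
have cardb (b : pred 'I_n) : (\sum_(i < n) b i)%N = #|[set i | b i]%SET|.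
  by rewrite -sum1_card [RHS]big_mkcond /=; apply: eq_bigr => i _; rewrite inE; case: (b i).
apply: (@leq_trans (minn r #|A|)); last exact: geq_minl.
rewrite -(@card_rank_lt _ A before r); first last.
- move=> i j _ _ ij; rewrite /before; case: ltgtP => //= _.
  by have := ij; rewrite -val_eqE /= neq_ltn.
- move=> y x z _ _ _; rewrite /before => /orP[xy|/andP[/eqP xy yx]] /orP[yz|/andP[/eqP yz zy]].
  + by rewrite (lt_trans yz xy).
  + by rewrite -yz xy.
  + by rewrite xy yz.
  + by rewrite xy yz eqxx (ltn_trans yx zy) orbT.
- by move=> x _; rewrite /before ltxx ltnn andbF.
rewrite cardb; apply: subset_leq_card; apply/fintype.subsetP => i.
rewrite !inE => /and3P[eli _ h]; rewrite eli /=.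
rewrite cardb in h; apply: leq_ltn_trans h; apply: subset_leq_card.
by apply/fintype.subsetP => j; rewrite !inE.
Qed.

End Greedy.

Lemma sqr_mix_le (R : realType) (f b1 b2 l : R) : 0 <= b1 <= 1 -> 0 <= b2 <= 1 ->
  (f - ((1 - l) * b1 + l * b2)) ^+ 2 <=
  (f - b1) ^+ 2 + - (2 * l) * ((f - b1) * (b2 - b1)) + l * l.
Proof.
move=> /andP[? ?] /andP[? ?].
have h : (b2 - b1) ^+ 2 <= 1 by nra.
have := sqr_ge0 l; nra.
Qed.

Section Existence.
Context (R : realType) (mu : probability R R) (n : nat).
Variables (r : n.-tuple R -> nat) (el : 'I_n -> n.-tuple R -> bool) (J : set R).
Variable phi : R.
Hypotheses (n0 : (0 < n)%N) (phi0 : 0 <= phi) (mJ : measurable J) (br : bmn r)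
  (mel : forall i, measurable_fun setT (el i)).
Hypotheses (rsym : forall s t, r (permt s t) = r t)
  (elsym : forall s i t, el i (permt s t) = el (s i) t).

Local Notation E := (Ex (iid mu n)).
Local Notation fractional := (fractional r el).

Hypothesis border : forall B, measurable B -> B `<=` J ->
  n%:R * phi * fine (mu B) <=
  E (fun t => (minn (r t) (\sum_(i < n) (el i t && (tnth t i \in B))))%:R).

Lemma minimizer_variation p q (v := fun x => (x \in J)%:R * (phi - avgPhi mu p x)) :
  fractional p -> (forall q, fractional q -> dev mu J phi p <= dev mu J phi q) ->
  fractional q ->
  Ex mu (fun x => v x * avgPhi mu q x) <= Ex mu (fun x => v x * avgPhi mu p x).
Proof.
move=> fp pmin fq; have bp i := fractional_bm i fp; have bq i := fractional_bm i fq.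
have bv : bm v.
  by apply: bmM; [exact: bm_J|apply: bmB; [exact: bm_cst|exact: bm_avgPhi]].
pose D x := avgPhi mu q x - avgPhi mu p x.
have bD : bm D by apply: bmB; exact: bm_avgPhi.
have bvD : bm (fun x => v x * D x) by exact: bmM.
have -> : Ex mu (fun x => v x * avgPhi mu q x) =
    Ex mu (fun x => v x * avgPhi mu p x) + Ex mu (fun x => v x * D x).
  rewrite -ExD//; last by apply: bmM => //; exact: bm_avgPhi.
  by apply: eq_Ex => x; rewrite /D; ring.
rewrite gerDl leNgt; apply/negP => A0; set a := Ex mu _ in A0.
pose l := Num.min 1 a.
have l0 : 0 < l by rewrite lt_min ltr01.
have l1 : l <= 1 by rewrite ge_min lexx.
have la : l <= a by rewrite ge_min lexx orbT.
have l01 : 0 <= l <= 1 by rewrite (ltW l0).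
have fm := fractional_mix l01 fp fq.
have := pmin _ fm; rewrite leNgt => /negP; apply.
have bdp : bm (fun x => (x \in J)%:R * (phi - avgPhi mu p x) ^+ 2) by exact: bm_dev.
apply: (@le_lt_trans _ _ (dev mu J phi p + (- (2 * l)) * a + l * l)); last first.
  have h : l * l < 2 * l * a.
    rewrite -mulrA [ltRHS]mulrCA ltr_pM2l//.
    by apply: le_lt_trans la _; rewrite ltr_pMl// ltr1n.
  by rewrite -addrA gtrDl mulNr addrC subr_lt0.
rewrite /dev /a -ExZ// -ExD//; last exact: bmZ.
rewrite -(Ex_cst mu (l * l)) -ExD; [|by apply: bmD => //; exact: bmZ|exact: bm_cst].
apply: Ex_le.
- by apply: bm_dev => // i; exact: fractional_bm fm.
- by apply: bmD; [apply: bmD => //; exact: bmZ|exact: bm_cst].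
move=> x; rewrite (avgPhi_mix mu _ _ fp fq) /v /D.
have := avgPhi01 mu n0 x fp; have := avgPhi01 mu n0 x fq.
set a1 := avgPhi mu p x; set a2 := avgPhi mu q x.
case: (x \in J) => /=; rewrite ?mul1r ?mul0r; last first.
  by move=> _ _; rewrite !mulr0 !addr0 add0r mulr_ge0// ltW.
by move=> h2 h1; exact: sqr_mix_le.
Qed.

Lemma bm_indic_tnth (B : set R) (i : 'I_n) : measurable B ->
  measurable_fun setT (fun t : n.-tuple R => tnth t i \in B).
Proof. by move=> mB; apply: measurable_mem => //; exact: measurable_tnth. Qed.

Lemma greedy_weight (w : R -> R) : bm w -> (forall x, 0 <= w x <= phi + 1) ->
  (forall x, 0 < w x -> J x) ->
  exists q, [/\ fractional q, forall i t, w (tnth t i) <= 0 -> q i t = 0 &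
    phi * Ex mu w <= Ex mu (fun x => w x * avgPhi mu q x)].
Proof.
move=> bw w01 wJ; pose W := phi + 1.
have W0 : 0 < W by rewrite /W ltr_wpDl.
pose g i t := greedy (r t) (fun j => el j t) (fun j => w (tnth t j)) i.
have mw i : measurable_fun setT (fun t : n.-tuple R => w (tnth t i)).
  apply: (measurableT_comp (bm_measurable bw)); exact: measurable_tnth.
have mg i : measurable_fun setT (g i).
  rewrite /g /greedy; apply: measurable_and => //; apply: measurable_and.
    by apply: measurable_fun_ltr => //; exact: measurable_cst.
  apply: (measurable_nat2 (fun u v => u < v)%N) => //.
  apply: bmn_sum => j; apply: bmn_bool; apply: measurable_and => //.
  apply: measurable_or; first exact: measurable_fun_ltr.
  by apply: measurable_and; [exact: measurable_fun_eqr|exact: measurable_cst].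
pose q i t : R := (g i t)%:R.
have bq i : bm (q i) by exact: bm_bool.
have fq : fractional q.
  split => [i|i t|t]; first by have [] := bq i.
    by rewrite /q ler0n ler_nat; case E : (g i t) => //; have /and3P[->] := E.
  by rewrite -natr_sum ler_nat; exact: greedy_count.
exists q; split => //.
  move=> i t wi; rewrite /q; case E : (g i t) => //; have /and3P[_ h _] := E.
  by move: h; rewrite ltNge wi.
have main N : (0 < N)%N ->
    phi * (Ex mu w - W / N%:R) <= Ex mu (fun x => w x * avgPhi mu q x).
  move=> N0; have N0R : 0 < N%:R :> R by rewrite ltr0n.
  pose c l : R := l.+1%:R * (W / N%:R).
  have c0 l : 0 < c l by rewrite mulr_gt0 ?divr_gt0.
  pose b l x := (c l <= w x)%R.
  have mb l : measurable_fun setT (b l).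
    by apply: measurable_fun_ler; [exact: measurable_cst|exact: bm_measurable].
  pose B l := [set x | b l x].
  have mB l : measurable (B l) by apply/measurable_boolP.
  have BJ l : B l `<=` J by move=> x /= h; apply: wJ; exact: lt_le_trans (c0 l) h.
  pose h x := W / N%:R * \sum_(l < N) (b l x)%:R.
  have bbl l : bm (fun x => (b l x)%:R : R) by exact: bm_bool.
  have bh : bm h by apply: bmZ; apply: bm_sum.
  have hw x : w x - W / N%:R <= h x <= w x.
    have zN : 0 <= w x * (N%:R / W) <= N%:R.
      have /andP[w0 w1] := w01 x; rewrite mulr_ge0 ?divr_ge0 ?(ltW W0)//=.
      by rewrite mulrCA ler_piMr ?(ltW N0R)// ler_pdivrMr// mul1r.
    have := layer_count zN.
    rewrite (eq_bigr (fun l : 'I_N => (b l x)%:R)); last first.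
      move=> l _; congr ((_ : bool)%:R).
      by rewrite /b /c -ler_pdivlMr ?divr_gt0// invf_div.
    set s := \sum_(l < N) _; move=> /andP[s1 s2].
    have e : W / N%:R * (w x * (N%:R / W)) = w x.
      by field; rewrite !gt_eqF.
    have WN0 : 0 <= W / N%:R by rewrite divr_ge0// ltW.
    rewrite /h -/s -[X in X - _]e -[X in _ && (_ <= X)]e -[X in _ - X]mulr1 -mulrBr.
    by rewrite !ler_wpM2l.
  apply: (@le_trans _ _ (phi * Ex mu h)).
    rewrite ler_wpM2l// -[X in _ - X](Ex_cst mu) -ExB//; last exact: bm_cst.
    apply: Ex_le => //; first by apply: bmB => //; exact: bm_cst.
    by move=> x; have /andP[] := hw x.
  apply: (@le_trans _ _ (Ex mu (fun x => h x * avgPhi mu q x))); last first.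
    apply: Ex_le; try by [apply: bmM => //; exact: bm_avgPhi].
    move=> x; have /andP[_ h1] := hw x; rewrite ler_wpM2r//.
    by have /andP[] := avgPhi01 mu n0 x fq.
  rewrite Ex_weight// ler_pdivlMl ?ltr0n// mulrA.
  have hE t : \sum_(i < n) h (tnth t i) * q i t =
      W / N%:R * \sum_(l < N) \sum_(i < n) (g i t && b l (tnth t i))%:R.
    rewrite exchange_big mulr_sumr; apply: eq_bigr => i _.
    rewrite /h -mulrA mulr_suml; congr (_ * _); apply: eq_bigr => l _.
    by rewrite /q mulrC -natrM mulnb.
  have bht i : bm (fun t => h (tnth t i) * q i t).
    by apply: bmM => //; apply: bm_comp => //; exact: measurable_tnth.
  rewrite -Ex_sum// (eq_Ex _ hE).
  have bgb l i : bm (fun t => (g i t && b l (tnth t i))%:R : R).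
    apply: bm_bool; apply: measurable_and => //.
    by apply: (measurableT_comp (mb l)); exact: measurable_tnth.
  have bsum (l : nat) : bm (fun t => \sum_(i < n) (g i t && b l (tnth t i))%:R : R).
    by apply: bm_sum => i; exact: bgb.
  rewrite ExZ; last by apply: bm_sum => l; exact: bbl.
  rewrite Ex_sum; last by move=> l; exact: bbl.
  rewrite ExZ; last by apply: bm_sum => l; exact: bsum.
  rewrite Ex_sum; last by move=> l; exact: bsum.
  rewrite mulrCA ler_wpM2l ?divr_ge0 ?(ltW W0)//.
  rewrite mulr_sumr; apply: ler_sum => l _.
  have -> : Ex mu (fun x => (b l x)%:R) = fine (mu (B l)).
    rewrite -Ex_indic//; apply: eq_Ex => x; congr ((_ : bool)%:R).
    by apply/idP/idP => [?|/set_mem//]; apply/mem_set.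
  apply: le_trans (border (mB l) (BJ l)) _; apply: Ex_le.
  - apply: (bm_nat2 (fun u v => (minn u v)%:R)) => //.
    apply: bmn_sum => i; apply: bmn_bool; apply: measurable_and => //.
    exact: bm_indic_tnth.
  - exact: bm_sum.
  - move=> t; rewrite -natr_sum ler_nat.
    rewrite (eq_bigr (fun i => nat_of_bool (el i t && b l (tnth t i)))).
      exact: greedy_layer.
    move=> i _; congr nat_of_bool; congr andb.
    by apply/idP/idP => [/set_mem//|?]; apply/mem_set.
rewrite leNgt; apply/negP => lt.
set lhs := Ex mu (fun x => w x * avgPhi mu q x) in lt main.
set Ew := Ex mu w in lt main.
pose d := phi * Ew - lhs.
have d0 : 0 < d by rewrite subr_gt0.
pose N := (Num.truncn (phi * W / d)).+1.
have := main N isT; rewrite mulrBr lerBlDr => h.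
have N0R : 0 < N%:R :> R by rewrite ltr0n.
have : phi * W / d < N%:R by rewrite truncnS_gt.
rewrite ltr_pdivrMr// -ltr_pdivrMl// mulrC.
rewrite -mulrA => h2.
by move: h2; rewrite ltNge /d lerBlDl h.
Qed.

(* Let v = phi - avgPhi p on J.  Minimality of p gives E[v avgPhi p] >=
   E[v avgPhi q] for the greedy q that serves the largest v > 0 first; by the
   Border inequality on the level sets of v this is at least phi E[v^+] >=
   phi E[v], so that E[v^2] <= 0. *)
Lemma avgPhi_exact : exists p, fractional p /\
  exists N, [/\ measurable N, mu N = 0%E &
    forall x, J x -> ~ N x -> avgPhi mu p x = phi].
Proof.
have [p [fp pmin]] := @fractional_minimizer R mu n r el J phi n0 phi0 mJ.
exists p; split => //; have bp i := fractional_bm i fp.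
pose v x := (x \in J)%:R * (phi - avgPhi mu p x).
have bavg : bm (avgPhi mu p) by exact: bm_avgPhi.
have bv : bm v.
  by apply: bmM; [exact: bm_J|apply: bmB => //; exact: bm_cst].
pose w x := Num.max 0 (v x).
have bw : bm w by apply: bm_max => //; exact: bm_cst.
have v_le x : v x <= phi + 1.
  have /andP[h _] := avgPhi01 mu n0 x fp; rewrite /v; case: (x \in J) => /=.
    by rewrite mul1r lerBlDr -addrA lerDl addr_ge0.
  by rewrite mul0r addr_ge0.
have w0 x : 0 <= w x by rewrite le_max lexx.
have wv x : v x <= w x by rewrite le_max lexx orbT.
have [q [fq q0 qw]] : exists q, [/\ fractional q,
    forall i t, w (tnth t i) <= 0 -> q i t = 0 &
    phi * Ex mu w <= Ex mu (fun x => w x * avgPhi mu q x)].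
  apply: greedy_weight => //.
    by move=> x; rewrite w0 /= ge_max v_le addr_ge0.
  move=> x; rewrite lt_max ltxx /= /v; case: (boolP (x \in J)) => [/set_mem//|_].
  by rewrite mul0r ltxx.
have bq i := fractional_bm i fq.
have vq : Ex mu (fun x => w x * avgPhi mu q x) = Ex mu (fun x => v x * avgPhi mu q x).
  rewrite !Ex_weight//; congr (_ * _); apply: eq_bigr => i _; apply: eq_Ex => t.
  have [wt|wt] := leP (w (tnth t i)) 0; first by rewrite q0// !mulr0.
  congr (_ * _); rewrite /w; apply/max_idPr; rewrite leNgt; apply/negP => vt.
  by move: wt; rewrite /w lt_max ltxx /= ltNge (ltW vt).
have var := minimizer_variation fp pmin fq.
have v2 : Ex mu (fun x => v x ^+ 2) <= 0.
  have -> : Ex mu (fun x => v x ^+ 2) =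
      phi * Ex mu v - Ex mu (fun x => v x * avgPhi mu p x).
    rewrite -ExZ// -ExB; [|exact: bmZ|exact: bmM].
    apply: eq_Ex => x; rewrite /v; case: (x \in J) => /=; last by rewrite !mul0r expr0n mulr0 subr0.
    by rewrite mul1r expr2; ring.
  rewrite subr_le0; apply: le_trans var; rewrite -vq; apply: le_trans qw.
  by rewrite ler_wpM2l// Ex_le.
have v20 : Ex mu (fun x => v x ^+ 2) = 0.
  by apply/eqP; rewrite eq_le v2; apply: Ex_ge0 => x; exact: sqr_ge0.
have bv2 : bm (fun x => v x ^+ 2) by exact: bmX2.
have N0 := Ex_eq0 bv2 (fun x => sqr_ge0 _) v20.
exists [set x | v x ^+ 2 != 0]; split => //.
  have mv2 := bm_measurable bv2.
  apply/measurable_boolP; apply: measurable_neg.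
  by apply: measurable_fun_eqr => //; exact: measurable_cst.
move=> x Jx /= /negP; rewrite negbK sqrf_eq0 /v mem_set// mul1r subr_eq0.
by move=> /eqP ->.
Qed.

(* Averaging over the relabelings of the agents equalizes the interim rules. *)
Lemma interim_exact : exists p, fractional p /\
  exists N, [/\ measurable N, mu N = 0%E &
    forall x i, J x -> ~ N x -> condE mu (p i) i x = phi].
Proof.
have [p [fp [N [mN N0 pN]]]] := avgPhi_exact.
have bp i := fractional_bm i fp; have [mp pel pr] := fp.
pose c : R := #|{perm 'I_n}|%:R.
have c0 : 0 < c by rewrite ltr0n; apply/card_gt0P; exists 1%g.
pose p' i t : R := c^-1 * \sum_(s : {perm 'I_n}) p (s i) (permt s^-1%g t).
have bps (s : {perm 'I_n}) i : bm (fun t => p (s i) (permt s^-1%g t)).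
  by apply: bm_comp => //; exact: measurable_permt.
have sumc (x : R) : \sum_(s : {perm 'I_n}) x = c * x.
  by rewrite sumr_const mulr_natl.
exists p'; split.
  split.
  - move=> i; have [] // : bm (p' i) by apply: bmZ; exact: bm_sum.
  - move=> i t; rewrite /p'; apply/andP; split.
      rewrite mulr_ge0 ?invr_ge0 ?(ltW c0)// sumr_ge0// => s _.
      by have /andP[] := pel (s i) (permt s^-1%g t).
    rewrite ler_pdivrMl// -sumc; apply: ler_sum => s _.
    have /andP[_] := pel (s i) (permt s^-1%g t).
    by rewrite elsym permK.
  - move=> t; rewrite /p' -mulr_sumr exchange_big /= ler_pdivrMl// -sumc.
    apply: ler_sum => s _; rewrite -(rsym s^-1%g t); apply: le_trans (pr _).
    by rewrite [leRHS](reindex_inj (@perm_inj _ s)).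
exists N; split => // x i Jx Nx.
pose C j := condE mu (p j) j x.
have E1 j : condE mu (p' j) j x = c^-1 * \sum_(s : {perm 'I_n}) C (s j).
  rewrite /p' condEZ; last exact: bm_sum.
  congr (_ * _); rewrite /condE Ex_sum; last first.
    by move=> s; apply: (bm_set_coord j x (bps s j)).
  apply: eq_bigr => s _; rewrite /C /condE.
  rewrite -[RHS](Ex_permt mu s^-1%g); last exact: bm_set_coord.
  apply: eq_Ex => t; rewrite -permt_set_coord permK.
  by [].
have E2 j : condE mu (p' j) j x = condE mu (p' i) i x.
  rewrite !E1; congr (_ * _).
  rewrite (reindex_inj (mulgI (tperm i j))) /=; apply: eq_bigr => s _.
  by rewrite permM tpermR.
have : \sum_(j < n) condE mu (p' j) j x = n%:R * phi.
  rewrite -(pN x)// /avgPhi mulrA divff ?mul1r ?pnatr_eq0 -?lt0n//.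
  under eq_bigr do rewrite E1.
  rewrite -mulr_sumr exchange_big /=.
  apply: (mulfI (lt0r_neq0 c0)); rewrite mulrA divff ?lt0r_neq0// mul1r -sumc; apply: eq_bigr => s _.
  by rewrite [RHS](reindex_inj (@perm_inj _ s)).
under eq_bigr do rewrite E2.
rewrite sumr_const card_ord -[LHS]mulr_natl.
by move/(mulfI _) ; apply; rewrite pnatr_eq0 -lt0n.
Qed.

End Existence.

(** * Rounding a fractional rule *)

Section Rounding.
Context (R : realType).
Local Notation U := (uniform_prob (@ltr01 R)).

Definition clip (x : R) : R := Num.max 0 (Num.min 1 x).

Lemma clip_lt (c : R) : Ex U (fun s : R => ((s < c)%R)%:R) = clip c.
Proof.
have mc : measurable `]-oo, c[ by exact: measurable_itv.
transitivity (fine (U `]-oo, c[%classic)).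
  rewrite -Ex_indic//; apply: eq_Ex => s; congr ((_ : bool)%:R).
  by apply/idP/idP => [sc|/set_mem /=]; [apply/mem_set|]; rewrite /= in_itv.
rewrite /uniform_prob /clip.
have [c0|c0] := leP c 0.
  rewrite integral_uniform_pdf (_ : _ `&` _ = set0); last first.
    by apply/seteqP; split => x //=; rewrite !in_itv /= => -[xc /andP[x0 _]]; lra.
  rewrite integral_set0 /= min_r; last by lra.
  by rewrite max_l.
have [c1|c1] := leP c 1.
  rewrite integral_uniform_pdf (_ : _ `&` _ = `[0, c[%classic); last first.
    apply/seteqP; split => x /=; rewrite !in_itv /=.
      by move=> [xc /andP[-> _]].
    by move=> /andP[x0 xc]; split => //; rewrite x0 /=; lra.
  rewrite (eq_integral (fun=> 1%E)); last first.
    move=> x /set_mem; rewrite /= in_itv /= => /andP[x0 xc]; rewrite /uniform_pdf x0 /=.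
    by rewrite (le_trans (ltW xc) c1) subr0 invr1.
  rewrite integral_cst//= mul1e lebesgue_measure_itv /= lte_fin c0 /= subr0.
  by rewrite /= max_r// ltW.
rewrite integral_uniform_pdf (_ : _ `&` _ = `[0, 1]%classic); last first.
  apply/seteqP; split => x /=; rewrite !in_itv /=; first by case.
  by move=> /andP[x0 x1]; split; [lra|rewrite x0].
by rewrite integral_uniform_pdf1//= max_r.
Qed.

Lemma sum_clip (j : nat) (y : R) : 0 <= y <= j%:R -> \sum_(z < j) clip (y - z%:R) = y.
Proof.
rewrite /clip; elim: j y => [|j IH] y /andP[y0 yj].
  by rewrite big_ord0; move: yj => /=; lra.
rewrite big_ord_recr /=; have [yj'|jy] := leP y j%:R.
  rewrite IH ?y0// max_l ?addr0// ge_min; apply/orP; right; lra.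
rewrite (eq_bigr (fun=> 1)); last first.
  move=> z _; have : (z.+1)%:R <= j%:R :> R by rewrite ler_nat; exact: ltn_ord.
  rewrite -natr1 => h; rewrite min_l; last by lra.
  by rewrite max_r.
rewrite sumr_const card_ord min_r; last by move: yj; rewrite -natr1; lra.
by rewrite max_r; lra.
Qed.

Variable (n : nat).

Definition psum (p : 'I_n -> n.-tuple R -> R) (j : nat) (t : n.-tuple R) : R :=
  \sum_(l < n | (l < j)%N) p l t.

(* The intervals [S_i, S_(i+1)) of partial sums have length p i t, and agent i
   is served when the i-th one meets s + Z. *)
Definition rounding (p : 'I_n -> n.-tuple R -> R) (i : 'I_n) (t : n.-tuple R) (s : R) :=
  [exists z : 'I_n, (psum p i t <= z%:R + s) && (z%:R + s < psum p i.+1 t)].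

Lemma psumS p (i : 'I_n) t : psum p i.+1 t = psum p i t + p i t.
Proof.
rewrite /psum (bigD1 i)//= addrC; congr (_ + _); apply: eq_bigl => l.
by rewrite ltnS [RHS]ltn_neqAle andbC.
Qed.

Lemma psum0 p t : psum p 0 t = 0.
Proof. by rewrite /psum big1. Qed.

Lemma psumn p t : psum p n t = \sum_(i < n) p i t.
Proof. by apply: eq_bigl => i; exact: ltn_ord. Qed.

Lemma psum_le p (i j : nat) t : (forall i t, 0 <= p i t) -> (i <= j)%N ->
  psum p i t <= psum p j t.
Proof.
move=> p0 ij; rewrite /psum [leLHS]big_mkcond [leRHS]big_mkcond /=.
apply: ler_sum => l _; case: ltnP => li; last by case: ifP.
by rewrite (leq_trans li ij).
Qed.

Lemma rounding_sum p t s (r : nat) : (forall i t, 0 <= p i t) ->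
  \sum_(i < n) p i t <= r%:R -> 0 <= s -> (\sum_(i < n) rounding p i t s <= r)%N.
Proof.
move=> p0 pr s0.
pose A (z i : nat) := (psum p i t <= z%:R + s) && (z%:R + s < psum p i.+1 t).
apply: (@leq_trans (\sum_(i < n) \sum_(z < n) A z i)%N).
  apply: leq_sum => i _; rewrite /rounding; case: existsP => //= -[z hz].
  by rewrite (bigD1 z)//= {1}/A hz.
rewrite exchange_big /=.
have Az (z : nat) : (\sum_(i < n) A z i <= (z < r))%N.
  apply: (@leq_trans ((z%:R + s < psum p n t)%R)).
    rewrite -(big_mkord xpredT (fun i => nat_of_bool (A z i))).
    suff H (j : nat) : (\sum_(0 <= i < j) A z i <= (z%:R + s < psum p j t)%R)%N by exact: H.
    elim: j => [|j IH]; first by rewrite big_geq.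
    rewrite big_nat_recr//= {2}/A; have [h|h] /= := leP (psum p j t) (z%:R + s).
      by move: IH; rewrite ltNge h /= leqn0 => /eqP ->.
    by rewrite addn0; apply: leq_trans IH _; rewrite h (lt_le_trans h)// psum_le.
  rewrite psumn; have [h|//] := ltP; rewrite -(ltr_nat R) (_ : (_ < _) = true)//.
  by apply: lt_le_trans pr; apply: le_lt_trans h; rewrite lerDl.
apply: (@leq_trans (\sum_(z < n) (z < r))%N); first exact: leq_sum.
elim: n => [|j IH]; first by rewrite big_ord0.
rewrite big_ord_recr /=; case: (ltnP j r) => jr; last by rewrite addn0.
rewrite addn1; apply: leq_ltn_trans jr.
apply: (@leq_trans (\sum_(z < j) 1)%N); last by rewrite sum1_card card_ord.
by apply: leq_sum => z _; exact: leq_b1.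
Qed.

Lemma rounding_eq0 p i t s : p i t = 0 -> rounding p i t s = false.
Proof.
move=> pi; apply/negbTE; rewrite negb_exists; apply/forallP => z.
by rewrite psumS pi addr0; case: leP => //= h; rewrite ltNge h.
Qed.

Lemma bm_psum p j : (forall i, bm (p i)) -> bm (psum p j).
Proof. by move=> bp; exact: bm_sum. Qed.

Lemma measurable_rounding p i : (forall i, bm (p i)) ->
  measurable_fun setT (fun w : n.-tuple R * R => rounding p i w.1 w.2).
Proof.
move=> bp.
have mp j : measurable_fun setT (fun w : n.-tuple R * R => psum p j w.1).
  apply: (measurableT_comp (bm_measurable (bm_psum j bp))); exact: measurable_fst.
have mz (z : nat) : measurable_fun setT (fun w : n.-tuple R * R => z%:R + w.2).
  by apply: measurable_funD; [exact: measurable_cst|exact: measurable_snd].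
rewrite (_ : (fun w => _) = (fun w : n.-tuple R * R => (0 < \sum_(z < n)
    ((psum p i w.1 <= z%:R + w.2)%R && (z%:R + w.2 < psum p i.+1 w.1)%R))%N)).
  apply: (measurable_nat2 (fun u v => u < v)%N); first exact: bmn_cst.
  apply: bmn_sum => z; apply: bmn_bool; apply: measurable_and.
    exact: measurable_fun_ler.
  exact: measurable_fun_ltr.
apply/funext => w; rewrite /rounding; apply/existsP/idP => [[z hz]|].
  by rewrite (bigD1 z)//= hz.
rewrite lt0n sum_nat_eq0 negb_forall => /existsP[z]; rewrite implyTb eqb0 negbK => hz.
by exists z.
Qed.

Lemma rounding_prob p i t : (forall i t, 0 <= p i t <= 1) ->
  Ex U (fun s => (rounding p i t s)%:R) = p i t.
Proof.
move=> p01; have p0 j u : 0 <= p j u by have /andP[] := p01 j u.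
set a := psum p i t; set b := psum p i.+1 t.
have ab : b = a + p i t by rewrite /b psumS.
have /andP[pi0 pi1] := p01 i t.
have a0 : 0 <= a by rewrite -(psum0 p t) psum_le.
have bn : b <= n%:R.
  apply: (@le_trans _ _ (psum p n t)); first by rewrite psum_le.
  rewrite psumn; apply: (@le_trans _ _ (\sum_(j < n) 1)); last by rewrite sumr_const card_ord.
  by apply: ler_sum => j _; have /andP[] := p01 j t.
have E (s : R) : (rounding p i t s)%:R =
    \sum_(z < n) (((s < b - z%:R)%R)%:R - ((s < a - z%:R)%R)%:R) :> R.
  have F (z : nat) : ((s < b - z%:R)%R)%:R - ((s < a - z%:R)%R)%:R =
      ((a <= z%:R + s)%R && (z%:R + s < b)%R)%:R :> R.
    rewrite !ltrBrDr [s + _]addrC; case: (leP a) => h /=.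
      by rewrite subr0.
    by rewrite (lt_le_trans h) ?subrr// ab lerDl.
  under eq_bigr do rewrite F.
  rewrite /rounding -/a -/b; case: existsP => [[z hz]|h] /=; last first.
    rewrite big1// => z _; case: andP => // hz; exfalso; apply: h; exists z; exact/andP.
  rewrite (bigD1 z)//= hz big1 ?addr0// => z' zz'; case: andP => // -[h1 h2].
  exfalso; case/andP: hz => h3 h4; move: zz'; rewrite -val_eqE /= neq_ltn => /orP[] lt.
    have : (z'.+1)%:R <= z%:R :> R by rewrite ler_nat.
    by rewrite -natr1 => ?; lra.
  have : (z.+1)%:R <= z'%:R :> R by rewrite ler_nat.
  by rewrite -natr1 => ?; lra.
have bs (c : R) : bm (fun s : R => ((s < c)%R)%:R : R).
  by apply: bm_bool; apply: measurable_fun_ltr => //; exact: measurable_cst.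
transitivity (Ex U (fun s : R => \sum_(z < n)
    (((s < b - z%:R)%R)%:R - ((s < a - z%:R)%R)%:R))); first exact: eq_Ex.
rewrite Ex_sum; last by move=> z; apply: bmB; exact: bs.
rewrite (eq_bigr (fun z : 'I_n => clip (b - z%:R) - clip (a - z%:R))); last first.
  move=> z _; rewrite ExB; [|exact: bs|exact: bs].
  by congr (_ - _); exact: clip_lt.
rewrite sumrB !sum_clip ?ab; first by rewrite addrC addKr.
  by rewrite a0 /= (le_trans _ bn)// ab lerDl.
by rewrite -ab bn andbT ab addr_ge0.
Qed.

End Rounding.

(** * The merit-based allocation *)

Lemma le_meas d (T : measurableType d) (R : realType)
    (nu : {measure set T -> \bar R}) (A B : set T) :
  measurable A -> measurable B -> A `<=` B -> (nu A <= nu B)%E.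
Proof. by move=> mA mB AB; apply: le_measure => //; exact/mem_set. Qed.

Section Cdf.
Context (R : realType) (mu : probability R R) (f : R -> R).
Hypothesis hf : has_positive_density mu f.
Local Notation F := (type_cdf mu).
Local Notation leb := (@lebesgue_measure R).

Lemma mu_null (A : set R) : measurable A -> leb (A `&` `[0, 1]) = 0%E -> mu A = 0%E.
Proof.
move=> mA A0; have [mf f0 ->] := hf => //.
apply: null_set_integral => //; first exact: measurableI.
by apply/measurable_EFinP; apply: (measurable_funS _ (@subIsetr _ _ _) mf).
Qed.

Lemma mu_outside : mu (~` `[0, 1]) = 0%E.
Proof.
apply: mu_null; first exact: measurableC.
by rewrite setICl measure0.
Qed.

Lemma mu_set1 x : mu [set x] = 0%E.
Proof.
apply: mu_null => //; apply/eqP; rewrite -measure_le0.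
apply: (@le_trans _ _ (leb [set x])); last by rewrite lebesgue_measure_set1.
apply: le_meas => //.
by apply: measurableI; [exact: measurable_set1|exact: measurable_itv].
Qed.

Lemma cdf_mono (x y : R) : x <= y -> F x <= F y.
Proof.
move=> xy; rewrite /type_cdf fine_le ?fin_num_measure//.
by apply: le_meas => //; apply: subitvPr; rewrite bnd_simp.
Qed.

Lemma cdf01 x : 0 <= F x <= 1.
Proof.
rewrite /type_cdf fine_ge0//= -lee_fin fineK ?fin_num_measure//.
exact: probability_le1.
Qed.

Lemma cdf_sub (x y : R) : x <= y -> fine (mu `]x, y]%classic) = F y - F x.
Proof.
move=> xy; apply/eqP; rewrite eq_sym subr_eq addrC; apply/eqP.
rewrite /type_cdf -fineD ?fin_num_measure//; congr fine.
rewrite -measureU//.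
  by rewrite -itv_bndbnd_setU ?bnd_simp.
apply/seteqP; split => z //=; rewrite !in_itv /= => -[zx /andP[xz _]].
by move: xz; rewrite ltNge zx.
Qed.

Lemma cdf_gt (x : R) : fine (mu `]x, +oo[%classic) = 1 - F x.
Proof.
apply/eqP; rewrite eq_sym subr_eq; apply/eqP.
rewrite /type_cdf -fineD ?fin_num_measure// -measureU//; last first.
  apply/seteqP; split => z //=; rewrite !in_itv /= andbT => -[xz zx].
  by move: xz; rewrite ltNge zx.
rewrite setUC -itv_bndbnd_setU ?bnd_simp// set_itvNyy -[1]/(fine (1%E : \bar R)).
by congr fine; exact/esym/probability_setT.
Qed.

Lemma cdf_lt_mono (x y : R) : 0 <= x -> x < y -> y <= 1 -> F x < F y.
Proof.
move=> x0 xy y1; rewrite -subr_gt0 -cdf_sub ?(ltW xy)//.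
have [mf f0 muE] := hf.
apply: fine_gt0; apply/andP; split; last first.
  by apply: le_lt_trans (probability_le1 _ _) (ltry _).
rewrite muE// lt0e integral_ge0 ?andbT; last first.
  by move=> z [_ /=]; rewrite in_itv /= lee_fin => /f0 /ltW.
apply/negP => /eqP I0.
have I1 : `]x, y]%classic `&` `[0, 1]%classic = `]x, y]%classic :> set R.
  apply/seteqP; split => z /=; rewrite !in_itv /=; first by case.
  by move=> /andP[xz zy]; split; [rewrite xz|apply/andP; split; lra].
rewrite I1 in I0.
have fp z : `]x, y]%classic z -> 0 < f z.
  by rewrite /= in_itv /= => /andP[xz zy]; apply: f0; apply/andP; split; lra.
have mf' : measurable_fun `]x, y] f.
  by apply: (measurable_funS _ _ mf) => //; rewrite -I1; exact: subIsetr.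
have : (\int[leb]_(z in `]x, y]) `|(EFin \o f) z| = 0)%E.
  rewrite -[RHS]I0; apply: eq_integral => z /set_mem /fp fz.
  by rewrite /= ger0_norm// ltW.
move/(ae_eq_integral_abs leb (measurable_itv _) ((measurable_EFinP _ _).2 mf')).1.
move=> [N [mN N0 sub]].
have : (leb `]x, y]%classic <= leb N)%E.
  apply: le_meas => //.
  by move=> z zxy; apply: sub => /= /(_ zxy) [] fz; have := fp z zxy; rewrite fz ltxx.
by rewrite N0 lebesgue_measure_itv /= lte_fin xy -EFinD lee_fin leNgt subr_gt0 xy.
Qed.

Lemma cdf0 (x : R) : x <= 0 -> F x = 0.
Proof.
move=> x0; rewrite /type_cdf mu_null//.
apply/eqP; rewrite -measure_le0.
apply: (@le_trans _ _ (leb [set 0%R])); last by rewrite lebesgue_measure_set1.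
apply: le_meas => //; first by apply: measurableI; exact: measurable_itv.
move=> z [h1 h2]; move: h1 h2; rewrite /= !in_itv /= => zx /andP[z0 _].
by apply/eqP; rewrite eq_le z0 (le_trans zx x0).
Qed.

Lemma cdf1 (x : R) : 1 <= x -> F x = 1.
Proof.
move=> x1; apply/eqP; rewrite eq_sym -subr_eq0 -cdf_gt mu_null//.
rewrite (_ : _ `&` _ = set0) ?measure0//.
by apply/seteqP; split => z //=; rewrite !in_itv /= andbT => -[xz /andP[_ z1]]; lra.
Qed.

Lemma cdf_continuous : {within `[0, 1], continuous F}.
Proof.
have [mf f0 muE] := hf.
have intf : leb.-integrable `[0, 1] (EFin \o f).
  apply/integrableP; split; first exact/measurable_EFinP.
  rewrite [X in (X < _)%E](_ : _ = mu setT); last first.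
    rewrite muE// setTI; apply: eq_integral => z /set_mem /=.
    by rewrite in_itv /= => /f0 fz; rewrite ger0_norm// ltW.
  by apply: le_lt_trans (probability_le1 _ _) (ltry _).
have := parameterized_integral_continuous (ler01 : (0:R) <= 1) intf.
move=> h; apply: (subspace_eq_continuous _ h) => x /set_mem /=.
rewrite in_itv /= => /andP[x0 x1].
rewrite /from_subspace /parameterized_integral /Rintegral /type_cdf muE//; congr (fine (integral _ _ _)).
apply/seteqP; split => z /=; rewrite !in_itv /=.
  by move=> /andP[z0 zx]; rewrite zx z0 (le_trans zx x1).
by move=> [zx /andP[z0 _]]; rewrite z0.
Qed.

Lemma cdf_surj q : 0 <= q <= 1 -> exists2 x : R, 0 <= x <= 1 & F x = q.
Proof.
move=> q01; have [|x] := @IVT R F 0 1 q ler01 cdf_continuous.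
  by rewrite cdf0// cdf1// min_l// max_r.
by rewrite in_itv /= => x01 Fx; exists x.
Qed.

Lemma measurable_cdf : measurable_fun setT F.
Proof. by apply: nondecreasing_measurable => // x y xy; exact: cdf_mono. Qed.

Definition upper q : set R := [set x | q <= F x].

Lemma measurable_upper q : measurable (upper q).
Proof.
apply/measurable_boolP; apply: measurable_fun_ler; first exact: measurable_cst.
exact: measurable_cdf.
Qed.

Lemma cdf_inj (x y : R) : 0 <= x <= 1 -> 0 <= y <= 1 -> F x = F y -> x = y.
Proof.
move=> /andP[x0 x1] /andP[y0 y1] e; case: (ltgtP x y) => // h.
  by have := cdf_lt_mono x0 h y1; rewrite e ltxx.
by have := cdf_lt_mono y0 h x1; rewrite e ltxx.
Qed.

Lemma mu_level q : mu [set x | F x = q] = 0%E.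
Proof.
have mA : measurable [set x | F x = q].
  rewrite (_ : [set x | F x = q] = [set x | F x == q]); last first.
    by apply/seteqP; split => x /= /eqP.
  apply/measurable_boolP; apply: measurable_fun_eqr; first exact: measurable_cdf.
  exact: measurable_cst.
apply: mu_null => //.
have [[x [x01 Fx]]|no] := pselect (exists x : R, 0 <= x <= 1 /\ F x = q); last first.
  rewrite (_ : _ `&` _ = set0) ?measure0//.
  by apply/seteqP; split => y //= [Fy]; rewrite in_itv /= => y01; apply: no; exists y.
apply/eqP; rewrite -measure_le0.
apply: (@le_trans _ _ (leb [set x])); last by rewrite lebesgue_measure_set1.
apply: le_meas => //; first by apply: measurableI => //; exact: measurable_itv.
by move=> y [/= Fy]; rewrite in_itv /= => y01; apply: cdf_inj => //; rewrite Fx.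
Qed.

Lemma mu_upper q : 0 <= q <= 1 -> fine (mu (upper q)) = 1 - q.
Proof.
move=> q01; have [x x01 Fx] := cdf_surj q01.
rewrite -{2}Fx -cdf_gt.
have mlev : measurable [set x | F x = q].
  rewrite (_ : [set x | F x = q] = [set x | F x == q]); last first.
    by apply/seteqP; split => y /= /eqP.
  apply/measurable_boolP; apply: measurable_fun_eqr; first exact: measurable_cdf.
  exact: measurable_cst.
congr fine; apply/eqP; rewrite eq_le; apply/andP; split.
  have -> : mu `]x, +oo[%classic = mu (`]x, +oo[ `|` [set y | F y = q]).
    by rewrite measureU0//; exact: mu_level.
  apply: le_meas => //; [exact: measurable_upper|exact: measurableU|].
  move=> y /= qy; have [xy|yx] := ltP x y; first by left; rewrite /= in_itv /= xy.
  by right; apply/eqP; rewrite /= eq_le qy -Fx cdf_mono.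
apply: le_meas => //; first exact: measurable_upper.
by move=> y; rewrite /= in_itv /= andbT => xy; rewrite /upper /= -Fx cdf_mono// ltW.
Qed.

End Cdf.

Section Degenerate.
Context (R : realType) (mu : probability R R) (n : nat).
Hypothesis mu1 : forall x, mu [set x] = 0%E.

Definition degenerate (x : R) (Z : set R) : set (n.-tuple R) :=
  [set t | [exists j, [|| tnth t j \in Z, tnth t j == x |
     [exists l, (l != j) && (tnth t l == tnth t j)]]]].

Lemma measurable_tnth_eq i j :
  measurable_fun setT (fun t : n.-tuple R => tnth t i == tnth t j).
Proof. by apply: measurable_fun_eqr; exact: measurable_tnth. Qed.

Lemma Ex_tnth (Z : set R) i : measurable Z -> mu Z = 0%E ->
  Ex (iid mu n) (fun t => (tnth t i \in Z)%:R) = 0.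
Proof.
move=> mZ Z0; rewrite (Ex_resample mu i); last first.
  by apply: bm_bool; apply: measurable_mem => //; exact: measurable_tnth.
transitivity (Ex mu (fun x => (x \in Z)%:R)); last by rewrite Ex_indic// Z0.
apply: eq_Ex => x; rewrite -[RHS](Ex_cst (iid mu n)); apply: eq_Ex => t.
by rewrite tnth_mktuple eqxx.
Qed.

Lemma Ex_tnth_eq i j : i != j ->
  Ex (iid mu n) (fun t => (tnth t i == tnth t j)%:R) = 0.
Proof.
move=> ij; rewrite (Ex_resample mu i); last first.
  by apply: bm_bool; exact: measurable_tnth_eq.
rewrite -(Ex_cst mu 0); apply: eq_Ex => x.
transitivity (Ex (iid mu n) (fun t => (tnth t j \in [set x])%:R)).
  apply: eq_Ex => t; congr ((_ : bool)%:R); rewrite !tnth_mktuple eqxx.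
  rewrite eq_sym; rewrite [j == i]eq_sym (negbTE ij).
  by apply/eqP/idP => [->|/set_mem//]; exact/mem_set.
by rewrite Ex_tnth//.
Qed.

Lemma measurable_degenerate x Z : measurable Z -> measurable (degenerate x Z).
Proof.
move=> mZ; apply/measurable_boolP.
pose c (t : n.-tuple R) := (\sum_(j < n) ((tnth t j \in Z) + ((tnth t j == x) +
     \sum_(l < n | l != j) (tnth t l == tnth t j))))%N.
rewrite (_ : (fun t => _) = fun t => (0 < c t)%N).
  apply: (measurable_nat2 (fun u v => u < v)%N); first exact: bmn_cst.
  apply: bmn_sum => j; apply: (bmn2 addn).
    by apply: bmn_bool; apply: measurable_mem => //; exact: measurable_tnth.
  apply: (bmn2 addn).
    by apply: bmn_bool; apply: measurable_fun_eqr; [exact: measurable_tnth|exact: measurable_cst].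
  by apply: bmn_sum => l; apply: bmn_bool; exact: measurable_tnth_eq.
apply/funext => t; rewrite lt0n sum_nat_eq0 negb_forall; apply: eq_existsb => j.
rewrite /= addn_eq0 addn_eq0 !eqb0 sum_nat_eq0 !negb_and !negbK negb_forall.
by congr [|| _, _ | _]; apply: eq_existsb => l; rewrite negb_imply eqb0 negbK.
Qed.

Lemma degenerate_null x Z : measurable Z -> mu Z = 0%E ->
  iid mu n (degenerate x Z) = 0%E.
Proof.
move=> mZ Z0; have mD := measurable_degenerate x mZ.
have bZ j : bm (fun t : n.-tuple R => (tnth t j \in Z)%:R : R).
  by apply: bm_bool; apply: measurable_mem => //; exact: measurable_tnth.
have bx j : bm (fun t : n.-tuple R => (tnth t j \in [set x])%:R : R).
  by apply: bm_bool; apply: measurable_mem => //; exact: measurable_tnth.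
have be j l : bm (fun t : n.-tuple R => (tnth t l == tnth t j)%:R : R).
  by apply: bm_bool; exact: measurable_tnth_eq.
have bs j : bm (fun t : n.-tuple R => \sum_(l < n | l != j) (tnth t l == tnth t j)%:R : R).
  exact: bm_sum.
rewrite -[LHS]fineK ?fin_num_measure// -Ex_indic//; congr EFin; apply/eqP.
rewrite eq_le Ex_ge0 ?andbT//.
apply: (@le_trans _ _ (Ex (iid mu n) (fun t => \sum_(j < n)
   ((tnth t j \in Z)%:R + ((tnth t j \in [set x])%:R +
     \sum_(l < n | l != j) (tnth t l == tnth t j)%:R))))).
  apply: Ex_le.
  - by apply: bm_bool; apply: measurable_mem.
  - by apply: bm_sum => j; apply: bmD => //; exact: bmD.
  move=> t; case: (boolP (t \in degenerate x Z)) => [/set_mem|_]; last first.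
    by apply: sumr_ge0 => j _; rewrite !addr_ge0// sumr_ge0.
  move=> /existsP[j h]; rewrite (bigD1 j)//=.
  apply: ler_wpDr; first by apply: sumr_ge0 => l _; rewrite !addr_ge0// sumr_ge0.
  case/or3P: h => [->|/eqP tx|/existsP[l /andP[lj tl]]].
  - by rewrite lerDl addr_ge0// sumr_ge0.
  - by rewrite ler_wpDl// ler_wpDr ?sumr_ge0// mem_set.
  - by rewrite ler_wpDl// ler_wpDl// (bigD1 l)//= tl lerDl sumr_ge0.
rewrite Ex_sum; last by move=> j; apply: bmD => //; exact: bmD.
rewrite big1// => j _; rewrite !ExD//; last exact: bmD.
rewrite !Ex_tnth// Ex_sum// big1 ?addr0// => l lj.
exact: Ex_tnth_eq.
Qed.

Lemma not_degenerate x Z t : ~ degenerate x Z t ->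
  [/\ forall j, ~ Z (tnth t j), forall j, tnth t j != x & injective (tnth t)].
Proof.
move=> /negP; rewrite negb_exists => /forallP h.
have {}h j : [/\ ~ Z (tnth t j), tnth t j != x & forall l, l != j -> tnth t l != tnth t j].
  have := h j; rewrite negb_or => /andP[h1].
  rewrite negb_or negb_exists => /andP[h2 /forallP h3].
  split => // [Zt|l lj]; first by apply: (negP h1); exact: mem_set.
  by have := h3 l; rewrite lj.
split => [j|j|j l jl]; [by have [] := h j|by have [] := h j|].
apply/eqP; apply: contraT => jl'.
by have [_ _ /(_ _ jl')] := h l; rewrite jl eqxx.
Qed.

Lemma uniq_set_coord i x (t : n.-tuple R) : injective (tnth t) ->
  (forall j, tnth t j != x) -> uniq (set_coord i x t).
Proof.
move=> tinj tx; apply/tuple_uniqP => j l; rewrite !tnth_mktuple.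
case: (eqVneq j i) => [->|ji]; case: (eqVneq l i) => [->//|li].
- by move=> /eqP; rewrite eq_sym (negbTE (tx l)).
- by move=> /eqP; rewrite (negbTE (tx j)).
- exact: tinj.
Qed.

End Degenerate.

Section Merit.
Context (R : realType) (n m k : nat) (phi : R) (mu : probability R R).
Hypothesis hkm : (k < m)%N.
Local Notation F := (type_cdf mu).
Variables (q1 q2 c b : R).
Hypothesis reg : regions n m k phi q1 q2 c b.

Local Notation pm := (p_merit m k phi mu).
Implicit Types (t : n.-tuple R) (i : 'I_n).

Lemma among_highest_mono r s t i : (r <= s)%N -> among_highest r t i ->
  among_highest s t i.
Proof. by move=> rs h; exact: leq_trans h rs. Qed.

Lemma merit_allo t i : uniq t -> 0 <= tnth t i <= 1 ->
  q1 <= F (tnth t i) < q2 \/ b <= F (tnth t i) -> pm i t = among_highest m t i.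
Proof.
move=> ut ti h; have [h1 h2] : c_allo n m (F (tnth t i)) <= c_aud n k phi (F (tnth t i)) /\
    c_allo n m (F (tnth t i)) <= c_ic n m phi (F (tnth t i)).
  apply: (reg_allo reg); case: h => [h|h]; [by left|right].
  by rewrite h; have /andP[] := cdf01 mu (tnth t i).
rewrite /p_merit ut /= mem_set /=; last by [].
by apply/orP/idP => [[//|/andP[_]]|->]; [exact/among_highest_mono/ltnW|left].
Qed.

Lemma merit_aud t i : uniq t -> 0 <= tnth t i <= 1 ->
  c <= F (tnth t i) < b -> q2 < F (tnth t i) -> pm i t = among_highest k t i.
Proof.
move=> ut ti h h2; have [a1 a2] := reg_aud reg h; have a3 := reg_aud_strict reg h h2.
rewrite /p_merit ut /= memNset /=; last by move=> [_]; rewrite leNgt a3.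
by rewrite mem_set.
Qed.

Lemma merit_ic t i : 0 <= tnth t i <= 1 ->
  0 < F (tnth t i) < q1 \/ q2 < F (tnth t i) < c -> pm i t = false.
Proof.
move=> ti h; have [a1 a2] := reg_ic_strict reg h.
rewrite /p_merit memNset /=; last by move=> [_ _]; rewrite leNgt a2.
by rewrite memNset ?andbF//; move=> [_ _]; rewrite leNgt a1.
Qed.

Definition above (q : R) t : nat := \sum_(i < n) (q <= F (tnth t i))%R.

Lemma count_highest r q t : uniq t ->
  (\sum_(i < n) (among_highest r t i && (q <= F (tnth t i))%R) = minn r (above q t))%N.
Proof.
move=> /tuple_uniqP ut.
have cardb (B : pred 'I_n) : (\sum_(i < n) B i)%N = #|[set i | B i]%SET|.
  by rewrite -sum1_card [RHS]big_mkcond /=; apply: eq_bigr => i _; rewrite inE; case: (B i).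
pose A := [set i | (q <= F (tnth t i))%R]%SET.
rewrite /above [X in minn _ X]cardb -/A.
rewrite -(@card_rank_lt _ A (fun j i => (tnth t i < tnth t j)%R) r); first last.
- move=> i j _ _ ij; case: ltgtP => // /ut e; by rewrite e eqxx in ij.
- by move=> y x z _ _ _ xy yz; exact: lt_trans yz xy.
- by move=> x _; exact: ltxx.
rewrite cardb; apply: eq_card => i; rewrite !inE andbC; apply: andb_id2l => qi.
rewrite /among_highest; congr (_ < _)%N; apply: eq_card => j; rewrite !inE.
case: (boolP (tnth t i < tnth t j)) => [ij|_]; last by rewrite andbF.
by rewrite andbT (le_trans qi)// cdf_mono// ltW.
Qed.

Definition exceptional : set R := ~` `[0, 1] `|` [set x | F x = 0 \/ F x = q2].

Lemma merit_among t i : pm i t -> among_highest m t i.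
Proof. by case/andP => _ /orP[/andP[]//|/andP[_]]; exact/among_highest_mono/ltnW. Qed.

Lemma merit_total t : uniq t ->
  (forall i, ~ exceptional (tnth t i) \/ ~~ among_highest m t i) ->
  (\sum_(i < n) pm i t + minn k (above b t) + minn m (above q2 t) =
   minn m (above b t) + minn k (above c t) + minn m (above q1 t))%N.
Proof.
move=> ut hex; rewrite -!count_highest// -!big_split /=; apply: eq_bigr => i _.
case: (hex i) => {}hex; last first.
  rewrite (negbTE (contra (@among_highest_mono _ _ _ _ (ltnW hkm)) hex)).
  by rewrite (negbTE hex) (negbTE (contra (@merit_among t i) hex)).
have ti : 0 <= tnth t i <= 1.
  apply: contrapT => h; apply: hex; left => /=; by rewrite in_itv.
have Fi : 0 < F (tnth t i).
  have /andP[+ _] := cdf01 mu (tnth t i); rewrite le_eqVlt => /predU1P[e|//].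
  by exfalso; apply: hex; right; left.
have F2 : F (tnth t i) != q2.
  by apply/eqP => e; apply: hex; right; right.
have [r1 r2 r3 r4 r5] := reg_le reg.
have [lt1|ge1] := ltP (F (tnth t i)) q1.
  rewrite merit_ic//; last by left; rewrite Fi.
  have nle q : q1 <= q -> (q <= F (tnth t i)) = false.
    by move=> qq; apply/negbTE; rewrite -ltNge (lt_le_trans lt1).
  have r13 := le_trans r2 r3; have r14 := le_trans r13 r4.
  by rewrite !nle// !andbF.
have [lt2|] := ltP (F (tnth t i)) q2.
  rewrite merit_allo//; last by left; rewrite ge1.
  rewrite [c <= _]leNgt (lt_le_trans lt2 r3) [b <= _]leNgt (lt_le_trans lt2 (le_trans r3 r4)).
  by rewrite !andbF !andbT /= ?addn0 ?add0n.
rewrite le_eqVlt eq_sym (negbTE F2) /= => gt2.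
have [ltc|gec] := ltP (F (tnth t i)) c.
  rewrite merit_ic//; last by right; rewrite gt2.
  by rewrite [b <= _]leNgt (lt_le_trans ltc r4) /= !andbF !andbT.
have [ltb|geb] := ltP (F (tnth t i)) b.
  by rewrite merit_aud ?gec// !andbF !andbT /= ?addn0 ?add0n.
by rewrite merit_allo//; [rewrite !andbT|right].
Qed.

End Merit.

(* X1, X2, Xc, Xb count the types above q1, q2, c, b, b0 and b1 those in two
   sets of lottery types below q1 and in (q2, b), ub those of the latter that
   are served on merit; M objects go to merit and r remain. *)
Lemma lottery_room (m k M r el ub X1 X2 Xb Xc b0 b1 : nat) :
  (k < m)%N -> (r + M = m)%N ->
  (M + minn k Xb + minn m X2 = minn m Xb + minn k Xc + minn m X1)%N ->
  (el + ub = b0 + b1)%N -> (ub <= b1)%N ->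
  (ub + minn k Xb <= minn k Xc)%N -> (ub + minn k Xb <= k)%N ->
  (Xb + b1 <= X2)%N -> (Xb <= Xc)%N -> (Xc <= X2)%N -> (X2 <= X1)%N ->
  (minn m (Xb + b1) + minn k Xb + minn m (X1 + b0) <=
   minn r el + minn m Xb + minn k (Xb + b1) + minn m X1)%N /\
  (minn m (Xb + b1) + minn k Xb + minn m (X1 + b0) <=
   minn r el + minn m Xb + minn k Xc + minn m X1)%N.
Proof.
lia.
Qed.

Section MeritRule.
Context (R : realType) (n m k : nat) (phi : R) (mu : probability R R) (f : R -> R).
Hypothesis hkm : (k < m)%N.
Hypothesis hf : has_positive_density mu f.
Local Notation F := (type_cdf mu).
Variables (q1 q2 c b : R).
Hypothesis reg : regions n m k phi q1 q2 c b.

Local Notation pm := (p_merit m k phi mu).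
Implicit Types (t : n.-tuple R) (i : 'I_n).

Lemma measurable_C_allo : measurable (C_allo n m k phi mu).
Proof.
have mF := measurable_cdf mu.
have mc g : continuous g -> measurable_fun setT (fun x : R => (g (F x) : R)).
  by move=> cg; apply: measurableT_comp => //; exact: continuous_measurable_fun.
have ca := is_derive_continuous (@is_derive_allo R n m).
have cu := is_derive_continuous (@is_derive_aud R n k phi).
have ci := is_derive_continuous (@is_derive_ic R n m phi).
rewrite (_ : C_allo _ _ _ _ _ = [set x | [&& (0 <= x), (x <= 1),
   c_allo n m (F x) <= c_aud n k phi (F x) & c_allo n m (F x) <= c_ic n m phi (F x)]]).
  apply/measurable_boolP; do ![apply: measurable_and];
    apply: measurable_fun_ler => //; try exact: measurable_cst; exact: mc.
by apply/seteqP; split => x /=; [case=> /andP[h1 h2] h3 h4; exact/and4P|move=> /and4P[h1 h2 h3 h4]; split => //; exact/andP].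
Qed.

Lemma measurable_C_aud : measurable (C_aud n m k phi mu).
Proof.
have mF := measurable_cdf mu.
have mc g : continuous g -> measurable_fun setT (fun x : R => (g (F x) : R)).
  by move=> cg; apply: measurableT_comp => //; exact: continuous_measurable_fun.
have ca := is_derive_continuous (@is_derive_allo R n m).
have cu := is_derive_continuous (@is_derive_aud R n k phi).
have ci := is_derive_continuous (@is_derive_ic R n m phi).
rewrite (_ : C_aud _ _ _ _ _ = [set x | [&& (0 <= x), (x <= 1),
   c_aud n k phi (F x) <= c_allo n m (F x) & c_aud n k phi (F x) <= c_ic n m phi (F x)]]).
  apply/measurable_boolP; do ![apply: measurable_and];
    apply: measurable_fun_ler => //; try exact: measurable_cst; exact: mc.
by apply/seteqP; split => x /=; [case=> /andP[h1 h2] h3 h4; exact/and4P|move=> /and4P[h1 h2 h3 h4]; split => //; exact/andP].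
Qed.

Lemma among_highestE r t i : among_highest r t i =
  (\sum_(j < n) (tnth t i < tnth t j)%R < r)%N.
Proof.
rewrite /among_highest; congr (_ < _)%N.
by rewrite -sum1_card big_mkcond /=; apply: eq_bigr => j _; rewrite inE; case: (_ < _).
Qed.

Lemma measurable_among_highest r i :
  measurable_fun setT (fun t => among_highest r t i).
Proof.
rewrite (_ : (fun t => _) = fun t => (\sum_(j < n) (tnth t i < tnth t j)%R < r)%N).
  apply: (measurable_nat2 (fun u v => u < v)%N); last exact: bmn_cst.
  by apply: bmn_sum => j; apply: bmn_bool; apply: measurable_fun_ltr; exact: measurable_tnth.
by apply/funext => t; exact: among_highestE.
Qed.

Lemma measurable_uniq : measurable_fun setT (fun t => uniq t).
Proof.
rewrite (_ : (fun t => _) = fun t => (\sum_(i < n) \sum_(j < n | j != i)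
    (tnth t i == tnth t j) == 0)%N).
  apply: (measurable_nat2 (fun u v => u == v)%N); last exact: bmn_cst.
  apply: bmn_sum => i; apply: bmn_sum => j; apply: bmn_bool; exact: measurable_tnth_eq.
apply/funext => t; apply/tuple_uniqP/idP => [tinj|].
  rewrite sum_nat_eq0; apply/forallP => i; rewrite implyTb sum_nat_eq0; apply/forallP => j.
  by apply/implyP => ji; rewrite eqb0; apply: contra ji => /eqP/tinj ->.
rewrite sum_nat_eq0 => /forallP h i j e; apply/eqP; apply: contraT => ij.
have := h j; rewrite implyTb sum_nat_eq0 => /forallP/(_ i)/implyP/(_ ij).
by rewrite e eqxx.
Qed.

Lemma measurable_merit i : measurable_fun setT (fun t => pm i t).
Proof.
have mt : measurable_fun setT (fun t => tnth t i) by exact: measurable_tnth.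
apply: measurable_and; first exact: measurable_uniq.
apply: measurable_or; apply: measurable_and; try exact: measurable_among_highest.
  exact: (measurable_mem mt measurable_C_allo).
exact: (measurable_mem mt measurable_C_aud).
Qed.

Lemma merit_permt s i t : pm i (permt s t) = pm (s i) t.
Proof.
rewrite /p_merit tnth_mktuple.
have ah r : among_highest r (permt s t) i = among_highest r t (s i).
  rewrite !among_highestE; congr (_ < _)%N; rewrite [RHS](reindex_inj (@perm_inj _ s)).
  by apply: eq_bigr => j _; rewrite !tnth_mktuple.
rewrite !ah; congr (_ && _).
apply/tuple_uniqP/tuple_uniqP => tinj j l.
  rewrite -(permKV s j) -(permKV s l) => e; congr (s _); apply: tinj.
  by rewrite !tnth_mktuple.
by rewrite !tnth_mktuple => /tinj/perm_inj.
Qed.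

Lemma merit_le t : (\sum_(i < n) pm i t <= m)%N.
Proof.
case: (boolP (uniq t)) => ut; last first.
  by rewrite big1// => i _; rewrite /p_merit (negbTE ut).
apply: (@leq_trans (minn m (above mu 0 t))); last exact: geq_minl.
rewrite -count_highest//; apply: leq_sum => i _.
have -> : 0 <= F (tnth t i) by have /andP[] := cdf01 mu (tnth t i).
rewrite andbT /p_merit ut /=; case: (boolP (among_highest m t i)) => [_|h].
  exact: leq_b1.
rewrite andbF /= (_ : among_highest k t i = false) ?andbF//.
by apply: contraNF h; apply: among_highest_mono; exact: ltnW.
Qed.

Definition remaining t : nat := (m - \sum_(i < n) pm i t)%N.

Definition lottery_types : set R := [set x | 0 < F x < q1 \/ q2 < F x < b].

Definition eligible i t : bool := (tnth t i \in lottery_types) && ~~ pm i t.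

Lemma measurable_between (u v : R) : measurable [set x | u < F x < v].
Proof.
apply/measurable_boolP; apply: measurable_and; apply: measurable_fun_ltr;
  by [exact: measurable_cst|exact: measurable_cdf].
Qed.

Lemma measurable_lottery_types : measurable lottery_types.
Proof.
rewrite (_ : lottery_types = [set x | 0 < F x < q1] `|` [set x | q2 < F x < b])//.
by apply: measurableU; exact: measurable_between.
Qed.

Lemma measurable_eligible i : measurable_fun setT (eligible i).
Proof.
apply: measurable_and.
  apply: measurable_mem; [exact: measurable_tnth|exact: measurable_lottery_types].
by apply: measurable_neg; exact: measurable_merit.
Qed.

Lemma bmn_remaining : bmn remaining.
Proof.
apply: (bmn2 subn); first exact: bmn_cst.
by apply: bmn_sum => i; apply: bmn_bool; exact: measurable_merit.
Qed.

Lemma remaining_permt s t : remaining (permt s t) = remaining t.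
Proof.
rewrite /remaining; congr (_ - _)%N.
by rewrite [RHS](reindex_inj (@perm_inj _ s)); apply: eq_bigr => i _; rewrite merit_permt.
Qed.

Lemma eligible_permt s i t : eligible i (permt s t) = eligible (s i) t.
Proof. by rewrite /eligible merit_permt tnth_mktuple. Qed.

Lemma measurable_exceptional : measurable (exceptional mu q2).
Proof.
have ml q : measurable [set x | F x = q].
  rewrite (_ : [set x | F x = q] = [set x | F x == q]); last first.
    by apply/seteqP; split => x /= /eqP.
  apply/measurable_boolP; apply: measurable_fun_eqr; first exact: measurable_cdf.
  exact: measurable_cst.
apply: measurableU; first by apply: measurableC; exact: measurable_itv.
by rewrite (_ : [set x | _ \/ _] = [set x | F x = 0] `|` [set x | F x = q2])//; exact: measurableU.
Qed.

Lemma exceptional_null : mu (exceptional mu q2) = 0%E.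
Proof.
have ml q : measurable [set x | F x = q].
  rewrite (_ : [set x | F x = q] = [set x | F x == q]); last first.
    by apply/seteqP; split => x /= /eqP.
  apply/measurable_boolP; apply: measurable_fun_eqr; first exact: measurable_cdf.
  exact: measurable_cst.
rewrite null_set_setU//.
- by apply: measurableC; exact: measurable_itv.
- by rewrite (_ : [set x | _ \/ _] = [set x | F x = 0] `|` [set x | F x = q2])//; exact: measurableU.
- exact: (mu_outside hf).
rewrite (_ : [set x | _ \/ _] = [set x | F x = 0] `|` [set x | F x = q2])//.
by rewrite null_set_setU//; exact: (mu_level hf).
Qed.

Lemma aboveE q t : above mu q t = cnt predT (upper mu q) t.
Proof.
rewrite /above /cnt; apply: eq_bigr => i _ /=; congr nat_of_bool.
by apply/idP/idP => [?|/set_mem//]; exact/mem_set.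
Qed.

Lemma cnt_setU (A B : set R) t : A `&` B = set0 ->
  cnt predT (A `|` B) t = (cnt predT A t + cnt predT B t)%N.
Proof.
move=> AB; rewrite /cnt -big_split /=; apply: eq_bigr => i _.
rewrite in_setU; case: (boolP (_ \in A)) => //= /set_mem At.
by rewrite memNset// => Bt; have : (A `&` B) (tnth t i) by []; rewrite AB.
Qed.

Lemma bm_capped r (A : set R) : measurable A ->
  bm (fun t => (minn r (cnt predT A t))%:R : R).
Proof. by move=> mA; apply: (bm_nat (fun j : nat => (minn r j)%:R)); exact: bmn_cnt. Qed.

Lemma Ex_capped r (A : set R) : measurable A ->
  Ex (iid mu n) (fun t => (minn r (cnt predT A t))%:R) = capped n r (fine (mu A)).
Proof.
move=> mA; rewrite (Ex_cnt mu predT (fun j : nat => (minn r j)%:R) mA).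
by rewrite sum1_card card_ord; apply: eq_bern => j _; rewrite minnC.
Qed.

Lemma cdf_type x : ~ exceptional mu q2 x -> [/\ 0 <= x <= 1, 0 < F x & F x != q2].
Proof.
move=> hx; split.
- by apply: contrapT => h; apply: hx; left => /=; rewrite in_itv.
- have /andP[+ _] := cdf01 mu x; rewrite le_eqVlt => /predU1P[e|//].
  by exfalso; apply: hx; right; left.
- by apply/eqP => e; apply: hx; right; right.
Qed.

Section Border.
Variable B : set R.
Hypotheses (mB : measurable B) (BJ : B `<=` lottery_types).
Let B0 : set R := B `&` [set x | 0 < F x < q1].
Let B1 : set R := B `&` [set x | q2 < F x < b].

Lemma mem_B0 x : (x \in B0) = (x \in B) && (0 < F x < q1).
Proof.
by apply/idP/idP => [/set_mem[Bx ->]|/andP[/set_mem Bx h]]; [rewrite mem_set|exact/mem_set].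
Qed.

Lemma mem_B1 x : (x \in B1) = (x \in B) && (q2 < F x < b).
Proof.
by apply/idP/idP => [/set_mem[Bx ->]|/andP[/set_mem Bx h]]; [rewrite mem_set|exact/mem_set].
Qed.

Lemma room t : uniq t -> (forall i, ~ exceptional mu q2 (tnth t i)) ->
  let el := (\sum_(i < n) (eligible i t && (tnth t i \in B)))%N in
  let XB q A := cnt predT (upper mu q `|` A) t in
  let X q := cnt predT (upper mu q) t in
  (minn m (XB b B1) + minn k (X b) + minn m (XB q1 B0) <=
   minn (remaining t) el + minn m (X b) + minn k (XB b B1) + minn m (X q1))%N /\
  (minn m (XB b B1) + minn k (X b) + minn m (XB q1 B0) <=
   minn (remaining t) el + minn m (X b) + minn k (X c) + minn m (X q1))%N.
Proof.
move=> ut hex el XB X.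
have [r1 r2 r3 r4 r5] := reg_le reg.
have XBb : XB b B1 = (above mu b t + cnt predT B1 t)%N.
  rewrite /XB cnt_setU ?aboveE//; apply/seteqP; split => x //= -[bx [_ /andP[_]]].
  by rewrite ltNge bx.
have XBq : XB q1 B0 = (above mu q1 t + cnt predT B0 t)%N.
  rewrite /XB cnt_setU ?aboveE//; apply/seteqP; split => x //= -[bx [_ /andP[_]]].
  by rewrite ltNge bx.
rewrite XBb XBq /X -!aboveE.
pose ub := (\sum_(i < n) [&& tnth t i \in B1, among_highest k t i & (c <= F (tnth t i))%R])%N.
have le_above q q' : q <= q' -> (above mu q' t <= above mu q t)%N.
  move=> qq; apply: leq_sum => i _; case: (leP q' _) => // h.
  by rewrite (le_trans qq h).
apply: (@lottery_room m k (\sum_(i < n) pm i t) (remaining t) el ub _ (above mu q2 t)) => //.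
- by rewrite /remaining subnK// merit_le.
- by apply: (merit_total hkm reg) => // i; left.
- rewrite -!big_split /=; apply: eq_bigr => i _; rewrite /eligible mem_B0 mem_B1.
  have [ti Fi F2] := cdf_type (hex i).
  case: (boolP (tnth t i \in B)) => [/set_mem/BJ h|]; last by rewrite andbF.
  rewrite mem_set//= !andbT; case: h => h.
    rewrite (merit_ic reg ti); last by left.
    move: h => /andP[-> h]; rewrite h /=.
    by rewrite [q2 < _]ltNge (le_trans (ltW h) r2).
  have /andP[h1 h2] := h; rewrite Fi h1 h2 ltNge (le_trans r2 (ltW h1)) /=.
  have [ltc|gec] := ltP (F (tnth t i)) c.
    by rewrite (merit_ic reg ti)//; [rewrite andbF|right; rewrite h1].
  by rewrite (merit_aud reg)// ?gec ?h2// andbT; case: (among_highest _ _ _).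
- by apply: leq_sum => i _; case: (_ \in _); rewrite ?leq_b1.
- rewrite -!(count_highest mu)// -big_split /=; apply: leq_sum => i _.
  rewrite mem_B1; case: (among_highest _ _ _) => /=; last by rewrite andbF.
  have [h|h] := leP b (F (tnth t i)); first by rewrite !andbF /= (le_trans r4 h).
  by rewrite addn0; case: (c <= _)%R; rewrite ?andbF ?leq_b1.
- apply: leq_trans (geq_minl k (above mu c t)).
  rewrite -!(count_highest mu)// -big_split /=; apply: leq_sum => i _.
  rewrite mem_B1; case: (among_highest _ _ _) => /=; last by rewrite andbF.
  have [h|h] := leP b (F (tnth t i)); first by rewrite !andbF /= (le_trans r4 h).
  by rewrite addn0; case: (c <= _)%R; rewrite ?andbF ?leq_b1.
- rewrite -big_split /=; apply: leq_sum => i _; rewrite mem_B1.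
  have [h|h] := leP b (F (tnth t i)); first by rewrite !andbF /= (le_trans (le_trans r3 r4) h).
  by case: (_ \in _) => //=; have [h'|] := ltP q2 _; rewrite //= (ltW h').
- exact: le_above.
- exact: le_above.
- exact: le_above.
Qed.

Lemma merit_border : n%:R * phi * fine (mu B) <=
  Ex (iid mu n) (fun t => (minn (remaining t)
    (\sum_(i < n) (eligible i t && (tnth t i \in B))))%:R).
Proof.
have [r1 r2 r3 r4 r5] := reg_le reg.
have mB0 : measurable B0 by apply: measurableI => //; exact: measurable_between.
have mB1 : measurable B1 by apply: measurableI => //; exact: measurable_between.
have mup q : measurable (upper mu q) by exact: measurable_upper.
have mU0 : measurable (upper mu q1 `|` B0) by exact: measurableU.
have mU1 : measurable (upper mu b `|` B1) by exact: measurableU.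
have fin (A : set R) : measurable A -> mu A \is a fin_num by exact: fin_num_measure.
set u0 := fine (mu B0); set u1 := fine (mu B1).
have BE : fine (mu B) = u0 + u1.
  rewrite -fineD ?fin// -measureU//; last first.
    apply/seteqP; split => x //= -[[_ /andP[_ h1]] [_ /andP[h2 _]]].
    by have := lt_trans (lt_le_trans h1 r2) h2; rewrite ltxx.
  congr (fine (mu _)); apply/seteqP; split => x; last by case=> -[].
  by move=> Bx; case: (BJ Bx) => h; [left|right].
have E0 : fine (mu (upper mu q1 `|` B0)) = 1 - (q1 - u0).
  rewrite measureU//; last first.
    apply/seteqP; split => x //= -[bx [_ /andP[_]]]; by rewrite ltNge bx.
  rewrite fineD ?fin// (mu_upper hf); last by apply/andP; split => //; lra.
  by rewrite /u0; lra.
have E1 : fine (mu (upper mu b `|` B1)) = 1 - (b - u1).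
  rewrite measureU//; last first.
    apply/seteqP; split => x //= -[bx [_ /andP[_]]]; by rewrite ltNge bx.
  rewrite fineD ?fin// (mu_upper hf); last by apply/andP; split => //; lra.
  by rewrite /u1; lra.
have b01 : 0 <= b <= 1 by apply/andP; split => //; lra.
have c01 : 0 <= c <= 1 by apply/andP; split; lra.
have q101 : 0 <= q1 <= 1 by apply/andP; split; lra.
have q201 : 0 <= q2 <= 1 by apply/andP; split; lra.
have u00 : 0 <= u0 by exact: fine_ge0.
have u10 : 0 <= u1 by exact: fine_ge0.
have u0q : u0 <= q1.
  have : fine (mu (upper mu q1 `|` B0)) <= 1.
    by rewrite -lee_fin fineK ?fin//; exact: probability_le1.
  by rewrite E0; lra.
have u1q : q2 <= b - u1.
  have : fine (mu (upper mu b `|` B1)) <= fine (mu (upper mu q2)).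
    rewrite fine_le ?fin// le_meas// => x [h|[_ /andP[/ltW//]]].
    by apply: le_trans h; lra.
  by rewrite E1 (mu_upper hf)//; lra.
set el := fun t => (\sum_(i < n) (eligible i t && (tnth t i \in B)))%N.
have bel : bm (fun t => (minn (remaining t) (el t))%:R : R).
  apply: (bm_nat2 (fun u v => (minn u v)%:R)); first exact: bmn_remaining.
  apply: bmn_sum => i; apply: bmn_bool; apply: measurable_and.
    exact: measurable_eligible.
  by apply: measurable_mem => //; exact: measurable_tnth.
have bc r (A : set R) : measurable A -> bm (fun t => (minn r (cnt predT A t))%:R : R).
  exact: bm_capped.
pose D : set (n.-tuple R) := degenerate 0 (exceptional mu q2).
have mD : measurable D by apply: measurable_degenerate; exact: measurable_exceptional.
have D0 : iid mu n D = 0%E.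
  apply: degenerate_null; [exact: (mu_set1 hf)|exact: measurable_exceptional|].
  exact: exceptional_null.
have good t : ~ D t -> uniq t /\ forall i, ~ exceptional mu q2 (tnth t i).
  by move=> /not_degenerate[h _ /tuple_uniqP].
have h0 : n%:R * phi * u0 <= capped n m (1 - (q1 - u0)) - capped n m (1 - q1).
  have := @reg_border0 _ _ _ _ _ _ _ _ _ reg (q1 - u0).
  rewrite opprB addrCA subrr addr0; apply; lra.
have I1 : capped n m (1 - (b - u1)) + capped n k (1 - b) + capped n m (1 - (q1 - u0)) <=
    Ex (iid mu n) (fun t => (minn (remaining t) (el t))%:R) + capped n m (1 - b) +
    capped n k (1 - (b - u1)) + capped n m (1 - q1).
  rewrite -E0 -E1 -!(mu_upper hf)// -!Ex_capped// -!ExD; do ?[exact: bel|apply: bc => //|apply: bmD].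
  apply: (@Ex_ae_le _ _ _ _ _ _ D) => //; do ?[exact: bel|apply: bc => //|apply: bmD] => // t Dt.
  have [ut hex] := good _ Dt; have [h _] := room ut hex.
  by rewrite -!natrD ler_nat.
have I2 : capped n m (1 - (b - u1)) + capped n k (1 - b) + capped n m (1 - (q1 - u0)) <=
    Ex (iid mu n) (fun t => (minn (remaining t) (el t))%:R) + capped n m (1 - b) +
    capped n k (1 - c) + capped n m (1 - q1).
  rewrite -E0 -E1 -!(mu_upper hf)// -!Ex_capped// -!ExD; do ?[exact: bel|apply: bc => //|apply: bmD].
  apply: (@Ex_ae_le _ _ _ _ _ _ D) => //; do ?[exact: bel|apply: bc => //|apply: bmD] => // t Dt.
  have [ut hex] := good _ Dt; have [_ h] := room ut hex.
  by rewrite -!natrD ler_nat.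
rewrite BE mulrDr.
have := @reg_border1 _ _ _ _ _ _ _ _ _ reg (b - u1).
have -> : b - (b - u1) = u1 by ring.
case; first by rewrite u1q; lra.
  by move=> h; move: h h0 I1; lra.
by move=> h; move: h h0 I2; lra.
Qed.

End Border.

End MeritRule.

(** * The merit-with-guarantee rule *)

Section Slope.
Context (R : realType).
Implicit Types (g c : R -> R) (q d : R).

Lemma right_slope g q d : is_derive q 1 g d ->
  (h^-1 * (g (q + h) - g q)) @[h --> (0 : R)^'+] --> d.
Proof.
move=> [dg <-]; apply: cvg_dnbhs_at_right.
have := dg; rewrite /derive => /cvg_ex[l hl].
rewrite (cvg_lim _ hl)//; apply: cvg_trans hl; apply: near_eq_cvg.
by near=> h; rewrite /= [h *: 1]mulr1 [h + q]addrC.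
Unshelve. all: by end_near. Qed.

Lemma left_slope g q d : is_derive q 1 g d ->
  (h^-1 * (g (q + h) - g q)) @[h --> (0 : R)^'-] --> d.
Proof.
move=> [dg <-]; apply: cvg_dnbhs_at_left.
have := dg; rewrite /derive => /cvg_ex[l hl].
rewrite (cvg_lim _ hl)//; apply: cvg_trans hl; apply: near_eq_cvg.
by near=> h; rewrite /= [h *: 1]mulr1 [h + q]addrC.
Unshelve. all: by end_near. Qed.

Lemma derive_right c q d : derivable c q 1 ->
  (h^-1 * (c (q + h) - c q)) @[h --> (0 : R)^'+] --> d -> 'D_1 c q = d.
Proof.
move=> dc cd; apply/esym; have := right_slope (DeriveDef dc erefl).
exact: cvg_unique cd.
Qed.

Lemma derive_left c q d : derivable c q 1 ->
  (h^-1 * (c (q + h) - c q)) @[h --> (0 : R)^'-] --> d -> 'D_1 c q = d.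
Proof.
move=> dc cd; apply/esym; have := left_slope (DeriveDef dc erefl).
exact: cvg_unique cd.
Qed.

Lemma cvg_maxr (T : Type) (G : set_system T) (u v : T -> R) (a b : R) :
  Filter G -> u x @[x --> G] --> a -> v x @[x --> G] --> b ->
  Num.max (u x) (v x) @[x --> G] --> Num.max a b.
Proof.
move=> FG ua vb; rewrite maxr_absE.
rewrite (_ : (fun x => _) = fun x => (u x + v x + `|u x - v x|) / 2); last first.
  by apply/funext => x; exact: maxr_absE.
apply: cvgM; last exact: cvg_cst.
by apply: cvgD; [exact: cvgD|apply: cvg_norm; exact: cvgB].
Qed.

End Slope.

Section Value.
Context (R : realType) (n m k : nat) (phi : R) (mu : probability R R).
Hypotheses (hkm : (k < m)%N) (hmn : (m < n)%N).
Hypothesis phi0 : 0 <= phi.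
Local Notation F := (type_cdf mu).
Variables (q1 q2 c b : R).
Hypothesis reg : regions n m k phi q1 q2 c b.

Let n0 : n%:R != 0 :> R.
Proof. by rewrite pnatr_eq0 -lt0n (leq_ltn_trans _ hmn). Qed.

Lemma c_phi'_right (q v d : R) (g : R -> R) : q < v -> v <= 1 -> is_derive q 1 g d ->
  (forall x : R, q <= x < v -> c_phi n m k phi x = g x) -> c_phi' n m k phi q = d.
Proof.
move=> qv v1 dg h.
have cd : (h^-1 * (c_phi n m k phi (q + h) - c_phi n m k phi q))
    @[h --> (0 : R)^'+] --> d.
  apply: cvg_trans (right_slope dg); apply: near_eq_cvg; near=> x.
  rewrite !h ?lexx//; apply/andP; split; first by rewrite lerDl.
  by rewrite -ltrBrDl; near: x; apply: nbhs_right_lt; rewrite subr_gt0.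
rewrite /c_phi'; case: ifPn => [/asboolP dc|_]; first exact: derive_right.
by rewrite (lt_le_trans qv v1); apply: cvg_lim.
Unshelve. all: by end_near. Qed.

Lemma value_ic x : 0 <= F x < q1 \/ q2 <= F x < c ->
  merit_with_guarantee n m k phi mu x = phi.
Proof.
have [r1 r2 r3 r4 r5] := reg_le reg.
move=> h; rewrite /merit_with_guarantee.
suff -> : c_phi' n m k phi (F x) = - (n%:R * phi) by rewrite mulrNN mulKf.
have [v [xv v1 hv]] : exists v : R, [/\ F x < v, v <= 1 & forall q : R, F x <= q < v ->
    0 <= q < q1 \/ q2 <= q < c].
  case: h => /andP[h1 h2]; [exists q1|exists c]; split => //; try lra.
    by move=> q /andP[h3 ->]; left; rewrite (le_trans h1 h3).
  by move=> q /andP[h3 ->]; right; rewrite (le_trans h1 h3).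
apply: (c_phi'_right xv v1 (is_derive_ic n m phi _)) => q /hv hq.
have [h1 h2] := reg_ic reg hq; rewrite /c_phi [Num.min (c_aud _ _ _ _) _]min_r//.
by rewrite min_r.
Qed.

Lemma value_aud x : c <= F x < b ->
  merit_with_guarantee n m k phi mu x = top n k (F x) + phi.
Proof.
have [r1 r2 r3 r4 r5] := reg_le reg.
move=> /andP[h1 h2]; rewrite /merit_with_guarantee.
suff -> : c_phi' n m k phi (F x) = - (n%:R * (top n k (F x) + phi)).
  by rewrite mulrNN mulKf.
have d := is_derive_aud n k phi (F x).
rewrite mulrDr opprD; apply: (c_phi'_right h2 r5 d) => q /andP[h3 h4].
have h : c <= q < b by rewrite h4 (le_trans h1 h3).
have [h5 h6] := reg_aud reg h; rewrite /c_phi [Num.min (c_aud _ _ _ _) _]min_l//.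
by rewrite min_r.
Qed.

Lemma value_allo x : q1 <= F x < q2 \/ b <= F x < 1 ->
  merit_with_guarantee n m k phi mu x = top n m (F x).
Proof.
have [r1 r2 r3 r4 r5] := reg_le reg.
move=> h; rewrite /merit_with_guarantee.
suff -> : c_phi' n m k phi (F x) = - (n%:R * top n m (F x)).
  by rewrite mulrNN mulKf.
have [v [xv v1 hv]] : exists v : R, [/\ F x < v, v <= 1 & forall q : R, F x <= q < v ->
    q1 <= q < q2 \/ b <= q <= 1].
  case: h => /andP[h1 h2]; [exists q2|exists 1]; split => //; try lra.
    by move=> q /andP[h3 ->]; left; rewrite (le_trans h1 h3).
  by move=> q /andP[h3 h4]; right; rewrite (le_trans h1 h3) ltW.
apply: (c_phi'_right xv v1 (is_derive_allo n m _)) => q /hv hq.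
have [h1 h2] := reg_allo reg hq; rewrite /c_phi min_l//.
by rewrite le_min h1.
Qed.

Lemma value_top x : F x = 1 -> (0 < k)%N -> phi < m%:R / n%:R ->
  merit_with_guarantee n m k phi mu x = 1.
Proof.
move=> Fx k0 phim; rewrite /merit_with_guarantee Fx.
have n0' : 0 < n%:R :> R by rewrite lt_def n0 ler0n.
suff -> : c_phi' n m k phi 1 = - n%:R by rewrite mulrNN mulVf.
have a1 : c_allo n m (1 : R) = 0 by rewrite c_alloE subrr /capped bern_at0 min0n.
have u1 : c_aud n k phi (1 : R) = 0.
  by rewrite c_audE subrr /capped bern_at0 min0n mulr0 mul0r addr0.
have i1 : 0 < c_ic n m phi 1.
  by rewrite /c_ic mulr1 subr_gt0 mulrC -ltr_pdivlMr.
have p1 : c_phi n m k phi (1 : R) = 0.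
  by rewrite /c_phi a1 u1 [Num.min 0 (c_ic _ _ _ _)]min_l ?(ltW i1)// minxx.
have ci := is_derive_continuous (@is_derive_ic R n m phi).
have ca := is_derive_continuous (@is_derive_allo R n m).
have [e e0 he] : exists2 e : R, 0 < e & forall y : R, `|y - 1| < e ->
    c_allo n m y < c_ic n m phi y.
  have cc : continuous (fun y : R => c_ic n m phi y - c_allo n m y).
    by move=> y; apply: cvgB; [exact: ci|exact: ca].
  have := @continuous_pos_near R _ 1 cc; rewrite a1 subr0 => /(_ i1)[e e0 he].
  by exists e => // y /he; rewrite subr_gt0.
have da := is_derive_allo n m (1 : R); have du := is_derive_aud n k phi (1 : R).
rewrite top_at1 (leq_trans _ hkm)// mulr1 in da.
rewrite top_at1 k0 mulr1 in du.
have cd : (h^-1 * (c_phi n m k phi (1 + h) - c_phi n m k phi 1))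
    @[h --> (0 : R)^'-] --> (- n%:R : R).
  have -> : - n%:R = Num.max (- n%:R) (- n%:R - n%:R * phi) :> R.
    by rewrite max_l// gerBl mulr_ge0// ltW.
  have lm := cvg_maxr (at_left_proper_filter 0 : Filter _) (left_slope da) (left_slope du).
  apply: cvg_trans lm.
  apply: near_eq_cvg; near=> h.
  have h0 : h < 0 by [].
  rewrite p1 a1 u1 !subr0 -minr_nMr ?invr_le0 ?ltW//.
  congr (_ * _); rewrite /c_phi minA [RHS]min_l//.
  rewrite ge_min ltW// he// addrC addKr ltr0_norm// ltrNl; near: h.
  by apply: nbhs_left_gt; rewrite oppr_lt0.
rewrite /c_phi'; case: ifPn => [/asboolP dc|_]; first exact: derive_left.
by rewrite ltxx; apply: cvg_lim.
Unshelve. all: by end_near. Qed.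

End Value.

(** * The lottery *)

Section NullSet.
Context (R : realType) (mu : probability R R) (n : nat).
Variables (r : n.-tuple R -> nat) (el A : 'I_n -> n.-tuple R -> bool).
Variables (p : 'I_n -> n.-tuple R -> R) (N : set R) (w : R -> R).
Hypotheses (mu1 : forall x, mu [set x] = 0%E) (fp : fractional r el p).
Hypotheses (mN : measurable N) (N0 : mu N = 0%E).
Hypotheses (mA : forall i, measurable_fun setT (A i)) (Ar : forall i t, A i t -> (0 < r t)%N).
Local Notation S i x := (condE mu (fun t => (A i t)%:R) i x).
Hypotheses (mw : measurable_fun setT w) (wS : forall i x, 0 <= w x <= S i x).

Let alone i (t : n.-tuple R) : bool := cnt (predC1 i) N t == 0%N.

Let q i t : R := (alone i t)%:R *
  ((tnth t i \in N)%:R * ((A i t)%:R * (w (tnth t i) / S i (tnth t i))) +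
   (tnth t i \notin N)%:R * p i t).

Let ratio01 i x : 0 <= w x / S i x <= 1.
Proof.
have /andP[w0 wle] := wS i x; have S0 := le_trans w0 wle.
rewrite divr_ge0//=; have [S00|Sn0] := eqVneq (S i x) 0.
  by rewrite S00 invr0 mulr0.
by rewrite ler_pdivrMr ?mul1r// lt_def Sn0.
Qed.

Let aloneP i t : alone i t -> forall j, j != i -> tnth t j \notin N.
Proof.
rewrite /alone /cnt sum_nat_eq0 => /forallP h j ji.
by have := h j; rewrite implyTb eqb0 /= ji.
Qed.

Let q01 i t : 0 <= q i t <= 1.
Proof.
rewrite /q; have /andP[p0 p1] := fractional01 i t fp.
have /andP[g0 g1] := ratio01 i (tnth t i).
case: (alone i t); case: (tnth t i \in N); case: (A i t);
  by rewrite /= ?mul0r ?mul1r ?addr0 ?add0r ?mul0r ?mul1r ?g0 ?p0 ?lexx ?ler01.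
Qed.

Let bq i : bm (q i).
Proof.
apply: bm01; last exact: q01.
have mt : measurable_fun setT (fun t : n.-tuple R => tnth t i) by exact: measurable_tnth.
have bA : bm (fun t => (A i t)%:R : R) by exact: bm_bool.
have mS : measurable_fun setT (fun x => S i x) by exact/bm_measurable/bm_condE.
have mm : measurable_fun setT (fun t : n.-tuple R => tnth t i \in N) by exact: measurable_mem.
have mr : measurable_fun setT (fun t : n.-tuple R => w (tnth t i) / S i (tnth t i)).
  rewrite (_ : (fun t => _) = (fun x => w x * (S i x) `^ (-1)) \o (fun t => tnth t i)).
    apply: measurableT_comp => //; apply: measurable_funM => //.
    by apply: (measurableT_comp (measurable_powR (-1))).
  apply/funext => t /=; have /andP[w0 wle] := wS i (tnth t i).
  by rewrite powR_inv1//; exact: le_trans wle.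
have mal : measurable_fun setT (alone i).
  apply: (measurable_nat2 (fun u v => u == v)); last exact: bmn_cst.
  exact: bmn_cnt.
apply: measurable_funM; first exact: (bm_measurable (bm_bool _ mal)).
apply: measurable_funD; apply: measurable_funM.
- exact: (bm_measurable (bm_bool _ mm)).
- by apply: measurable_funM => //; exact: (bm_measurable bA).
- by apply/bm_measurable/bm_bool; exact: measurable_neg.
- by have [] := fp.
Qed.

Let q_supp i t : q i t != 0 -> el i t \/ A i t.
Proof.
rewrite /q; have [_ /(_ i t) pe _] := fp.
case: (A i t); first by right.
case: (el i t) pe => [|/= pe]; first by left.
rewrite mul0r mulr0 add0r (_ : p i t = 0) ?mulr0 ?eqxx//.
by apply/eqP; rewrite eq_le andbC.
Qed.

Let q_sum t : \sum_(i < n) q i t <= (r t)%:R.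
Proof.
have [[i iN]|noN] := pselect (exists i, tnth t i \in N).
  have q0 j : j != i -> q j t = 0.
    move=> ji; rewrite /q; case: (boolP (alone j t)) => [/aloneP/(_ i)|_]; last by rewrite mul0r.
    by rewrite eq_sym ji iN => /(_ isT).
  rewrite (bigD1 i)//= big1// addr0.
  have /andP[qi0 qi1] := q01 i t; case: (posnP (r t)) => [r0|rp]; last first.
    by apply: le_trans qi1 _; rewrite ler1n.
  have Ai : A i t = false by apply/negP => /Ar; rewrite r0.
  by rewrite /q iN Ai /= mul0r mulr0 mul0r addr0 mulr0.
have [_ pe pr] := fp; apply: le_trans (pr t); apply: ler_sum => i _; rewrite /q.
have p0 : 0 <= p i t by have /andP[] := pe i t.
have -> : tnth t i \in N = false by apply/negP => iN; apply: noN; exists i.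
by rewrite /= mul0r add0r mul1r; case: (alone i t); rewrite ?mul1r ?mul0r.
Qed.

Let condE_q i x : condE mu (q i) i x = if x \in N then w x else condE mu (p i) i x.
Proof.
have mD : measurable (@degenerate R n x N) by exact: measurable_degenerate.
have D0 : iid mu n (degenerate x N) = 0%E by exact: degenerate_null.
have lone t : ~ degenerate x N t -> alone i (set_coord i x t).
  move=> /not_degenerate[h _ _]; rewrite /alone /cnt sum_nat_eq0; apply/forallP => j.
  rewrite implyTb eqb0 /= tnth_mktuple; case: (eqVneq j i) => //= ji.
  by apply/negP => /set_mem; exact: h.
have bp i' := fractional_bm i' fp.
have bA : bm (fun t => (A i t)%:R : R) by exact: bm_bool.
case: (boolP (x \in N)) => xN.
  transitivity (Ex (iid mu n) (fun t => w x / S i x * (A i (set_coord i x t))%:R)).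
    apply: (Ex_ae (N := degenerate x N)) => //.
    - exact: bm_set_coord.
    - by apply: bmZ; exact: (bm_set_coord i x bA).
    - move=> t /lone h; rewrite /q h tnth_mktuple eqxx xN /= mul0r addr0 !mul1r.
      by rewrite mulrC.
  rewrite ExZ; last exact: (bm_set_coord i x bA).
  rewrite -/(condE mu (fun t => (A i t)%:R) i x).
  have /andP[w0 wle] := wS i x; have [S00|Sn0] := eqVneq (S i x) 0.
    by rewrite S00 mulr0; apply/eqP; rewrite eq_le w0 /= -S00.
  by rewrite divfK.
apply: (Ex_ae (N := degenerate x N)) => //; try exact: bm_set_coord.
move=> t /lone h; rewrite /q h tnth_mktuple eqxx (negbTE xN) /= mul0r add0r !mul1r.
by [].
Qed.

(* Types in the null set N are served only when no other agent has such a type,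
   an event of probability 1, so that N can be treated separately. *)
Lemma null_set_rule : exists q : 'I_n -> n.-tuple R -> R,
  [/\ forall i, bm (q i), forall i t, 0 <= q i t <= 1,
      forall i t, q i t != 0 -> el i t \/ A i t,
      forall t, \sum_(i < n) q i t <= (r t)%:R &
      forall i x, condE mu (q i) i x = if x \in N then w x else condE mu (p i) i x].
Proof. by exists q. Qed.

End NullSet.

Lemma few_low (m k Xb Xc X1 X2 M : nat) : (k < m)%N ->
  (M + minn k Xb + minn m X2 = minn m Xb + minn k Xc + minn m X1)%N ->
  (X2 <= X1)%N -> (Xc <= X2)%N -> (Xb <= Xc)%N -> (X1 < m)%N -> (M < m)%N.
Proof. lia. Qed.

Lemma few_ic (m k Xb Xc X1 X2 M : nat) : (k < m)%N ->
  (M + minn k Xb + minn m X2 = minn m Xb + minn k Xc + minn m X1)%N ->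
  (X2 <= X1)%N -> (Xc < X2)%N -> (Xb <= Xc)%N -> (Xb < m)%N -> (M < m)%N.
Proof. lia. Qed.

Lemma few_aud (m k Xb Xc X1 X2 M : nat) : (k < m)%N ->
  (M + minn k Xb + minn m X2 = minn m Xb + minn k Xc + minn m X1)%N ->
  (X2 <= X1)%N -> (Xc <= X2)%N -> (Xb < Xc)%N -> (k < Xc)%N -> (Xb < m)%N -> (M < m)%N.
Proof. lia. Qed.

Section Interim.
Context (R : realType) (n m k : nat) (phi : R) (mu : probability R R) (f : R -> R).
Hypotheses (hkm : (k < m)%N) (hmn : (m < n)%N) (phi0 : 0 <= phi).
Hypothesis hf : has_positive_density mu f.
Local Notation F := (type_cdf mu).
Variables (q1 q2 c b : R).
Hypothesis reg : regions n m k phi q1 q2 c b.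

Local Notation pm := (p_merit m k phi mu).
Local Notation top := (top n).
Local Notation above := (above mu).
Local Notation exceptional := (exceptional mu q2).
Local Notation lottery_types := (lottery_types mu q1 q2 b).
Implicit Types (t : n.-tuple R) (i : 'I_n).

Lemma le_above q q' t : q <= q' -> (above q' t <= above q t)%N.
Proof.
move=> qq; apply: leq_sum => i _; case: (leP q' _) => // h.
by rewrite (le_trans qq h).
Qed.

Lemma lt_above q q' t i : q <= F (tnth t i) < q' -> (above q' t < above q t)%N.
Proof.
move=> /andP[qi iq']; rewrite /above (bigD1 i)//= [ltnRHS](bigD1 i)//= qi.
rewrite [q' <= _]leNgt iq' add0n add1n ltnS; apply: leq_sum => j _.
by case: (leP q' _) => // h; rewrite (le_trans (le_trans qi (ltW iq')) h).
Qed.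

Lemma above_rank q r t i : q <= F (tnth t i) -> ~~ among_highest r t i ->
  (r < above q t)%N.
Proof.
rewrite among_highestE -leqNgt => qi h; apply: leq_ltn_trans h _.
rewrite /above (bigD1 i)//= [ltnRHS](bigD1 i)//= qi ltxx add0n add1n ltnS.
apply: leq_sum => j _; case: (boolP (_ < _)) => // /ltW ij.
by rewrite (le_trans qi)// cdf_mono.
Qed.

Lemma merit_room_low t : uniq t ->
  (forall i, ~ exceptional (tnth t i) \/ ~~ among_highest m t i) ->
  (above q1 t < m)%N -> (\sum_(i < n) pm i t < m)%N.
Proof.
have [r1 r2 r3 r4 r5] := reg_le reg.
move=> ut hex; apply: few_low hkm (merit_total hkm reg ut hex) _ _ _;
  exact: le_above.
Qed.

Lemma merit_room_high t i : uniq t ->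
  (forall i, ~ exceptional (tnth t i) \/ ~~ among_highest m t i) ->
  q2 <= F (tnth t i) < b -> (c <= F (tnth t i) -> ~~ among_highest k t i) ->
  (above b t < m)%N -> (\sum_(i < n) pm i t < m)%N.
Proof.
have [r1 r2 r3 r4 r5] := reg_le reg.
move=> ut hex /andP[h1 h2] h; have e := merit_total hkm reg ut hex.
have [ltc|gec] := ltP (F (tnth t i)) c.
  apply: few_ic hkm e _ _ _; try exact: le_above.
  by apply: (@lt_above _ _ t i); rewrite h1 ltc.
apply: few_aud hkm e _ _ _ _; try exact: le_above.
  by apply: (@lt_above _ _ t i); rewrite gec h2.
exact: above_rank gec (h gec).
Qed.

Lemma among_set_coord r i x t : among_highest r (set_coord i x t) i =
  (cnt (predC1 i) `]x, +oo[%classic t < r)%N.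
Proof.
rewrite among_highestE /cnt; congr (_ < _)%N; apply: eq_bigr => j _.
rewrite !tnth_mktuple eqxx /=; case: (eqVneq j i) => /= ji; first by rewrite ltxx.
congr nat_of_bool; apply/idP/idP => [h|/set_mem].
  by apply/mem_set; rewrite /= in_itv /= h.
by rewrite /= in_itv /= andbT.
Qed.

Lemma above_set_coord q i x t : F x < q ->
  above q (set_coord i x t) = cnt (predC1 i) (upper mu q) t.
Proof.
move=> Fx; apply: eq_bigr => j _; rewrite tnth_mktuple /=.
case: (eqVneq j i) => /= ji; first by rewrite leNgt Fx.
by congr nat_of_bool; apply/idP/idP => [?|/set_mem//]; exact/mem_set.
Qed.

Lemma sum_others i : (\sum_(j < n) predC1 i j)%N = n.-1.
Proof.
have := sum1_card (predC1 i); rewrite cardC1 card_ord => <-.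
rewrite [RHS]big_mkcond; apply: eq_bigr => j _.
have -> : (j \in predC1 i) = predC1 i j by [].
by case: (predC1 i j).
Qed.

Lemma Ex_few r i (A : set R) q : measurable A -> fine (mu A) = 1 - q ->
  Ex (iid mu n) (fun t => (cnt (predC1 i) A t < r)%:R) = top r q.
Proof.
move=> mA Aq; rewrite (Ex_cnt mu (predC1 i) (fun j : nat => (j < r)%:R) mA) Aq.
by rewrite sum_others.
Qed.

Lemma bm_few r i (A : set R) : measurable A ->
  bm (fun t => (cnt (predC1 i) A t < r)%:R : R).
Proof. by move=> mA; apply: (bm_nat (fun j : nat => (j < r)%:R)); exact: bmn_cnt. Qed.

Definition merit_prob (x : R) : R :=
  if x \in C_allo n m k phi mu then top m (F x)
  else if x \in C_aud n m k phi mu then top k (F x) else 0.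

Lemma bm_merit i : bm (fun t => (pm i t)%:R : R).
Proof. by apply: bm_bool; exact: measurable_merit. Qed.

Let typical x : set (n.-tuple R) := degenerate x exceptional.

Let measurable_typical x : measurable (typical x).
Proof. by apply: measurable_degenerate; exact: measurable_exceptional. Qed.

Let typical_null x : iid mu n (typical x) = 0%E.
Proof.
apply: degenerate_null; [exact: (mu_set1 hf)|exact: measurable_exceptional|].
exact: (exceptional_null hf).
Qed.

Lemma merit_interim i x : condE mu (fun t => (pm i t)%:R) i x = merit_prob x.
Proof.
have mx : measurable (`]x, +oo[%classic : set R) by exact: measurable_itv.
have ux t : ~ typical x t -> uniq (set_coord i x t).
  by move=> /not_degenerate[_ h1 h2]; exact: uniq_set_coord.
have few r : Ex (iid mu n) (fun t => (among_highest r (set_coord i x t) i)%:R) = top r (F x).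
  rewrite -(Ex_few r i mx (cdf_gt mu x)).
  by apply: eq_Ex => t; rewrite among_set_coord.
have bf r : bm (fun t => (among_highest r (set_coord i x t) i)%:R : R).
  have := bm_few r i mx; congr bm; apply/funext => t; by rewrite among_set_coord.
rewrite /merit_prob /condE; case: ifPn => xa; last case: ifPn => xu.
- rewrite -few; apply: (Ex_ae (N := typical x)) => //.
    exact: (bm_set_coord i x (bm_merit i)).
  move=> t /ux ut; congr ((_ : bool)%:R); rewrite /p_merit ut tnth_mktuple eqxx xa /=.
  by apply/orP/idP => [[//|/andP[_]]|->]; [exact/among_highest_mono/ltnW|left].
- rewrite -few; apply: (Ex_ae (N := typical x)) => //.
    exact: (bm_set_coord i x (bm_merit i)).
  by move=> t /ux ut; rewrite /p_merit ut tnth_mktuple eqxx (negbTE xa) xu.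
- rewrite -[RHS](Ex_cst (iid mu n)); apply: eq_Ex => t.
  by rewrite /p_merit tnth_mktuple eqxx (negbTE xa) (negbTE xu) andbF.
Qed.

(* At a tie of all rules at q2 the type is in C_allo, while the right-derivative
   is that of c_aud: the lottery makes up the difference. *)
Definition lottery_prob (x : R) : R := (0 <= x <= 1)%R%:R *
  (if (F x == 0) || (x \in lottery_types) then phi
   else if (F x == q2) && (q2 < b) then phi - psi n m k q2 else 0).

Definition open_to_lottery i t : bool := ~~ pm i t && (0 < remaining m k phi mu t)%N.

Lemma measurable_open i : measurable_fun setT (open_to_lottery i).
Proof.
apply: measurable_and; first by apply: measurable_neg; exact: measurable_merit.
by apply: (measurable_nat2 (fun u v => u < v)%N); [exact: bmn_cst|exact: bmn_remaining].
Qed.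

Lemma bottom_rank i x t : ~ typical x t -> F x = 0 ->
  ~~ among_highest m (set_coord i x t) i.
Proof.
move=> /not_degenerate[h0 _ _] Fx; rewrite among_set_coord -leqNgt.
apply: (@leq_trans (\sum_(j < n) predC1 i j)).
  by rewrite sum_others -ltnS (ltn_predK hmn).
apply: leq_sum => j _; case: (predC1 i j) => //=.
rewrite mem_set//= in_itv /= andbT ltNge; apply/negP => /(cdf_mono mu).
rewrite Fx => F0; apply: (h0 j); right; left; apply/eqP; rewrite eq_le F0.
by have /andP[] := cdf01 mu (tnth t j).
Qed.

Lemma typical_set_coord i x t : ~ typical x t ->
  (exceptional x -> ~~ among_highest m (set_coord i x t) i) ->
  forall j, ~ exceptional (tnth (set_coord i x t) j) \/
            ~~ among_highest m (set_coord i x t) j.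
Proof.
move=> /not_degenerate[h0 _ _] hx j; have [->|ji] := eqVneq j i.
  rewrite tnth_mktuple eqxx; have [/hx|] := pselect (exceptional x); by [right|left].
by left; rewrite tnth_mktuple (negbTE ji).
Qed.

Lemma exceptional_in (x : R) : 0 <= x <= 1 -> exceptional x -> F x = 0 \/ F x = q2.
Proof. by move=> x01 [/=|//]; rewrite in_itv /= x01. Qed.

Lemma open_low i x t : ~ typical x t -> 0 <= x <= 1 -> F x < q1 ->
  (cnt (predC1 i) (upper mu q1) t < m)%N -> open_to_lottery i (set_coord i x t).
Proof.
have [r1 r2 r3 r4 r5] := reg_le reg.
move=> tx x01 Fx; rewrite -(@above_set_coord q1 i x t Fx) => X1.
have ti : tnth (set_coord i x t) i = x by rewrite tnth_mktuple eqxx.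
have ut : uniq (set_coord i x t).
  by have [_ h1 h2] := not_degenerate tx; exact: uniq_set_coord.
apply/andP; split.
  have /andP[+ _] := cdf01 mu x; rewrite le_eqVlt => /predU1P[e|F0].
    apply: contra (@bottom_rank i x t tx (esym e)); exact: merit_among.
  by rewrite (merit_ic reg)// ti//; left; rewrite F0.
rewrite /remaining subn_gt0; apply: merit_room_low => //.
apply: typical_set_coord => // /(exceptional_in x01)[|e]; first exact: bottom_rank.
by move: Fx; rewrite e ltNge r2.
Qed.

Lemma open_high i x t : ~ typical x t -> 0 <= x <= 1 -> q2 <= F x < b ->
  (cnt (predC1 i) (upper mu b) t < m)%N -> ~~ pm i (set_coord i x t) ->
  open_to_lottery i (set_coord i x t).
Proof.
have [r1 r2 r3 r4 r5] := reg_le reg.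
move=> tx x01 Fx; have /andP[F2 Fb] := Fx.
rewrite -(@above_set_coord b i x t Fb) => Xb npm; rewrite /open_to_lottery npm /= /remaining subn_gt0.
have ti : tnth (set_coord i x t) i = x by rewrite tnth_mktuple eqxx.
have ut : uniq (set_coord i x t).
  by have [_ h1 h2] := not_degenerate tx; exact: uniq_set_coord.
have ex : F x = 0 \/ F x = q2 -> ~~ among_highest m (set_coord i x t) i.
  case=> e; first exact: bottom_rank.
  have /andP[+ _] := cdf01 mu x; rewrite le_eqVlt => /predU1P[e'|F0].
    exact: bottom_rank.
  have q2p : 0 < q2 by rewrite -e.
  have q2b : q2 < b by rewrite -e.
  have [h1 h2] := reg_q2 reg q2p q2b.
  apply: contra npm => am; rewrite /p_merit ut /=; apply/orP; left.
  by rewrite am ti andbT mem_set// /C_allo /= e.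
apply: (@merit_room_high _ i) => //.
- by apply: typical_set_coord => // /(exceptional_in x01).
- by rewrite ti.
- rewrite ti => cF; have [/ex h|h] := pselect (F x = 0 \/ F x = q2).
    apply: contra h; exact/among_highest_mono/ltnW.
  rewrite -(merit_aud (mu := mu) reg) ?ti ?cF//.
  by rewrite lt_def F2 andbT; apply/eqP => e; apply: h; right.
Qed.

Lemma bm_open i : bm (fun t => (open_to_lottery i t)%:R : R).
Proof. by apply: bm_bool; exact: measurable_open. Qed.

Lemma open_low_prob i (x : R) : 0 <= x <= 1 -> F x < q1 ->
  top m q1 <= condE mu (fun t => (open_to_lottery i t)%:R) i x.
Proof.
have [r1 r2 r3 r4 r5] := reg_le reg.
move=> x01 Fx; have mq := measurable_upper mu q1.
have q101 : 0 <= q1 <= 1 by apply/andP; split; lra.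
rewrite -(Ex_few m i mq (mu_upper hf q101)).
apply: (Ex_ae_le (N := typical x)) => //.
- exact: bm_few.
- exact: (bm_set_coord i x (bm_open i)).
by move=> t tx; rewrite ler_nat; case: ltnP => // h; rewrite open_low.
Qed.

Lemma open_high_prob i (x : R) : 0 <= x <= 1 -> q2 <= F x < b ->
  top m b - merit_prob x <= condE mu (fun t => (open_to_lottery i t)%:R) i x.
Proof.
have [r1 r2 r3 r4 r5] := reg_le reg.
move=> x01 Fx; have mb := measurable_upper mu b.
have b01 : 0 <= b <= 1 by apply/andP; split => //; lra.
rewrite lerBlDr -(Ex_few m i mb (mu_upper hf b01)) -(merit_interim i).
have bo := bm_set_coord i x (bm_open i); have bp := bm_set_coord i x (bm_merit i).
rewrite /condE -ExD//.
apply: (Ex_ae_le (N := typical x)) => //.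
- exact: bm_few.
- exact: bmD.
move=> t tx; rewrite -natrD ler_nat; case: ltnP => // h.
by case: (boolP (pm i _)) => [_|/(open_high tx x01 Fx h)->]; rewrite ?addn1.
Qed.

Lemma merit_prob_allo (x : R) : 0 <= x <= 1 ->
  c_allo n m (F x) <= c_aud n k phi (F x) -> c_allo n m (F x) <= c_ic n m phi (F x) ->
  merit_prob x = top m (F x).
Proof. by move=> x01 h1 h2; rewrite /merit_prob mem_set. Qed.

Lemma merit_prob_aud (x : R) : 0 <= x <= 1 -> c <= F x < b -> q2 < F x ->
  merit_prob x = top k (F x).
Proof.
move=> x01 h h'; have [h1 h2] := reg_aud reg h; have h3 := reg_aud_strict reg h h'.
rewrite /merit_prob memNset; last by case=> _; rewrite leNgt h3.
by rewrite mem_set.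
Qed.

Lemma merit_prob_ic (x : R) : 0 < F x < q1 \/ q2 < F x < c -> merit_prob x = 0.
Proof.
move=> h; have [h1 h2] := reg_ic_strict reg h.
rewrite /merit_prob memNset; last by case=> _ _; rewrite leNgt h2.
by rewrite memNset//; case=> _ _; rewrite leNgt h1.
Qed.

Lemma merit_prob_bottom (x : R) : F x = 0 -> merit_prob x = 0.
Proof.
have kn := ltn_trans hkm hmn.
by move=> F0; rewrite /merit_prob F0 !top_at0//; case: ifP => // _; case: ifP.
Qed.

Lemma lottery_prob_bounds i (x : R) :
  0 <= lottery_prob x <= condE mu (fun t => (open_to_lottery i t)%:R) i x.
Proof.
have kn := ltn_trans hkm hmn.
have [r1 r2 r3 r4 r5] := reg_le reg.
have S0 : 0 <= condE mu (fun t => (open_to_lottery i t)%:R) i x by exact: Ex_ge0.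
rewrite /lottery_prob; case: (boolP (0 <= x <= 1)) => x01; last by rewrite mul0r lexx.
rewrite mul1r; have /andP[F0 F1] := cdf01 mu x.
have low : F x < q1 -> phi <= condE mu (fun t => (open_to_lottery i t)%:R) i x.
  move=> Fq; apply: le_trans (open_low_prob i x01 Fq); apply: (reg_top_q1 reg).
  exact: le_lt_trans Fq.
have high : q2 <= F x < b -> merit_prob x <= top k b ->
    phi <= condE mu (fun t => (open_to_lottery i t)%:R) i x.
  move=> Fq mb; apply: le_trans (open_high_prob i x01 Fq).
  have /andP[h1 h2] := Fq.
  have := reg_psi_b reg (le_lt_trans h1 h2); rewrite /psi; lra.
have topb0 : 0 <= top k b by apply: top_ge0; apply/andP; split => //; lra.
case: ifPn => [/orP[/eqP e|/set_mem[/andP[h1 h2]|/andP[h1 h2]]]|_].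
- rewrite phi0 /=; have [h|h] := ltP 0 q1; first by apply: low; rewrite e.
  have [q20 b0] := reg_bot reg (le_anti (introT andP (conj h r1))).
  by apply: high; rewrite ?e ?q20 ?lexx ?b0// merit_prob_bottom.
- by rewrite phi0 low.
- rewrite phi0 high//; first by rewrite ltW.
  have [ltc|gec] := ltP (F x) c; first by rewrite merit_prob_ic//; right; rewrite h1.
  by rewrite merit_prob_aud ?gec ?h2// top_mono// ltW.
- case: ifPn => [/andP[/eqP e q2b]|_]; last by rewrite lexx S0.
  have [q20|q20] := eqVneq q2 0.
    rewrite /psi q20 !top_at0// subr0 subr0 phi0 high//.
      by rewrite e lexx.
    by rewrite merit_prob_bottom// e.
  have q2p : 0 < q2 by rewrite lt_def q20 (le_trans r1).
  rewrite subr_ge0 (reg_psi_q2 reg)//=.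
  have [h1 h2] := reg_q2 reg q2p q2b; rewrite -e in h1 h2.
  have e2 := merit_prob_allo x01 h1 h2.
  have Fq : q2 <= F x < b by rewrite e lexx.
  apply: le_trans (open_high_prob i x01 Fq); rewrite e2 /psi e.
  have := reg_psi_b reg q2b; rewrite /psi.
  have : top k q2 <= top k b by apply: top_mono => //; lra.
  lra.
Qed.

Lemma lottery_prob_contested (x : R) :
  ((C_aud n m k phi mu `|` C_ic n m k phi mu) `\` C_allo n m k phi mu) x ->
  lottery_prob x = phi.
Proof.
have [r1 r2 r3 r4 r5] := reg_le reg.
move=> [h nallo]; have x01 : 0 <= x <= 1 by case: h => -[].
have /andP[F0 F1] := cdf01 mu x.
have nal q : ~ (q = F x /\ c_allo n m q <= c_aud n k phi q /\ c_allo n m q <= c_ic n m phi q).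
  by move=> [-> [h1 h2]]; exact: nallo.
rewrite /lottery_prob x01 mul1r ifT//.
have [//|F0'] := eqVneq (F x) 0; apply/orP; right; apply/mem_set.
have Fp : 0 < F x by rewrite lt_def F0' F0.
have [lt1|ge1] := ltP (F x) q1; first by left; rewrite Fp.
have lt2 : q2 <= F x.
  by rewrite leNgt; apply/negP => lt2; apply: (nal (F x)); split => //;
    apply: (reg_allo reg); left; rewrite ge1.
have ltb : F x < b.
  by rewrite ltNge; apply/negP => geb; apply: (nal (F x)); split => //;
    apply: (reg_allo reg); right; rewrite geb.
right; rewrite ltb andbT lt_def lt2 andbT; apply/eqP => e.
by apply: (nal q2); split => //; apply: (reg_q2 reg); rewrite -e.
Qed.

Lemma merit_lottery_value (x : R) : 0 <= x <= 1 ->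
  (x = 1 -> (0 < k)%N /\ phi < m%:R / n%:R) ->
  merit_prob x + lottery_prob x = merit_with_guarantee n m k phi mu x.
Proof.
have kn := ltn_trans hkm hmn.
have [r1 r2 r3 r4 r5] := reg_le reg.
move=> x01 hx; have /andP[F0 F1] := cdf01 mu x.
rewrite /lottery_prob x01 mul1r.
have [F0'|F0'] := eqVneq (F x) 0.
  rewrite merit_prob_bottom// add0r.
  have [h|h] := ltP 0 q1; first by rewrite (value_ic hmn reg)//; left; rewrite F0' lexx.
  have [q20 b0] := reg_bot reg (le_anti (introT andP (conj h r1))).
  have [h'|h'] := ltP 0 c.
    by rewrite (value_ic hmn reg)//; right; rewrite F0' q20 lexx.
  by rewrite (value_aud hmn reg) F0' ?top_at0 ?add0r ?h' ?b0.
have Fp : 0 < F x by rewrite lt_def F0' F0.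
have [lt1|ge1] := ltP (F x) q1.
  rewrite merit_prob_ic; last by left; rewrite Fp.
  rewrite mem_set/=; last by left; rewrite Fp.
  by rewrite add0r (value_ic hmn reg)//; left; rewrite F0.
have nlow : ~ (0 < F x < q1) by rewrite [F x < q1]ltNge ge1 andbF.
have [lt2|ge2] := ltP (F x) q2.
  have h : q1 <= F x < q2 by rewrite ge1.
  have [h1 h2] := reg_allo reg (or_introl h).
  rewrite merit_prob_allo// memNset/=; last first.
    by case=> // /andP[]; rewrite ltNge (ltW lt2).
  by rewrite (lt_eqF lt2) /= addr0 (value_allo hmn reg)//; left.
have [ltb|geb] := ltP (F x) b; last first.
  have h : b <= F x <= 1 by rewrite geb.
  have [h1 h2] := reg_allo reg (or_intror h).
  rewrite merit_prob_allo// memNset/=; last first.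
    by case=> // /andP[_]; rewrite ltNge geb.
  have -> : (F x == q2) && (q2 < b) = false.
    by apply/negP => /andP[/eqP e]; rewrite -e ltNge geb.
  rewrite addr0; move: F1; rewrite le_eqVlt => /predU1P[e|F1].
    have [k0 phim] : (0 < k)%N /\ phi < m%:R / n%:R.
      apply: hx; apply: (cdf_inj hf) => //; first by rewrite ler01 lexx.
      by rewrite e (cdf1 hf).
    by rewrite e (value_top hkm hmn phi0 e)// top_at1 (leq_trans _ hkm).
  by rewrite (value_allo hmn reg)//; right; rewrite geb.
move: ge2; rewrite le_eqVlt => /predU1P[e|ge2].
  have q2p : 0 < q2 by rewrite e.
  have q2b : q2 < b by rewrite e.
  have cq := reg_c reg q2p.
  have [h1 h2] := reg_q2 reg q2p q2b; rewrite e in h1 h2.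
  rewrite merit_prob_allo// memNset/=; last by case=> // /andP[]; rewrite e ltxx.
  rewrite e eqxx ltb /= (value_aud hmn reg) ?cq ?e ?lexx// /psi; ring.
rewrite mem_set /=; last by right; rewrite ge2.
have [ltc|gec] := ltP (F x) c.
  rewrite merit_prob_ic; last by right; rewrite ge2.
  by rewrite add0r (value_ic hmn reg)//; right; rewrite (ltW ge2).
by rewrite merit_prob_aud ?gec// (value_aud hmn reg)// gec.
Qed.

End Interim.

Section Lottery.
Context (R : realType) (n m k : nat) (phi : R) (mu : probability R R) (f : R -> R).
Hypotheses (hkm : (k < m)%N) (hmn : (m < n)%N) (hphi : 0 <= phi <= m%:R / n%:R).
Hypothesis hf : has_positive_density mu f.
Local Notation F := (type_cdf mu).
Local Notation pm := (p_merit m k phi mu).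
Local Notation U := (uniform_prob (@ltr01 R)).
Local Notation rem := (remaining m k phi mu).

Lemma measurable_lottery_prob (q1 q2 b : R) :
  measurable_fun setT (lottery_prob n m k phi mu q1 q2 b).
Proof.
have mF := measurable_cdf mu.
have mFq (q : R) : measurable_fun setT (fun x => F x == q).
  by apply: measurable_fun_eqr => //; exact: measurable_cst.
have mle (x : R) : measurable_fun setT (fun y : R => x <= y).
  by apply: measurable_fun_ler; [exact: measurable_cst|exact: measurable_id].
apply: measurable_funM.
  have : measurable_fun setT (fun x : R => 0 <= x <= 1).
    by apply: measurable_and => //; apply: measurable_fun_ler;
      [exact: measurable_id|exact: measurable_cst].
  by move=> h; exact: (bm_measurable (bm_bool _ h)).
apply: measurable_fun_ifT.
- apply: measurable_or => //; apply: measurable_mem; first exact: measurable_id.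
  exact: measurable_lottery_types.
- exact: measurable_cst.
apply: measurable_fun_ifT; try exact: measurable_cst.
by apply: measurable_and => //; exact: measurable_cst.
Qed.

Lemma fractional_lottery : exists (q1 q2 c b : R) (q : 'I_n -> n.-tuple R -> R),
  regions n m k phi q1 q2 c b /\
  [/\ forall i, bm (q i), forall i t, 0 <= q i t <= 1,
      forall i t, pm i t -> q i t = 0,
      forall t, \sum_(i < n) q i t <= (rem t)%:R &
      forall i x, 0 <= x <= 1 ->
        condE mu (q i) i x = lottery_prob n m k phi mu q1 q2 b x].
Proof.
have phi0 : 0 <= phi by case/andP: hphi.
have n0 : (0 < n)%N by exact: leq_ltn_trans hmn.
have [q1 [q2 [c [b reg]]]] := regions_exist hkm hmn hphi.
exists q1, q2, c, b.
have [p [fp [N [mN N0 pN]]]] := interim_exact n0 phi0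
  (measurable_lottery_types mu q1 q2 b) (bmn_remaining n m k phi mu)
  (measurable_eligible m k phi mu q1 q2 b) (remaining_permt m k phi mu)
  (eligible_permt m k phi mu q1 q2 b) (merit_border hkm hf reg).
have mX : measurable (exceptional mu q2) by exact: measurable_exceptional.
pose N' := N `|` exceptional mu q2.
have mN' : measurable N' by exact: measurableU.
have N'0 : mu N' = 0%E.
  by rewrite null_set_setU//; exact: (exceptional_null hf).
have [q [bq q01 qs qr qc]] := null_set_rule (mu_set1 hf) fp mN' N'0
  (measurable_open m k phi mu) (fun i t h => proj2 (andP h))
  (measurable_lottery_prob q1 q2 b) (lottery_prob_bounds hkm hmn phi0 hf reg).
exists q; split => //; split => //.
  move=> i t pit; apply/eqP; apply: contraT => /qs[]; by rewrite /eligible /open_to_lottery pit ?andbF.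
move=> i x x01; rewrite qc; case: ifPn => // /negP xN.
have Nx : ~ N x by move=> Nx; apply: xN; apply/mem_set; left.
have Xx : ~ exceptional mu q2 x by move=> Nx'; apply: xN; apply/mem_set; right.
have [Jx|Jx] := pselect (lottery_types mu q1 q2 b x).
  by rewrite pN// /lottery_prob x01 mul1r [x \in _]mem_set// orbT.
have [_ Fx0 Fx2] := cdf_type Xx.
rewrite /lottery_prob x01 [x \in _]memNset// (negbTE Fx2) gt_eqF//= mulr0.
rewrite -[RHS](Ex_cst (iid mu n)); apply: eq_Ex => t.
have [_ pe _] := fp; apply/eqP; rewrite eq_le andbC; have := pe i (set_coord i x t).
by rewrite /eligible tnth_mktuple eqxx [x \in _]memNset.
Qed.

Lemma interim_Ex (p : 'I_n -> n.-tuple R -> R -> nat) i x :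
  bm (fun w : n.-tuple R * R => (p i (set_coord i x w.1) w.2)%:R : R) ->
  interim mu p i x =
  (Ex (iid mu n) (fun t => Ex U (fun s => (p i (set_coord i x t) s)%:R)))%:E.
Proof.
move=> bp; rewrite /interim unlock Ex_fin//; congr EFin.
by rewrite Ex_prod1.
Qed.

Lemma bm_rule (p : 'I_n -> n.-tuple R -> R -> bool) i x :
  measurable_fun setT (fun w : n.-tuple R * R => p i w.1 w.2) ->
  bm (fun w : n.-tuple R * R => (p i (set_coord i x w.1) w.2)%:R : R).
Proof.
move=> mp; apply: bm_bool.
apply: (measurableT_comp (f := fun w : n.-tuple R * R => p i w.1 w.2)
  (g := fun w : n.-tuple R * R => (set_coord i x w.1, w.2))) => //.
apply/measurable_fun_pairP; split => /=; last exact: measurable_snd.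
by apply: measurable_set_coord; [exact: measurable_cst|exact: measurable_fst].
Qed.

End Lottery.

Theorem proposition1 (R : realType) (n m k : nat) (hkm : (k < m)%N)
    (hmn : (m < n)%N) (mu : probability R R) (f : R -> R)
    (hf : has_positive_density mu f)
    (phi : R) (hphi : 0 <= phi <= m%:R / n%:R) :
  exists pl : rule R n,
    let pm : 'I_n -> n.-tuple R -> bool := p_merit m k phi mu in
    [/\ lottery_based m k phi mu pl,
        forall i t s, profile_in_T t -> 0 <= s <= 1 ->
          (pm i t + pl i t s)%N \in [:: 0; 1]%N,
        forall t s, profile_in_T t -> 0 <= s <= 1 ->
          (\sum_(i < n) (pm i t + pl i t s) <= m)%N
      & forall i t, 0 <= t <= 1 ->
          (t = 1 -> (0 < k)%N /\ phi < m%:R / n%:R) ->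
          interim mu (fun j u s => (pm j u + pl j u s)%N) i t
          = (merit_with_guarantee n m k phi mu t)%:E].
Proof.
have phi0 : 0 <= phi by case/andP: hphi.
have [q1 [q2 [c [b [q [reg [bq q01 qm qr qc]]]]]]] := fractional_lottery hkm hmn hphi hf.
have q0 i t : 0 <= q i t by have /andP[] := q01 i t.
exists (rounding q) => pm.
have sum_pl t s : 0 <= s <= 1 ->
    (\sum_(i < n) rounding q i t s <= m - \sum_(i < n) pm i t)%N.
  by case/andP=> s0 _; exact: rounding_sum.
have pl0 i t s : pm i t -> rounding q i t s = false.
  by move=> pit; apply: rounding_eq0; exact: qm.
have mpl i := measurable_rounding i bq.
have ipl i x : Ex (iid mu n) (fun t => Ex (uniform_prob (@ltr01 R))
    (fun s => (rounding q i (set_coord i x t) s)%:R)) = condE mu (q i) i x.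
  by apply: eq_Ex => t; rewrite rounding_prob.
split.
- split => //.
  + by split => // t s _ s01; apply: leq_trans (sum_pl t s s01) _; exact: leq_subr.
  + by move=> t s _; exact: sum_pl.
  + by move=> i t s _ _; exact: pl0.
  move=> i x /set_mem hx; have x01 : 0 <= x <= 1 by case: hx => -[] [].
  rewrite interim_Ex; last exact: (bm_rule (p := rounding q) x (mpl i)).
  by rewrite ipl qc// (lottery_prob_contested reg hx).
- move=> i t s _ _; case: (boolP (pm i t)) => [/pl0 ->//|_].
  by case: (rounding _ _ _ _).
- move=> t s _ s01; rewrite big_split /=.
  by rewrite -leq_subRL ?sum_pl// (merit_le phi mu hkm).
move=> i x x01 hx.
have bpl := bm_rule (p := rounding q) x (mpl i).
have bpm : bm (fun w : n.-tuple R * R => (pm i (set_coord i x w.1))%:R : R).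
  apply: (bm_rule (p := fun j u _ => pm j u)).
  by apply: (measurableT_comp (measurable_merit m k phi mu i)); exact: measurable_fst.
rewrite interim_Ex; last first.
  by rewrite (_ : (fun w => _) = fun w => (pm i (set_coord i x w.1))%:R +
    (rounding q i (set_coord i x w.1) w.2)%:R);
    [exact: bmD|apply/funext => w; rewrite natrD].
congr EFin; rewrite -(merit_lottery_value hkm hmn phi0 hf reg x01 hx).
rewrite -(merit_interim phi hkm hf q2 i) -(qc i)//.
rewrite -ipl /condE -ExD.
- apply: eq_Ex => t; rewrite -[X in _ = X + _](Ex_cst (uniform_prob (@ltr01 R))) -ExD.
  + by apply: eq_Ex => s; rewrite natrD.
  + exact: bm_cst.
  exact: (bm_pair1 _ bpl).
- exact: (bm_set_coord i x (bm_merit m k phi mu i)).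
exact: (@bm_Ex1 _ _ _ _ R (iid mu n) (uniform_prob (@ltr01 R)) _ bpl).
Qed.
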